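(* Let $A$ be an $n\times n$ symmetrizable generalized Cartan matrix and $\Sigma=\{\beta_i\}_{i=1}^m$ a $\pi$-system of type $B$ in $A$. For each $1\le i\le m$, let $e_{\beta_i}$ and $e_{-\beta_i}$ be non-zero elements of the root spaces $\mathfrak g(A)_{\beta_i}$ and $\mathfrak g(A)_{-\beta_i}$ respectively, such that $[e_{\beta_i},e_{-\beta_i}]=\beta_i^\vee$. Let $e_i,f_i$ ($1\le i\le m$) be the Chevalley generators of $\mathfrak g(B)$ and $h_i=[e_i,f_i]$. Then there exists a unique Lie algebra homomorphism $i_\Sigma:\mathfrak g'(B)\to\mathfrak g'(A)$ such that $e_i\mapsto e_{\beta_i}$, $f_i\mapsto e_{-\beta_i}$, $h_i\mapsto\beta_i^\vee$ for all $i$.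
   Context: A generalized Cartan matrix (GCM) is an integer $n\times n$ matrix $A=(a_{ij})$ with $a_{ii}=2$, $a_{ij}\le 0$ for $i\ne j$, and $a_{ij}=0$ whenever $a_{ji}=0$. It is symmetrizable if $DA$ is symmetric for some diagonal matrix $D$ with positive rational diagonal entries. $\mathfrak{g}(A)$ is the associated Kac-Moody algebra over $\mathbb{C}$ and $\mathfrak g'(A)=[\mathfrak g(A),\mathfrak g(A)]$ its derived subalgebra. For a real root $\beta=w\alpha_i$ ($w$ in the Weyl group, $\alpha_i$ a simple root) the coroot is $\beta^\vee=w(\alpha_i^\vee)$. A $\pi$-system in $A$ is a finite set of distinct real roots $\{\beta_1,\dots,\beta_m\}$ of $\mathfrak{g}(A)$ such that $\beta_i-\beta_j$ is not a root for all $i\neq j$ (linear independence is not assumed). Its type is the matrix $B=(\langle\beta_i^\vee,\beta_j\rangle)_{i,j}$, which is a GCM and is symmetrizable when $A$ is. *)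

(* Defs.v *)
From HB Require Import structures.
From mathcomp Require Import all_boot all_order all_algebra.
From mathcomp Require Import boolp classical_sets reals.

Set Implicit Arguments.
Unset Strict Implicit.
Unset Printing Implicit Defensive.

Import GRing.Theory.
Local Open Scope ring_scope.
Local Open Scope quotient_scope.

HB.mixin Record Lmodule_isLie (K : pzRingType) L of GRing.Lmodule K L := {
  lie : L -> L -> L;
  lieDl : forall x y z, lie (x + y) z = lie x z + lie y z;
  lieDr : forall x y z, lie x (y + z) = lie x y + lie x z;
  lieZl : forall (a : K) x y, lie (a *: x) y = a *: lie x y;
  lieZr : forall (a : K) x y, lie x (a *: y) = a *: lie x y;
  liexx : forall x, lie x x = 0;
  lie_jacobi : forall x y z,
    lie x (lie y z) + lie y (lie z x) + lie z (lie x y) = 0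
}.

#[short(type="lieAlgType")]
HB.structure Definition LieAlgebra (K : pzRingType) :=
  { L of GRing.Lmodule K L & Lmodule_isLie K L }.

Notation "[ 'lie' x , y ]" := (lie x y) (at level 0, x, y at level 99).

Definition lie_hom (K : pzRingType) (L M : lieAlgType K) (f : L -> M) : Prop :=
  linear f /\ forall x y, f [lie x, y] = [lie f x, f y].

Section LieBasics.
Variables (K : pzRingType) (L : lieAlgType K).
Implicit Types x y z : L.

Lemma lie0l y : [lie (0 : L), y] = 0.
Proof. by rewrite -[X in lie X _](scale0r 0) lieZl scale0r. Qed.

Lemma lie0r x : [lie x, (0 : L)] = 0.
Proof. by rewrite -[X in lie _ X](scale0r 0) lieZr scale0r. Qed.

Lemma lieBl x y z : [lie x - y, z] = [lie x, z] - [lie y, z].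
Proof. by rewrite -scaleN1r lieDl lieZl scaleN1r. Qed.

Lemma lieBr x y z : [lie x, y - z] = [lie x, y] - [lie x, z].
Proof. by rewrite -scaleN1r lieDr lieZr scaleN1r. Qed.

Lemma lieC x y : [lie x, y] = - [lie y, x].
Proof.
apply/eqP; rewrite -addr_eq0; apply/eqP.
have := liexx (x + y).
by rewrite lieDl !lieDr !liexx add0r addr0.
Qed.

End LieBasics.

Record lieIdeal (K : pzRingType) (L : lieAlgType K) := LieIdeal {
  ideal_mem : L -> Prop;
  ideal0 : ideal_mem 0;
  idealD : forall x y, ideal_mem x -> ideal_mem y -> ideal_mem (x + y);
  idealZ : forall (a : K) x, ideal_mem x -> ideal_mem (a *: x);
  ideal_lie : forall x y, ideal_mem y -> ideal_mem [lie x, y]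
}.

Coercion ideal_mem : lieIdeal >-> Funclass.

Section LieQuotient.
Variables (K : pzRingType) (L : lieAlgType K) (I : lieIdeal L).
Implicit Types x y z : L.

Definition ideal_eqv : rel L := fun x y => `[< I (x - y) >].

Lemma idealN x : I x -> I (- x).
Proof. by move=> Ix; rewrite -scaleN1r; apply: idealZ. Qed.

Lemma ideal_eqv_refl : reflexive ideal_eqv.
Proof. by move=> x; apply/asboolP; rewrite subrr; apply: ideal0. Qed.

Lemma ideal_eqv_sym : symmetric ideal_eqv.
Proof.
by move=> x y; apply/asboolP/asboolP => /idealN; rewrite opprB.
Qed.

Lemma ideal_eqv_trans : transitive ideal_eqv.
Proof.
move=> y x z /asboolP xy /asboolP yz; apply/asboolP.
by rewrite -(subrK y x) -addrA; apply: idealD.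
Qed.

Canonical ideal_equiv :=
  EquivRel ideal_eqv ideal_eqv_refl ideal_eqv_sym ideal_eqv_trans.

Definition lie_quot := {eq_quot ideal_eqv}.

HB.instance Definition _ : EqQuotient L ideal_eqv lie_quot :=
  EqQuotient.on lie_quot.
HB.instance Definition _ := Choice.on lie_quot.

Definition quot_pi (x : L) : lie_quot := \pi_lie_quot x.

Lemma quot_piP x y : quot_pi x = quot_pi y <-> I (x - y).
Proof.
split=> [/eqmodP|Ixy]; first by move/asboolP.
by apply/eqmodP/asboolP.
Qed.

Lemma quot_pi_repr (q : lie_quot) : quot_pi (repr q) = q.
Proof. exact: reprK. Qed.

Lemma repr_quot_pi x : I (repr (quot_pi x) - x).
Proof. by apply/quot_piP; rewrite quot_pi_repr. Qed.

Definition quot_add (p q : lie_quot) := quot_pi (repr p + repr q).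
Definition quot_opp (p : lie_quot) := quot_pi (- repr p).
Definition quot_scale (a : K) (p : lie_quot) := quot_pi (a *: repr p).
Definition quot_lie (p q : lie_quot) := quot_pi [lie repr p, repr q].

Lemma quot_addE x y : quot_add (quot_pi x) (quot_pi y) = quot_pi (x + y).
Proof.
apply/quot_piP; rewrite opprD addrACA.
by apply: idealD; apply: repr_quot_pi.
Qed.

Lemma quot_oppE x : quot_opp (quot_pi x) = quot_pi (- x).
Proof. by apply/quot_piP; rewrite -opprD; apply/idealN/repr_quot_pi. Qed.

Lemma quot_scaleE a x : quot_scale a (quot_pi x) = quot_pi (a *: x).
Proof. by apply/quot_piP; rewrite -scalerBr; apply/idealZ/repr_quot_pi. Qed.

Lemma quot_lieE x y : quot_lie (quot_pi x) (quot_pi y) = quot_pi [lie x, y].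
Proof.
apply/quot_piP; set x' := repr _; set y' := repr _.
rewrite -(subrK [lie x', y] [lie x', y']) -addrA -lieBr -lieBl.
apply: idealD; first by apply/ideal_lie/repr_quot_pi.
by rewrite lieC; apply/idealN/ideal_lie/repr_quot_pi.
Qed.

Let quotW (P : lie_quot -> Prop) : (forall x, P (quot_pi x)) -> forall q, P q.
Proof. by move=> HP q; rewrite -[q]quot_pi_repr. Qed.

Lemma quot_addA : associative quot_add.
Proof.
by do 3!elim/quotW => ?; rewrite !quot_addE addrA.
Qed.

Lemma quot_addC : commutative quot_add.
Proof. by do 2!elim/quotW => ?; rewrite !quot_addE addrC. Qed.

Lemma quot_add0 : left_id (quot_pi 0) quot_add.
Proof. by elim/quotW => ?; rewrite !quot_addE add0r. Qed.

Lemma quot_addN : left_inverse (quot_pi 0) quot_opp quot_add.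
Proof. by elim/quotW => ?; rewrite quot_oppE !quot_addE addNr. Qed.

HB.instance Definition _ :=
  GRing.isZmodule.Build lie_quot quot_addA quot_addC quot_add0 quot_addN.

Lemma quot_scaleA a b p : quot_scale a (quot_scale b p) = quot_scale (a * b) p.
Proof. by elim/quotW: p => ?; rewrite !quot_scaleE scalerA. Qed.

Lemma quot_scale1 : left_id 1 quot_scale.
Proof. by elim/quotW => ?; rewrite !quot_scaleE scale1r. Qed.

Lemma quot_scaleDr : right_distributive quot_scale +%R.
Proof.
move=> a; do 2!elim/quotW => ?.
by rewrite -![_ + _]/(quot_add _ _) !(quot_addE, quot_scaleE) scalerDr.
Qed.

Lemma quot_scaleDl p : {morph quot_scale^~ p : a b / a + b}.
Proof.
move=> a b; elim/quotW: p => ?.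
by rewrite -[RHS]/(quot_add _ _) !(quot_addE, quot_scaleE) scalerDl.
Qed.

HB.instance Definition _ := GRing.Zmodule_isLmodule.Build K lie_quot
  quot_scaleA quot_scale1 quot_scaleDr quot_scaleDl.

Lemma quot_piD x y : quot_pi (x + y) = quot_pi x + quot_pi y.
Proof. by rewrite -[RHS]/(quot_add _ _) quot_addE. Qed.

Lemma quot_piZ a x : quot_pi (a *: x) = a *: quot_pi x.
Proof. by rewrite -[RHS]/(quot_scale _ _) quot_scaleE. Qed.

Lemma quot_pi0 : quot_pi 0 = 0. Proof. by []. Qed.

Fact quot_lieDl p q r : quot_lie (p + q) r = quot_lie p r + quot_lie q r.
Proof.
elim/quotW: p => x; elim/quotW: q => y; elim/quotW: r => z.
by rewrite -quot_piD !quot_lieE -quot_piD lieDl.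
Qed.

Fact quot_lieDr p q r : quot_lie p (q + r) = quot_lie p q + quot_lie p r.
Proof.
elim/quotW: p => x; elim/quotW: q => y; elim/quotW: r => z.
by rewrite -quot_piD !quot_lieE -quot_piD lieDr.
Qed.

Fact quot_lieZl a p q : quot_lie (a *: p) q = a *: quot_lie p q.
Proof.
elim/quotW: p => x; elim/quotW: q => y.
by rewrite -quot_piZ !quot_lieE -quot_piZ lieZl.
Qed.

Fact quot_lieZr a p q : quot_lie p (a *: q) = a *: quot_lie p q.
Proof.
elim/quotW: p => x; elim/quotW: q => y.
by rewrite -quot_piZ !quot_lieE -quot_piZ lieZr.
Qed.

Fact quot_liexx p : quot_lie p p = 0.
Proof. by elim/quotW: p => x; rewrite quot_lieE liexx. Qed.

Fact quot_jacobi p q r :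
  quot_lie p (quot_lie q r) + quot_lie q (quot_lie r p)
    + quot_lie r (quot_lie p q) = 0.
Proof.
elim/quotW: p => x; elim/quotW: q => y; elim/quotW: r => z.
by rewrite !quot_lieE -!quot_piD lie_jacobi.
Qed.

HB.instance Definition _ := Lmodule_isLie.Build K lie_quot
  quot_lieDl quot_lieDr quot_lieZl quot_lieZr quot_liexx quot_jacobi.

Lemma quot_pi_lie x y : quot_pi [lie x, y] = [lie quot_pi x, quot_pi y].
Proof. by rewrite -[RHS]/(quot_lie _ _) quot_lieE. Qed.

Lemma quot_pi_hom : lie_hom quot_pi.
Proof.
by split=> [a x y|x y]; [rewrite quot_piD quot_piZ | rewrite quot_pi_lie].
Qed.

End LieQuotient.

Section Derived.
Variables (K : pzRingType) (L : lieAlgType K).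

Definition is_derived (x : L) : Prop :=
  exists s : seq (L * L), x = \sum_(p <- s) [lie p.1, p.2].

Definition derived_pred : {pred L} := fun x => `[< is_derived x >].

Lemma derived_submod_closed : submod_closed derived_pred.
Proof.
split=> [|a x y]; first by apply/asboolP; exists [::]; rewrite big_nil.
move=> /asboolP[s ->] /asboolP[t ->]; apply/asboolP.
exists ([seq (a *: p.1, p.2) | p <- s] ++ t).
rewrite big_cat big_map scaler_sumr /=; congr (_ + _).
by apply: eq_bigr => p _; rewrite lieZl.
Qed.

HB.instance Definition _ :=
  GRing.isSubmodClosed.Build K L derived_pred
    (GRing.submod_closed_semi derived_submod_closed).

Lemma lie_derived x y : [lie x, y] \in derived_pred.
Proof. by apply/asboolP; exists [:: (x, y)]; rewrite big_seq1. Qed.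

Record derived := Derived { derived_val :> L; _ : derived_val \in derived_pred }.

HB.instance Definition _ := [isSub for derived_val].
HB.instance Definition _ := [Choice of derived by <:].
HB.instance Definition _ := [SubChoice_isSubLmodule of derived by <:].

Definition derived_lie (x y : derived) : derived :=
  Derived (lie_derived x y).

Fact derived_lieDl x y z :
  derived_lie (x + y) z = derived_lie x z + derived_lie y z.
Proof. by apply: val_inj; rewrite raddfD /= lieDl. Qed.

Fact derived_lieDr x y z :
  derived_lie x (y + z) = derived_lie x y + derived_lie x z.
Proof. by apply: val_inj; rewrite raddfD /= lieDr. Qed.

Fact derived_lieZl a x y : derived_lie (a *: x) y = a *: derived_lie x y.
Proof. by apply: val_inj; rewrite linearZ /= lieZl. Qed.

Fact derived_lieZr a x y : derived_lie x (a *: y) = a *: derived_lie x y.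
Proof. by apply: val_inj; rewrite linearZ /= lieZr. Qed.

Fact derived_liexx x : derived_lie x x = 0.
Proof. by apply: val_inj; rewrite /= liexx. Qed.

Fact derived_jacobi x y z :
  derived_lie x (derived_lie y z) + derived_lie y (derived_lie z x)
    + derived_lie z (derived_lie x y) = 0.
Proof. by apply: val_inj; rewrite !raddfD /= lie_jacobi. Qed.

HB.instance Definition _ := Lmodule_isLie.Build K derived
  derived_lieDl derived_lieDr derived_lieZl derived_lieZr
  derived_liexx derived_jacobi.

End Derived.

Section Presentation.
Variables (K : pzRingType) (X : Type).

Inductive lie_term : Type :=
| LGen of X
| LZero
| LAdd of lie_term & lie_term
| LScale of K & lie_term
| LLie of lie_term & lie_term.

Variable rels : lie_term -> lie_term -> Prop.

(* The least congruence on terms that contains [rels] and whose quotient is a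
   Lie algebra over [K]. *)
Inductive lie_cong : lie_term -> lie_term -> Prop :=
| lc_refl t : lie_cong t t
| lc_sym t u : lie_cong t u -> lie_cong u t
| lc_trans t u v : lie_cong t u -> lie_cong u v -> lie_cong t v
| lc_add t t' u u' :
    lie_cong t t' -> lie_cong u u' -> lie_cong (LAdd t u) (LAdd t' u')
| lc_scale a t t' : lie_cong t t' -> lie_cong (LScale a t) (LScale a t')
| lc_lie t t' u u' :
    lie_cong t t' -> lie_cong u u' -> lie_cong (LLie t u) (LLie t' u')
| lc_addA t u v : lie_cong (LAdd t (LAdd u v)) (LAdd (LAdd t u) v)
| lc_addC t u : lie_cong (LAdd t u) (LAdd u t)
| lc_add0 t : lie_cong (LAdd LZero t) t
| lc_addN t : lie_cong (LAdd (LScale (-1) t) t) LZero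
| lc_scaleA a b t : lie_cong (LScale a (LScale b t)) (LScale (a * b) t)
| lc_scale1 t : lie_cong (LScale 1 t) t
| lc_scaleDr a t u :
    lie_cong (LScale a (LAdd t u)) (LAdd (LScale a t) (LScale a u))
| lc_scaleDl a b t :
    lie_cong (LScale (a + b) t) (LAdd (LScale a t) (LScale b t))
| lc_lieDl t u v : lie_cong (LLie (LAdd t u) v) (LAdd (LLie t v) (LLie u v))
| lc_lieDr t u v : lie_cong (LLie t (LAdd u v)) (LAdd (LLie t u) (LLie t v))
| lc_lieZl a t u : lie_cong (LLie (LScale a t) u) (LScale a (LLie t u))
| lc_lieZr a t u : lie_cong (LLie t (LScale a u)) (LScale a (LLie t u))
| lc_liexx t : lie_cong (LLie t t) LZero
| lc_jacobi t u v :
    lie_cong (LAdd (LAdd (LLie t (LLie u v)) (LLie u (LLie v t)))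
                   (LLie v (LLie t u)))
             LZero
| lc_rel t u : rels t u -> lie_cong t u.

HB.instance Definition _ := gen_eqMixin lie_term.
HB.instance Definition _ := gen_choiceMixin lie_term.

Definition lie_eqv : rel lie_term := fun t u => `[< lie_cong t u >].

Lemma lie_eqv_refl : reflexive lie_eqv.
Proof. by move=> t; apply/asboolP; apply: lc_refl. Qed.

Lemma lie_eqv_sym : symmetric lie_eqv.
Proof. by move=> t u; apply/asboolP/asboolP; apply: lc_sym. Qed.

Lemma lie_eqv_trans : transitive lie_eqv.
Proof.
by move=> u t v /asboolP tu /asboolP uv; apply/asboolP; apply: lc_trans uv.
Qed.

Canonical lie_equiv := EquivRel lie_eqv lie_eqv_refl lie_eqv_sym lie_eqv_trans.

Definition lie_pres := {eq_quot lie_eqv}.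

HB.instance Definition _ : EqQuotient lie_term lie_eqv lie_pres :=
  EqQuotient.on lie_pres.
HB.instance Definition _ := Choice.on lie_pres.

Definition pres_pi (t : lie_term) : lie_pres := \pi_lie_pres t.

Lemma pres_piP t u : pres_pi t = pres_pi u <-> lie_cong t u.
Proof.
split=> [/eqmodP|tu]; first by move/asboolP.
by apply/eqmodP/asboolP.
Qed.

Lemma pres_pi_repr (p : lie_pres) : pres_pi (repr p) = p.
Proof. exact: reprK. Qed.

Lemma repr_pres_pi t : lie_cong (repr (pres_pi t)) t.
Proof. by apply/pres_piP; rewrite pres_pi_repr. Qed.

Definition pres_add (p q : lie_pres) := pres_pi (LAdd (repr p) (repr q)).
Definition pres_scale (a : K) (p : lie_pres) := pres_pi (LScale a (repr p)).
Definition pres_opp (p : lie_pres) := pres_scale (-1) p.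
Definition pres_lie (p q : lie_pres) := pres_pi (LLie (repr p) (repr q)).

Lemma pres_addE t u : pres_add (pres_pi t) (pres_pi u) = pres_pi (LAdd t u).
Proof. by apply/pres_piP; apply: lc_add; apply: repr_pres_pi. Qed.

Lemma pres_scaleE a t : pres_scale a (pres_pi t) = pres_pi (LScale a t).
Proof. by apply/pres_piP; apply: lc_scale; apply: repr_pres_pi. Qed.

Lemma pres_lieE t u : pres_lie (pres_pi t) (pres_pi u) = pres_pi (LLie t u).
Proof. by apply/pres_piP; apply: lc_lie; apply: repr_pres_pi. Qed.

Let presW (P : lie_pres -> Prop) : (forall t, P (pres_pi t)) -> forall p, P p.
Proof. by move=> HP p; rewrite -[p]pres_pi_repr. Qed.

Lemma pres_addA : associative pres_add.
Proof.
by do 3!elim/presW => ?; rewrite !pres_addE; apply/pres_piP/lc_addA.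
Qed.

Lemma pres_addC : commutative pres_add.
Proof. by do 2!elim/presW => ?; rewrite !pres_addE; apply/pres_piP/lc_addC. Qed.

Lemma pres_add0 : left_id (pres_pi LZero) pres_add.
Proof. by elim/presW => ?; rewrite !pres_addE; apply/pres_piP/lc_add0. Qed.

Lemma pres_addN : left_inverse (pres_pi LZero) pres_opp pres_add.
Proof.
elim/presW => ?; rewrite /pres_opp pres_scaleE pres_addE.
exact/pres_piP/lc_addN.
Qed.

HB.instance Definition _ :=
  GRing.isZmodule.Build lie_pres pres_addA pres_addC pres_add0 pres_addN.

Lemma pres_scaleA a b p : pres_scale a (pres_scale b p) = pres_scale (a * b) p.
Proof.
by elim/presW: p => ?; rewrite !pres_scaleE; apply/pres_piP/lc_scaleA.
Qed.

Lemma pres_scale1 : left_id 1 pres_scale.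
Proof. by elim/presW => ?; rewrite !pres_scaleE; apply/pres_piP/lc_scale1. Qed.

Lemma pres_scaleDr : right_distributive pres_scale +%R.
Proof.
move=> a; do 2!elim/presW => ?.
rewrite -![_ + _]/(pres_add _ _) !(pres_addE, pres_scaleE).
exact/pres_piP/lc_scaleDr.
Qed.

Lemma pres_scaleDl p : {morph pres_scale^~ p : a b / a + b}.
Proof.
move=> a b; elim/presW: p => ?.
rewrite -[RHS]/(pres_add _ _) !(pres_addE, pres_scaleE).
exact/pres_piP/lc_scaleDl.
Qed.

HB.instance Definition _ := GRing.Zmodule_isLmodule.Build K lie_pres
  pres_scaleA pres_scale1 pres_scaleDr pres_scaleDl.

Lemma pres_piD t u : pres_pi (LAdd t u) = pres_pi t + pres_pi u.
Proof. by rewrite -[RHS]/(pres_add _ _) pres_addE. Qed.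

Lemma pres_piZ a t : pres_pi (LScale a t) = a *: pres_pi t.
Proof. by rewrite -[RHS]/(pres_scale _ _) pres_scaleE. Qed.

Lemma pres_pi0 : pres_pi LZero = 0. Proof. by []. Qed.

Fact pres_lieDl p q r : pres_lie (p + q) r = pres_lie p r + pres_lie q r.
Proof.
elim/presW: p => x; elim/presW: q => y; elim/presW: r => z.
by rewrite -pres_piD !pres_lieE -pres_piD; apply/pres_piP/lc_lieDl.
Qed.

Fact pres_lieDr p q r : pres_lie p (q + r) = pres_lie p q + pres_lie p r.
Proof.
elim/presW: p => x; elim/presW: q => y; elim/presW: r => z.
by rewrite -pres_piD !pres_lieE -pres_piD; apply/pres_piP/lc_lieDr.
Qed.

Fact pres_lieZl a p q : pres_lie (a *: p) q = a *: pres_lie p q.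
Proof.
elim/presW: p => x; elim/presW: q => y.
by rewrite -pres_piZ !pres_lieE -pres_piZ; apply/pres_piP/lc_lieZl.
Qed.

Fact pres_lieZr a p q : pres_lie p (a *: q) = a *: pres_lie p q.
Proof.
elim/presW: p => x; elim/presW: q => y.
by rewrite -pres_piZ !pres_lieE -pres_piZ; apply/pres_piP/lc_lieZr.
Qed.

Fact pres_liexx p : pres_lie p p = 0.
Proof.
by elim/presW: p => x; rewrite pres_lieE -pres_pi0; apply/pres_piP/lc_liexx.
Qed.

Fact pres_jacobi p q r :
  pres_lie p (pres_lie q r) + pres_lie q (pres_lie r p)
    + pres_lie r (pres_lie p q) = 0.
Proof.
elim/presW: p => x; elim/presW: q => y; elim/presW: r => z.
rewrite !pres_lieE -!pres_piD -pres_pi0.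
exact/pres_piP/lc_jacobi.
Qed.

HB.instance Definition _ := Lmodule_isLie.Build K lie_pres
  pres_lieDl pres_lieDr pres_lieZl pres_lieZr pres_liexx pres_jacobi.

Lemma pres_pi_lie t u : pres_pi (LLie t u) = [lie pres_pi t, pres_pi u].
Proof. by rewrite -[RHS]/(pres_lie _ _) pres_lieE. Qed.

End Presentation.

Arguments LGen {K X} _.
Arguments LZero {K X}.

Definition is_gcm n (A : 'M[int]_n) : Prop :=
  [/\ forall i, A i i = 2,
      forall i j, i != j -> A i j <= 0
    & forall i j, A j i = 0 -> A i j = 0].

Definition symmetrizable n (A : 'M[int]_n) : Prop :=
  exists d : 'rV[rat]_n,
    (forall i, 0 < d 0 i) /\
    (diag_mx d *m map_mx intr A)^T = diag_mx d *m map_mx intr A.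

(* A realization (h, Pi, Pi^vee) of A.  The last field is
   dim h = 2n - rank A. *)
Record realization (K : fieldType) n (A : 'M[int]_n) := Realization {
  cartan : vectType K;
  simple_root : 'I_n -> 'Hom(cartan, K^o);
  simple_coroot : 'I_n -> cartan;
  simple_root_free : free [seq simple_root i | i <- enum 'I_n];
  simple_coroot_free : free [seq simple_coroot i | i <- enum 'I_n];
  simple_pairing : forall i j,
    simple_root j (simple_coroot i) = (A i j)%:~R :> K;
  cartan_dim :
    (\dim {: cartan} + \rank (map_mx intr A : 'M[K]_n) = n + n)%N
}.

Section KacMoody.
Variables (K : fieldType) (n : nat) (A : 'M[int]_n) (R : realization K A).

Local Notation h := (cartan R).

Inductive km_gen : Type := GenE of 'I_n | GenF of 'I_n | GenH of h.

Local Notation term := (lie_term K km_gen).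
Local Notation E i := (LGen (GenE i) : term).
Local Notation F i := (LGen (GenF i) : term).
Local Notation H x := (LGen (GenH x) : term).

(* The defining relations of Kac's auxiliary algebra g~(A).  The first one says
   that the linear relations of h hold between the generators in h. *)
Inductive km_rel : term -> term -> Prop :=
| km_lin a x y : km_rel (H (a *: x + y)) (LAdd (LScale a (H x)) (H y))
| km_EF i : km_rel (LLie (E i) (F i)) (H (simple_coroot R i))
| km_EF0 i j : i != j -> km_rel (LLie (E i) (F j)) LZero
| km_HH x y : km_rel (LLie (H x) (H y)) LZero
| km_HE x i : km_rel (LLie (H x) (E i)) (LScale (simple_root R i x) (E i))
| km_HF x i : km_rel (LLie (H x) (F i)) (LScale (- simple_root R i x) (F i)).

Definition km_tilde : lieAlgType K := lie_pres km_rel.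

Definition tilde_h (x : h) : km_tilde := pres_pi km_rel (H x).

Definition meets_h_trivially (I : lieIdeal km_tilde) : Prop :=
  forall x : h, I (tilde_h x) -> tilde_h x = 0.

(* The sum of all the ideals of g~(A) that meet h trivially.  By a theorem of
   Kac it meets h trivially itself, hence is the largest such ideal. *)
Definition in_km_radical (x : km_tilde) : Prop :=
  exists s : seq km_tilde, x = \sum_(y <- s) y /\
    forall y, y \in s -> exists I, meets_h_trivially I /\ I y.

Fact km_radical0 : in_km_radical 0.
Proof. by exists [::]; rewrite big_nil. Qed.

Fact km_radicalD x y :
  in_km_radical x -> in_km_radical y -> in_km_radical (x + y).
Proof.
move=> [s [-> Hs]] [t [-> Ht]]; exists (s ++ t); rewrite big_cat; split=> // z.
by rewrite mem_cat => /orP[/Hs|/Ht].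
Qed.

Fact km_radicalZ a x : in_km_radical x -> in_km_radical (a *: x).
Proof.
move=> [s [-> Hs]]; exists [seq a *: y | y <- s].
rewrite big_map scaler_sumr; split=> // z /mapP[y /Hs[I [I0 Iy]] ->].
by exists I; split=> //; apply: idealZ.
Qed.

Fact km_radical_lie x y : in_km_radical y -> in_km_radical [lie x, y].
Proof.
move=> [s [-> Hs]]; exists [seq [lie x, y] | y <- s]; split.
  rewrite big_map; elim: s {Hs} => [|z s IHs]; first by rewrite !big_nil lie0r.
  by rewrite !big_cons lieDr IHs.
move=> _ /mapP[z /Hs[I [I0 Iz]] ->].
by exists I; split=> //; apply: ideal_lie.
Qed.

Definition km_radical : lieIdeal km_tilde :=
  LieIdeal km_radical0 km_radicalD km_radicalZ km_radical_lie.

Definition km_alg : lieAlgType K := lie_quot km_radical.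

Definition km_e (i : 'I_n) : km_alg := quot_pi km_radical (pres_pi km_rel (E i)).
Definition km_f (i : 'I_n) : km_alg := quot_pi km_radical (pres_pi km_rel (F i)).
Definition km_h (x : h) : km_alg := quot_pi km_radical (tilde_h x).

Definition km_derived : lieAlgType K := derived km_alg.

Lemma km_he x i : [lie km_h x, km_e i] = simple_root R i x *: km_e i.
Proof.
rewrite -quot_pi_lie -pres_pi_lie -quot_piZ -pres_piZ; congr quot_pi.
exact/pres_piP/lc_rel/km_HE.
Qed.

Lemma km_hf x i : [lie km_h x, km_f i] = - simple_root R i x *: km_f i.
Proof.
rewrite -quot_pi_lie -pres_pi_lie -quot_piZ -pres_piZ; congr quot_pi.
exact/pres_piP/lc_rel/km_HF.
Qed.

Lemma simple_root_neq0 i : exists x : h, simple_root R i x != 0.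
Proof.
apply: contrapT => /forallNP root0.
have ri0 : simple_root R i = 0.
  by apply/lfunP => x; rewrite lfunE /=; apply/eqP/negPn/negP/root0.
have /free_not0 : free [seq simple_root R i | i <- enum 'I_n].
  exact: simple_root_free.
by move=> /(_ 0); rewrite -ri0 map_f ?mem_enum // eqxx => /(_ isT).
Qed.

Lemma km_e_derived i : km_e i \in derived_pred (L := km_alg).
Proof.
have [x xi] := simple_root_neq0 i.
suff -> : km_e i = [lie (simple_root R i x)^-1 *: km_h x, km_e i].
  exact: lie_derived.
by rewrite lieZl km_he scalerA mulVf // scale1r.
Qed.

Lemma km_f_derived i : km_f i \in derived_pred (L := km_alg).
Proof.
have [x xi] := simple_root_neq0 i.
suff -> : km_f i = [lie (- simple_root R i x)^-1 *: km_h x, km_f i].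
  exact: lie_derived.
by rewrite lieZl km_hf scalerA mulVf ?oppr_eq0 // scale1r.
Qed.

Definition km_e' (i : 'I_n) : km_derived := Derived (km_e_derived i).
Definition km_f' (i : 'I_n) : km_derived := Derived (km_f_derived i).

Definition in_root_space (b : 'Hom(h, K^o)) (x : km_alg) : Prop :=
  forall y : h, [lie km_h y, x] = (b y : K) *: x.

Definition is_root (b : 'Hom(h, K^o)) : Prop :=
  b != 0 /\ exists x : km_alg, x != 0 /\ in_root_space b x.

Definition simple_refl_fun (i : 'I_n) (x : h) : h :=
  x - (simple_root R i x : K) *: simple_coroot R i.

Fact simple_refl_is_linear i : linear (simple_refl_fun i).
Proof.
move=> a x y; rewrite /simple_refl_fun linearP /= scalerDl -scalerA.
by rewrite scalerBr opprD addrACA.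
Qed.

HB.instance Definition _ i :=
  GRing.isLinear.Build K h h *:%R (simple_refl_fun i) (simple_refl_is_linear i).

Definition simple_refl (i : 'I_n) : 'End(h) := linfun (simple_refl_fun i).

(* The Weyl group as a subgroup of GL(h).  The simple reflections being
   involutions, closure under products is enough to get a group. *)
Inductive weyl : 'End(h) -> Prop :=
| weyl_id : weyl \1%VF
| weyl_refl i : weyl (simple_refl i)
| weyl_comp v w : weyl v -> weyl w -> weyl (v \o w)%VF.

(* The contragredient action on h^*. *)
Definition weyl_dual (w : 'End(h)) (b : 'Hom(h, K^o)) : 'Hom(h, K^o) :=
  (b \o w^-1)%VF.

Definition real_root_coroot (b : 'Hom(h, K^o)) (bv : h) : Prop :=
  exists w i, [/\ weyl w, b = weyl_dual w (simple_root R i)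
                & bv = w (simple_coroot R i)].

Definition is_real_root (b : 'Hom(h, K^o)) : Prop :=
  exists bv, real_root_coroot b bv.

Definition pi_system m (beta : 'I_m -> 'Hom(h, K^o)) : Prop :=
  [/\ injective beta,
      forall i, is_real_root (beta i)
    & forall i j, i != j -> ~ is_root (beta i - beta j)].

End KacMoody.

(* Main.v *)
Require Import Defs.
From mathcomp Require Import all_boot all_order all_algebra.
From mathcomp Require Import reals complex.
From HB Require Import structures.
From mathcomp Require Import boolp classical_sets functions.
From mathcomp Require Import ring lra zify.

(* Let [g0] be the algebra on generators E_i, F_i and a Cartan part spanned by
   the H_i, with the Chevalley relations for B but no Serre relations; it maps
   both to g'(B) (onto) and, by the pi-system property, to g(A).  One has to show
   that the kernel of the first map [pi] lies in the kernel of the second map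
   [rho].  Since [pi] respects degrees in Z^m and is injective in degree 0, an
   induction on the height reduces this to showing that no nonzero [rho x], with
   x of positive degree g in the E_i, is killed by all the [rho F_j].

   This replaces the Gabber-Kac theorem.  As B is symmetrizable, [g0] carries
   the cobracket delta of a Lie bialgebra, with values in a graded tensor square
   of g(A).  Composing delta with the bracket gives a derivation, which is
   multiplication by 2 sum_i g_i (alpha_i | alpha_i) in degree g.  For a singular
   x as above, delta x reduces by induction to its Cartan part, whose bracket is
   2 (g | g) x.  But real root vectors act locally nilpotently on g(A), so sl2
   theory forces (g | g) <= 0 < sum_i g_i (alpha_i | alpha_i), and rho x = 0.

   Local nilpotency of real root vectors comes from the invariance of the weights
   of g(A) under the Weyl group, which follows from the Serre relations; these
   hold since singular vectors generate ideals that meet h trivially. *)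

Set Implicit Arguments.
Unset Strict Implicit.
Unset Printing Implicit Defensive.

Import Order.TTheory GRing.Theory Num.Theory.
Local Open Scope ring_scope.

(** * Linear functionals *)

(** Since g(B) is a quotient by a largest ideal, no list of relations is at hand from which a map
    out of g'(B) could be defined; hence the comparison of two kernels on [g0]. The obstacle is that
    the roots [beta i] may be linearly dependent: g(A) then carries no grading by Z^m, and weights
    do not separate the degrees of [g0]. Degrees are therefore carried along formally: [npos]
    relates a degree to an element, the tensor square has an extra exponent, and the kernel of the
    map to g'(B) is split by weights inside g(B), whose realization has independent simple roots.
    The cobracket takes values in the square of g(A), that is, it is already composed with [rho].
    Nothing says beforehand that it vanishes on the kernel of [rho], so the induction proves that
    [rho x] and the cobracket of [x] vanish together. Only positive degrees are treated directly;
    the Chevalley involution gives the negative ones. *)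

Section Functionals.
Variables (K : fieldType) (V : lmodType K).

Definition subspace (S : V -> Prop) : Prop :=
  [/\ S 0, forall x y, S x -> S y -> S (x + y)
    & forall (a : K) x, S x -> S (a *: x)].

Lemma subspaceB S x y : subspace S -> S x -> S y -> S (x - y).
Proof. by case=> _ SD SZ Sx Sy; rewrite -scaleN1r; apply/SD/SZ. Qed.

Lemma subspace_sum S (I : eqType) (s : seq I) (c : I -> V) :
  subspace S -> {in s, forall i, S (c i)} -> S (\sum_(i <- s) c i).
Proof.
case=> S0 SD _; elim: s => [|i s IHs] Sc; first by rewrite big_nil.
rewrite big_cons; apply: SD; first exact/Sc/mem_head.
by apply: IHs => j js; apply: Sc; rewrite inE js orbT.
Qed.

(** Zorn's lemma on the subspaces that contain [S] and avoid [u]: adjoining any outside vector to a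
    maximal one captures [u], so [M] is a hyperplane complementary to [u]. *)
Lemma maximal_subspace_avoiding S (u : V) : subspace S -> ~ S u ->
  exists M, [/\ subspace M, forall x, S x -> M x, ~ M u
    & forall w, exists c : K, M (w - c *: u)].
Proof.
move=> subS Su.
pose good (M : set V) := [/\ subspace M, forall x, S x -> M x & ~ M u].
have [F Fgood Ftot|M [gM maxM]] :=
  @Zorn_bigcup V [set M | M = set0 \/ good M]%classic.
  have [[M [FM gM]]|noF] := pselect (exists M, F M /\ good M); last first.
    left; apply/seteqP; split=> // x [M FM Mx].
    case: (Fgood _ FM) => [M0|gM]; first by rewrite M0 in Mx.
    by case: noF; exists M.
  have goodF N x : F N -> N x -> good N.
    by move=> FN Nx; case: (Fgood _ FN) => // N0; rewrite N0 in Nx.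
  right; case: (gM) => -[M0 MD MZ] SM Mu; split; first split.
  - by exists M.
  - move=> x y [N FN Nx] [N' FN' N'y].
    have [[_ ND _] _ _] := goodF _ _ FN Nx.
    have [[_ ND' _] _ _] := goodF _ _ FN' N'y.
    by case: (Ftot _ _ FN FN') => sN; [exists N' | exists N] => //;
      [apply: ND' => //; apply: sN | apply: ND => //; apply: sN].
  - move=> a x [N FN Nx]; have [[_ _ NZ] _ _] := goodF _ _ FN Nx.
    by exists N => //; apply: NZ.
  - by move=> x Sx; exists M => //; apply: SM.
  - by move=> [N FN Nu]; have [] := goodF _ _ FN Nu.
case: gM => [M0|gM].
  exfalso; case: (maxM S); last by right; split.
  by rewrite M0; split=> // sS0; case: subS => S0 _ _; have := sS0 0 S0.
exists M; case: (gM) => -[M0 MD MZ] SM Mu; split=> // w.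
have [Mw|Mw] := pselect (M w).
  by exists 0; rewrite scale0r subr0.
pose N : set V := [set x | exists c : K, M (x - c *: w)]%classic.
have [[c Muc]|Nu] := pselect (N u); last first.
  exfalso; case: (maxM N).
    split=> [x Mx|sNM]; first by exists 0; rewrite scale0r subr0.
    by apply/Mw/sNM; exists 1; rewrite scale1r subrr.
  right; split=> //; first split.
  - by exists 0; rewrite scale0r subr0.
  - move=> x y [a Mx] [b My]; exists (a + b).
    by rewrite scalerDl opprD addrACA; apply: MD.
  - move=> a x [b Mx]; exists (a * b).
    by rewrite -scalerA -scalerBr; apply: MZ.
  - by move=> x /SM Mx; exists 0; rewrite scale0r subr0.
have c0 : c != 0 by apply: contra_not_neq Mu => c0; rewrite c0 scale0r subr0 in Muc.
exists c^-1.
suff -> : w - c^-1 *: u = - c^-1 *: (u - c *: w) by apply: MZ.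
by rewrite scalerBr scalerA mulNr mulVf // scaleN1r opprK scaleNr addrC.
Qed.

Lemma separating_functional S (u : V) : subspace S -> ~ S u ->
  exists xi : {scalar V}, (forall x, S x -> xi x = 0) /\ xi u = 1.
Proof.
move=> subS /(maximal_subspace_avoiding subS)[M [subM SM Mu Mcover]].
have [xi xiP] := choice Mcover.
have xi_uniq w c : M (w - c *: u) -> xi w = c.
  move=> Mc; apply/eqP/negPn/negP => xic; apply: Mu.
  have := subspaceB subM Mc (xiP w).
  case: subM => _ _ MZ; rewrite opprB addrC subrKA -scalerBl.
  by move/(MZ (xi w - c)^-1); rewrite scalerA mulVf ?subr_eq0 // scale1r.
have xi_lin : scalar xi.
  move=> a x y; apply: xi_uniq; case: subM => _ MD MZ.
  by rewrite scalerDl opprD addrACA -scalerA -scalerBr; apply/MD => //; apply: MZ.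
pose lin := GRing.isLinear.Build K V K *%R xi xi_lin.
pose f : {scalar V} := HB.pack xi lin.
exists f; split=> [x /SM Mx|]; apply: xi_uniq; first by rewrite scale0r subr0.
by rewrite scale1r subrr; case: subM.
Qed.

Lemma scalar_ext (v w : V) : (forall xi : {scalar V}, xi v = xi w) -> v = w.
Proof.
move=> vw; apply: contrapT => neq_vw.
have subS : subspace (fun x : V => x = 0).
  by split=> // [x y -> ->|a x ->]; rewrite ?addr0 ?scaler0.
have [|xi [_]] := separating_functional subS (u := v - w).
  by move/eqP; rewrite subr_eq0 => /eqP.
by rewrite linearB vw subrr => /eqP; rewrite eq_sym oner_eq0.
Qed.

End Functionals.

(* Functionals separate the points of [V], so a linear identity in [V] reduces
   to an identity in the ground field. *)
Ltac lmod_ring :=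
  let xi := fresh "xi" in
  apply: scalar_ext => xi;
  rewrite ?(linear0, linearD, linearN, linearZ, linearMn) /=; ring.

(** * Lie algebras and presentations *)

Section LieHom.
Variables (K : fieldType) (L M : lieAlgType K) (f : L -> M).
Hypothesis hf : lie_hom f.

Lemma lie_homD x y : f (x + y) = f x + f y.
Proof. by have [lf _] := hf; have := lf 1 x y; rewrite !scale1r. Qed.

Lemma lie_hom0 : f 0 = 0.
Proof. by apply: (@addrI _ (f 0)); rewrite -lie_homD !addr0. Qed.

Lemma lie_homZ a x : f (a *: x) = a *: f x.
Proof. by have [lf _] := hf; have := lf a x 0; rewrite lie_hom0 !addr0. Qed.

Lemma lie_homE x y : f [lie x, y] = [lie f x, f y].
Proof. by case: hf. Qed.

Lemma lie_hom_sum (I : Type) (s : seq I) (c : I -> L) :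
  f (\sum_(i <- s) c i) = \sum_(i <- s) f (c i).
Proof.
elim: s => [|i s IHs]; first by rewrite !big_nil lie_hom0.
by rewrite !big_cons lie_homD IHs.
Qed.

End LieHom.

Lemma lie_hom_comp (K : fieldType) (L M N : lieAlgType K) (f : M -> N) (g : L -> M) :
  lie_hom f -> lie_hom g -> lie_hom (fun x => f (g x)).
Proof.
move=> hf hg; split=> [a x y|x y].
  by rewrite (lie_homD hg) (lie_homZ hg) (lie_homD hf) (lie_homZ hf).
by rewrite (lie_homE hg) (lie_homE hf).
Qed.

Section LieMore.
Variables (K : fieldType) (L : lieAlgType K).
Implicit Types x y z : L.

Lemma lieNl x y : [lie - x, y] = - [lie x, y].
Proof. by rewrite -scaleN1r lieZl scaleN1r. Qed.

Lemma lieNr x y : [lie x, - y] = - [lie x, y].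
Proof. by rewrite -scaleN1r lieZr scaleN1r. Qed.

Lemma lie_sumr (I : Type) (s : seq I) (c : I -> L) y :
  [lie y, \sum_(i <- s) c i] = \sum_(i <- s) [lie y, c i].
Proof.
elim: s => [|i s IHs]; first by rewrite !big_nil lie0r.
by rewrite !big_cons lieDr IHs.
Qed.

Lemma lieA x y z : [lie [lie x, y], z] = [lie x, [lie y, z]] - [lie y, [lie x, z]].
Proof.
have := lie_jacobi x y z.
rewrite (lieC z x) lieNr (lieC z [lie x, y]) => /eqP.
by rewrite subr_eq0 eq_sym => /eqP ->.
Qed.

Lemma lieAr x y z : [lie x, [lie y, z]] = [lie [lie x, y], z] + [lie y, [lie x, z]].
Proof. by rewrite lieA subrK. Qed.

Definition subalgebra (S : L -> Prop) : Prop :=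
  subspace S /\ forall x y, S x -> S y -> S [lie x, y].

Definition lie_generated (G : L -> Prop) : Prop :=
  forall S, subalgebra S -> (forall x, G x -> S x) -> forall x, S x.

Lemma stabilizer_subalgebra (U : L -> Prop) : subspace U ->
  subalgebra (fun z => forall x, U x -> U [lie z, x]).
Proof.
move=> subU; have [U0 UD UZ] := subU; split; first split=> [x _|x y Ux Uy z Uz|a x Ux z Uz].
- by rewrite lie0l.
- by rewrite lieDl; apply: UD; [apply: Ux | apply: Uy].
- by rewrite lieZl; apply/UZ/Ux.
- by move=> x y Ux Uy z Uz; rewrite lieA; apply: subspaceB => //; auto.
Qed.

(** By the Jacobi identity the elements that stabilize [U] form a subalgebra, so generators
    suffice. *)
Lemma generated_stable (G U : L -> Prop) : lie_generated G -> subspace U ->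
  (forall g x, G g -> U x -> U [lie g, x]) -> forall z x, U x -> U [lie z, x].
Proof.
move=> genG subU GU z; apply: (genG _ (stabilizer_subalgebra subU)) => g Gg x.
exact: GU.
Qed.

End LieMore.

Lemma ideal_subspace (K : fieldType) (L : lieAlgType K) (I : lieIdeal L) : subspace I.
Proof. by split; [apply: ideal0 | apply: idealD | apply: idealZ]. Qed.

Section PresLift.
Variables (K : fieldType) (X : Type) (rels : lie_term K X -> lie_term K X -> Prop).
Variables (L : lieAlgType K) (g : X -> L).

Fixpoint lie_eval (t : lie_term K X) : L :=
  match t with
  | LGen x => g x
  | LZero => 0
  | LAdd t u => lie_eval t + lie_eval u
  | LScale a t => a *: lie_eval t
  | LLie t u => [lie lie_eval t, lie_eval u]
  end.

Hypothesis g_rels : forall t u, rels t u -> lie_eval t = lie_eval u.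

Lemma lie_eval_cong t u : lie_cong rels t u -> lie_eval t = lie_eval u.
Proof.
elim=> //=; try by move=> *; congruence.
- by move=> *; rewrite addrA.
- by move=> *; rewrite addrC.
- by move=> *; rewrite add0r.
- by move=> v; rewrite scaleN1r addNr.
- by move=> *; rewrite scalerA.
- by move=> *; rewrite scale1r.
- by move=> *; rewrite scalerDr.
- by move=> *; rewrite scalerDl.
- by move=> *; rewrite lieDl.
- by move=> *; rewrite lieDr.
- by move=> *; rewrite lieZl.
- by move=> *; rewrite lieZr.
- by move=> *; rewrite liexx.
- by move=> *; rewrite lie_jacobi.
Qed.

Definition pres_lift (p : lie_pres rels) : L := lie_eval (repr p).

Lemma pres_liftE t : pres_lift (pres_pi rels t) = lie_eval t.
Proof. exact/lie_eval_cong/repr_pres_pi. Qed.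

Lemma pres_lift_hom : lie_hom pres_lift.
Proof.
split=> [a|] p q; rewrite -[p]pres_pi_repr -[q]pres_pi_repr.
  by rewrite -pres_piZ -pres_piD !pres_liftE.
by rewrite -pres_pi_lie !pres_liftE.
Qed.

End PresLift.

Lemma pres_generated (K : fieldType) (X : Type)
    (rels : lie_term K X -> lie_term K X -> Prop) :
  lie_generated (fun p : lie_pres rels => exists x, p = pres_pi rels (LGen x)).
Proof.
move=> S [[S0 SD SZ] SL] Sgen p; rewrite -[p]pres_pi_repr.
elim: (repr p) => [x||t St u Su|a t St|t St u Su].
- by apply: Sgen; exists x.
- exact: S0.
- by rewrite pres_piD; apply: SD.
- by rewrite pres_piZ; apply: SZ.
- by rewrite pres_pi_lie; apply: SL.
Qed.

Section Eigen.
Variables (K : fieldType) (V : lmodType K) (Y : Type) (T : Y -> V -> V).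
Hypothesis T_lin : forall y, linear (T y).
Variable J : V -> Prop.
Hypothesis subJ : subspace J.
Hypothesis TJ : forall y x, J x -> J (T y x).

(** Working modulo [J] covers both the independence of eigenvectors ([J] zero) and the fact that an
    invariant subspace contains the components of its elements. *)
Lemma eigen_independent (I : eqType) (b : I -> Y -> K) (c : I -> V) (s : seq I) :
    uniq s -> (forall i, i \in s -> forall y, T y (c i) = b i y *: c i) ->
    (forall i j, i != j -> exists y, b i y != b j y) ->
  J (\sum_(i <- s) c i) -> forall i, i \in s -> J (c i).
Proof.
have [J0 JD JZ] := subJ => + + b_sep.
elim: s c => [//|j s IHs] c /= /andP[js us] ceig; rewrite big_cons => Jsum.
have TZD y a x z : T y (a *: x + z) = a *: T y x + T y z := T_lin y a x z.
have T0 y : T y 0 = 0.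
  by have := TZD y (-1) 0 0; rewrite scaler0 addr0 scaleN1r addNr.
have Tsum y (t : seq I) : T y (\sum_(i <- t) c i) = \sum_(i <- t) T y (c i).
  elim: t => [|i t IHt]; first by rewrite !big_nil T0.
  by rewrite !big_cons -IHt; have := TZD y 1 (c i) (\sum_(k <- t) c k); rewrite !scale1r.
have Js i : i \in s -> J (c i).
  move=> si; have [|y bij] := b_sep i j; first by apply: contraNneq js => <-.
  (* [T y - b j y] removes the summand [j] and multiplies the others by scalars, with a nonzero one
     at [i] for this [y]. *)
  have Jd : J (\sum_(i <- s) (b i y - b j y) *: c i).
    have := subspaceB subJ (TJ y Jsum) (JZ (b j y) _ Jsum).
    have := TZD y 1 (c j) (\sum_(k <- s) c k).
    rewrite !scale1r => ->; rewrite Tsum ceig ?mem_head //.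
    rewrite scalerDr opprD addrACA subrr add0r scaler_sumr -sumrB.
    rewrite big_seq (eq_bigr (fun i => (b i y - b j y) *: c i)) -?big_seq //.
    by move=> k ks; rewrite ceig ?inE ?ks ?orbT // scalerBl.
  have := IHs (fun i => (b i y - b j y) *: c i) us.
  move=> /(_ _ Jd i si) Jbc.
  rewrite -[c i]scale1r -(@mulVf _ (b i y - b j y)) ?subr_eq0 // -scalerA.
  apply/JZ/Jbc => k ks z.
  have TzZ x a : T z (a *: x) = a *: T z x by rewrite -[_ *: x]addr0 TZD T0 addr0.
  by rewrite TzZ ceig ?inE ?ks ?orbT // !scalerA mulrC.
move=> i; rewrite inE => /predU1P[->|/Js //].
have := subspaceB subJ Jsum (subspace_sum subJ Js).
by rewrite addrK.
Qed.

End Eigen.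

Section GradedSum.
Variables (K : fieldType) (V : lmodType K) (I : eqType) (P : I -> V -> Prop).
Hypothesis subP : forall i, subspace (P i).

Definition graded_sum (x : V) : Prop :=
  exists (s : seq I) (c : I -> V),
    [/\ uniq s, forall i, P i (c i) & x = \sum_(i <- s) c i].

Lemma sum_supported (s t : seq I) (c : I -> V) :
  uniq s -> uniq t -> {subset s <= t} ->
  \sum_(i <- t) (if i \in s then c i else 0) = \sum_(i <- s) c i.
Proof.
move=> us ut st; rewrite -big_mkcond -big_filter; apply: perm_big.
apply: uniq_perm => [||i]; rewrite ?filter_uniq // mem_filter.
by case si: (i \in s) => //=; rewrite st.
Qed.

Lemma graded_sum_subspace : subspace graded_sum.
Proof.
split=> [|x y [s [c [us Pc ->]]] [t [d [ut Pd ->]]]|a x [s [c [us Pc ->]]]].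
- exists [::], (fun=> 0); rewrite big_nil; split=> // i.
  by case: (subP i).
- exists (undup (s ++ t)).
  exists (fun i => (if i \in s then c i else 0) + (if i \in t then d i else 0)).
  rewrite undup_uniq big_split /= !sum_supported ?undup_uniq //; first split=> // i.
  + by have [P0 PD _] := subP i; apply: PD; case: ifP.
  + by move=> i; rewrite mem_undup mem_cat orbC => ->.
  + by move=> i; rewrite mem_undup mem_cat => ->.
- exists s, (fun i => a *: c i); rewrite scaler_sumr; split=> // i.
  by have [_ _ PZ] := subP i; apply: PZ.
Qed.

Lemma graded_sum_homogeneous i x : P i x -> graded_sum x.
Proof.
move=> Px; exists [:: i], (fun j => if j == i then x else 0).
by rewrite big_seq1 eqxx; split=> // j; case: eqP => [->|] //; case: (subP j).
Qed.

End GradedSum.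

Local Notation alpha i := (delta_mx 0 i : 'rV[int]_ _).

(** * Triangular decomposition *)

Section Lattice.
Variable m : nat.
Implicit Types g : 'rV[int]_m.

Definition height g : int := \sum_i g 0 i.

Lemma heightD g g' : height (g + g') = height g + height g'.
Proof. by rewrite /height -big_split; apply: eq_bigr => i _; rewrite mxE. Qed.

Lemma heightN g : height (- g) = - height g.
Proof. by rewrite /height -sumrN; apply: eq_bigr => i _; rewrite mxE. Qed.

Lemma height0 : height 0 = 0.
Proof. by rewrite /height big1 // => i _; rewrite mxE. Qed.

Lemma height_alpha (i : 'I_m) : height (alpha i) = 1.
Proof.
rewrite /height (bigD1 i) //= mxE !eqxx big1 ?addr0 // => j ji.
by rewrite mxE (negPf ji) andbF.
Qed.

Definition positive g : Prop := (forall i, 0 <= g 0 i) /\ 0 < height g.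

Lemma positive_neq0 g : positive g -> g <> 0.
Proof. by move=> [_ + g0]; rewrite g0 height0. Qed.

Lemma positive_alpha (i : 'I_m) : positive (alpha i).
Proof. by split=> [j|]; rewrite ?height_alpha // mxE; case: eqP. Qed.

Lemma positiveD g g' : positive g -> positive g' -> positive (g + g').
Proof.
move=> [g0 hg] [g'0 hg']; split=> [i|]; last by rewrite heightD addr_gt0.
by rewrite mxE addr_ge0.
Qed.

Lemma positiveN g : positive g -> ~ positive (- g).
Proof. by move=> [_ g0] [_]; rewrite heightN oppr_gt0 => /(lt_trans g0); rewrite ltxx. Qed.

End Lattice.

Section PositivePart.
Variables (K : fieldType) (m : nat) (L : lieAlgType K) (e : 'I_m -> L).

(* Every degree contains [0], so [npos g x] does not force [g] to be positive. *)
Inductive npos : 'rV[int]_m -> L -> Prop :=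
| npos_0 g : npos g 0
| npos_gen i : npos (alpha i) (e i)
| npos_ad i g x : npos g x -> npos (alpha i + g) [lie e i, x]
| npos_D g x y : npos g x -> npos g y -> npos g (x + y)
| npos_Z g a x : npos g x -> npos g (a *: x).

Lemma npos_positive g x : npos g x -> x = 0 \/ positive g.
Proof.
elim=> {g x} [g|i|i g x _ [-> |gp]|g x y _ IHx _ IHy|g a x _ [->|gp]].
- by left.
- by right; apply: positive_alpha.
- by left; rewrite lie0r.
- by right; apply/positiveD => //; apply: positive_alpha.
- by case: IHx IHy => [->|gp] [->|gp']; rewrite ?addr0; auto.
- by left; rewrite scaler0.
- by right.
Qed.

End PositivePart.

Lemma npos_hom (K : fieldType) m (L M : lieAlgType K) (f : L -> M)
    (e : 'I_m -> L) (e' : 'I_m -> M) :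
  lie_hom f -> (forall i, f (e i) = e' i) ->
  forall g x, npos e g x -> npos e' g (f x).
Proof.
move=> hf fe g x; elim=> {g x} [g|i|i g x _ IH|g x y _ IHx _ IHy|g a x _ IH].
- by rewrite (lie_hom0 hf); apply: npos_0.
- by rewrite fe; apply: npos_gen.
- by rewrite (lie_homE hf) fe; apply: npos_ad.
- by rewrite (lie_homD hf); apply: npos_D.
- by rewrite (lie_homZ hf); apply: npos_Z.
Qed.

Section Chevalley.
Variables (K : fieldType) (m : nat) (C : lmodType K).
Variables (root : 'I_m -> C -> K) (cor : 'I_m -> C).

Definition weight (g : 'rV[int]_m) (y : C) : K := \sum_i (g 0 i)%:~R * root i y.

Lemma weightD g g' y : weight (g + g') y = weight g y + weight g' y.
Proof.
by rewrite /weight -big_split; apply: eq_bigr => i _; rewrite mxE intrD mulrDl.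
Qed.

Lemma weightN g y : weight (- g) y = - weight g y.
Proof. by rewrite /weight -sumrN; apply: eq_bigr => i _; rewrite mxE intrN mulNr. Qed.

Lemma weight0 y : weight 0 y = 0.
Proof. by rewrite /weight big1 // => i _; rewrite mxE mul0r. Qed.

Lemma weight_alpha i y : weight (alpha i) y = root i y.
Proof.
rewrite /weight (bigD1 i) //= mxE !eqxx mul1r big1 ?addr0 // => j ji.
by rewrite mxE (negPf ji) andbF mul0r.
Qed.

(** These relations are shared by [g~(A)], g(A), [g0] and the root vectors of a pi-system; [C] and
    [root] stay abstract so that one set of lemmas serves them all. *)
Definition chevalley_rels (L : lieAlgType K) (e f : 'I_m -> L) (h : C -> L) : Prop :=
  [/\ linear h,
      forall i j, [lie e i, f j] = if i == j then h (cor i) else 0,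
      forall x y, [lie h x, h y] = 0,
      forall x i, [lie h x, e i] = root i x *: e i
    & forall x i, [lie h x, f i] = - root i x *: f i].

Section Triangular.
Variables (L : lieAlgType K) (e f : 'I_m -> L) (h : C -> L).
Hypothesis rels : chevalley_rels e f h.

Lemma cartan_linear : linear h. Proof. by case: rels. Qed.

Lemma cartan0 : h 0 = 0.
Proof.
have := cartan_linear (-1) 0 0; rewrite scaler0 addr0 scaleN1r.
by rewrite addNr.
Qed.

Lemma cartanZ a x : h (a *: x) = a *: h x.
Proof. by have := cartan_linear a x 0; rewrite addr0 cartan0 addr0. Qed.

Lemma cartanD x y : h (x + y) = h x + h y.
Proof. by have := cartan_linear 1 x y; rewrite !scale1r. Qed.

Lemma cartanN x : h (- x) = - h x.
Proof. by rewrite -scaleN1r cartanZ scaleN1r. Qed.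

(** The Chevalley involution: statements about the [f i] follow from those about the [e i]. *)
Lemma chevalley_swap : chevalley_rels f e (fun x => - h x).
Proof.
have [hl ef hh he hf] := rels; split=> [a x y|i j|x y|x i|x i].
- by rewrite hl opprD scalerN.
- by rewrite lieC ef eq_sym; case: eqP => [->|] //; rewrite oppr0.
- by rewrite lieNl lieNr hh !oppr0.
- by rewrite lieNl hf scaleNr opprK.
- by rewrite lieNl he scaleNr.
Qed.

Lemma npos_weight g x : npos e g x -> forall y, [lie h y, x] = weight g y *: x.
Proof.
have [hl ef hh he hf] := rels.
elim=> {g x} [g|i|i g x _ IH|g x x' _ IHx _ IHx'|g a x _ IH] y.
- by rewrite lie0r scaler0.
- by rewrite he weight_alpha.
- by rewrite lieAr he lieZl IH lieZr -scalerDl weightD weight_alpha.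
- by rewrite lieDr IHx IHx' scalerDr.
- by rewrite lieZr IH !scalerA mulrC.
Qed.

(** By the Jacobi identity [f j] passes through a nested bracket of the [e i] until it meets an
    [e j]; a Cartan term survives only when that [e j] is the whole bracket. *)
Lemma npos_lower j g x : npos e g x ->
  exists c y, [/\ [lie f j, x] = c *: h (cor j) + y, npos e (g - alpha j) y
    & c = 0 \/ g = alpha j].
Proof.
have [hl ef hh he hf] := rels.
have fe i : [lie f j, e i] = if i == j then - h (cor j) else 0.
  by rewrite lieC ef; case: eqP => [->|]; rewrite ?oppr0.
elim=> {g x} [g|i|i g x gx [c [y [IH gy cg]]]|g x x'
  _ [c [y [IH gy cg]]] _ [c' [y' [IH' gy' cg']]]|g a x _ [c [y [IH gy cg]]]].
- by exists 0, 0; rewrite lie0r scale0r addr0; split; auto; apply: npos_0.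
- rewrite fe; case: eqP => [->|_].
    by exists (-1), 0; rewrite scaleN1r addr0; split; auto; apply: npos_0.
  by exists 0, 0; rewrite scale0r addr0; split; auto; apply: npos_0.
(* The summands are the bracket of [[f j, e i]] with [x], then those of [e i] with the Cartan part
   and with the rest of [[f j, x]]. *)
- exists 0, ((if i == j then - weight g (cor j) *: x else 0)
     + (- (c * root i (cor j)) *: e i) + [lie e i, y]).
  split; last by left.
  + rewrite lieAr IH lieDr lieZr (lieC (e i) (h _)) he fe scale0r add0r addrA.
    rewrite scalerN scalerA -!scaleNr; do 2!congr (_ + _).
    by case: eqP => _; rewrite ?lie0l // lieNl (npos_weight gx) -scaleNr.
  + apply: npos_D; last by rewrite -addrA; apply: npos_ad.
    apply: npos_D.
      case: eqP => [->|_]; last exact: npos_0.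
      by rewrite (addrC (alpha j)) addrK; apply: npos_Z.
    case: cg => [->|->]; first by rewrite mul0r oppr0 scale0r; apply: npos_0.
    by rewrite addrK; apply/npos_Z/npos_gen.
- exists (c + c'), (y + y'); rewrite lieDr IH IH' scalerDl addrACA; split=> //.
    exact: npos_D.
  by case: cg cg' => [->|->] [->|]; rewrite ?addr0; auto.
- exists (a * c), (a *: y); rewrite lieZr IH scalerDr scalerA; split=> //.
    exact: npos_Z.
  by case: cg => [->|->]; rewrite ?mulr0; auto.
Qed.

(** Written as a sum, so that closure under addition is immediate; [homogeneous_cases] recovers that
    at most one of the three terms is nonzero. *)
Definition homogeneous (g : 'rV[int]_m) (x : L) : Prop :=
  exists u v c, [/\ npos e g u, npos f (- g) v, g = 0 \/ c = 0 & x = u + v + h c].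

Lemma homogeneous_subspace g : subspace (homogeneous g).
Proof.
split=> [|x x' [u [v [c [gu gv gc ->]]]] [u' [v' [c' [gu' gv' gc' ->]]]]
        |a x [u [v [c [gu gv gc ->]]]]].
- exists 0, 0, 0; rewrite cartan0 !addr0; split=> //; try exact: npos_0.
  by right.
- exists (u + u'), (v + v'), (c + c'); split; try exact: npos_D.
    by case: gc gc' => [->|->] [|->]; rewrite ?addr0; auto.
  by rewrite cartanD; lmod_ring.
- exists (a *: u), (a *: v), (a *: c); split; try exact: npos_Z.
    by case: gc => [->|->]; rewrite ?scaler0; auto.
  by rewrite cartanZ !scalerDr.
Qed.

Lemma homogeneous_pos g x : npos e g x -> homogeneous g x.
Proof.
move=> gx; exists x, 0, 0; rewrite cartan0 !addr0; split=> //; first exact: npos_0.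
by right.
Qed.

Lemma homogeneous_neg g x : npos f (- g) x -> homogeneous g x.
Proof.
move=> gx; exists 0, x, 0; rewrite cartan0 addr0 add0r; split=> //; first exact: npos_0.
by right.
Qed.

Lemma homogeneous_cartan c : homogeneous 0 (h c).
Proof.
exists 0, 0, c; rewrite !add0r; split=> //; try exact: npos_0.
by left.
Qed.

Lemma homogeneous_cases g x : homogeneous g x ->
  [\/ positive g /\ npos e g x, positive (- g) /\ npos f (- g) x,
    g = 0 /\ (exists c, x = h c) | x = 0].
Proof.
case=> u [v [c [gu gv gc ->]]].
have [u0|gp] := npos_positive gu; have [v0|gn] := npos_positive gv.
- case: gc => [g0|c0]; last by constructor 4; rewrite u0 v0 c0 cartan0 !addr0.
  by constructor 3; split=> //; exists c; rewrite u0 v0 !add0r.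
- constructor 2; split=> //; case: gc => [g0|->]; last by rewrite u0 add0r cartan0 addr0.
  by case: (positive_neq0 gn); rewrite g0 oppr0.
- constructor 1; split=> //; case: gc => [g0|->]; last by rewrite v0 addr0 cartan0 addr0.
  by case: (positive_neq0 gp).
- by case: (positiveN gp).
Qed.

End Triangular.

Section Grading.
Variables (L : lieAlgType K) (e f : 'I_m -> L) (h : C -> L).
Hypothesis rels : chevalley_rels e f h.
Local Notation homogeneous := (homogeneous e f h).

Lemma npos_f_weight g x : npos f (- g) x -> forall y, [lie h y, x] = weight g y *: x.
Proof.
move=> /(npos_weight (chevalley_swap rels)) fx y.
by rewrite -[h y]opprK lieNl fx weightN -scaleNr opprK.
Qed.

Lemma homogeneous_weight g x : homogeneous g x ->
  forall y, [lie h y, x] = weight g y *: x.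
Proof.
case/(homogeneous_cases rels) => [[_ gx]|[_ gx]|[-> [c ->]]|->] y.
- exact: (npos_weight rels).
- exact: npos_f_weight.
- by have [_ _ hh _ _] := rels; rewrite hh weight0 scale0r.
- by rewrite lie0r scaler0.
Qed.

Lemma homogeneous_ad_e i g x : homogeneous g x ->
  homogeneous (alpha i + g) [lie e i, x].
Proof.
have [_ ef hh he hf] := rels.
have [H0 HD HZ] := homogeneous_subspace rels (alpha i + g).
case/(homogeneous_cases rels) => [[_ gx]|[_ gx]|[g0 [c ->]]|->].
- by apply: (homogeneous_pos rels); apply: npos_ad.
- have [c [y [-> gy gc]]] := npos_lower (chevalley_swap rels) i gx.
  apply: HD.
    case: gc => [->|gi]; first by rewrite scale0r.
    rewrite -[g]opprK gi subrr scalerN -scaleNr -(cartanZ rels).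
    exact: homogeneous_cartan.
  by apply: homogeneous_neg => //; rewrite opprD addrC.
- rewrite g0 addr0 lieC he -scaleNr.
  by apply: (homogeneous_pos rels); apply/npos_Z/npos_gen.
- by rewrite lie0r.
Qed.

End Grading.

Lemma homogeneous_swap (L : lieAlgType K) (e f : 'I_m -> L) (h : C -> L) g x :
  chevalley_rels e f h -> homogeneous e f h g x <->
  homogeneous f e (fun x => - h x) (- g) x.
Proof.
move=> rels; split=> -[u [v [c [gu gv gc ->]]]]; exists v, u, (- c).
  rewrite (cartanN rels) !opprK (addrC v); split=> //.
  by case: gc => ->; rewrite oppr0; auto.
rewrite (cartanN rels) (addrC v); split=> //; first by rewrite -[g]opprK.
by case: gc => [/eqP|->]; rewrite ?oppr_eq0 ?oppr0; [move/eqP|]; auto.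
Qed.

Definition h_trivial (L : lieAlgType K) (h : C -> L) (I : lieIdeal L) : Prop :=
  forall x, I (h x) -> h x = 0.

Section Decomposition.
Variables (L : lieAlgType K) (e f : 'I_m -> L) (h : C -> L).
Hypothesis rels : chevalley_rels e f h.
Local Notation homogeneous := (homogeneous e f h).

Lemma homogeneous_ad_f i g x : homogeneous g x ->
  homogeneous (g - alpha i) [lie f i, x].
Proof.
move=> /(homogeneous_swap _ _ rels) /(homogeneous_ad_e (chevalley_swap rels) i) gx.
by apply/(homogeneous_swap _ _ rels); rewrite opprB.
Qed.

Definition chevalley_gen (x : L) : Prop :=
  [\/ exists i, x = e i, exists i, x = f i | exists c, x = h c].

Lemma graded_decomposition : lie_generated chevalley_gen ->
  forall x, graded_sum homogeneous x.
Proof.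
have [_ ef hh he hf] := rels => genL.
have subH := homogeneous_subspace rels.
have subG := graded_sum_subspace subH.
have HG := graded_sum_homogeneous subH.
have stab : forall z x, graded_sum homogeneous x -> graded_sum homogeneous [lie z, x].
  apply: (generated_stable genL) => // z x zgen [s [c [us Hc ->]]].
  rewrite lie_sumr; apply: subspace_sum => // g _.
  case: zgen => -[i ->].
  - exact/HG/homogeneous_ad_e.
  - exact/HG/homogeneous_ad_f.
  - by rewrite (homogeneous_weight rels (Hc g)); case: subG => _ _; apply; apply: HG.
apply: genL; first by split=> // x y _; apply: stab.
move=> x [[i ->]|[i ->]|[c ->]].
- by apply: (HG (alpha i)); apply: (homogeneous_pos rels); apply: npos_gen.
- apply: (HG (- alpha i)); apply: (homogeneous_neg rels); rewrite opprK.
  exact: npos_gen.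
- by apply: (HG 0); apply: homogeneous_cartan.
Qed.

Hypothesis weight_inj : forall g, (forall y, weight g y = 0) -> g = 0.

(** Distinct degrees have distinct weights by [weight_inj], so a subspace stable under the Cartan
    part is graded. *)
Lemma homogeneous_components (J : L -> Prop) (s : seq 'rV[int]_m)
    (c : 'rV[int]_m -> L) :
  subspace J -> (forall x y, J x -> J [lie h y, x]) -> uniq s ->
  (forall g, homogeneous g (c g)) ->
  J (\sum_(g <- s) c g) -> {in s, forall g, J (c g)}.
Proof.
move=> subJ hJ us Hc Jc.
apply: (eigen_independent (T := fun y x => [lie h y, x]) _ subJ _
          (b := weight) us) => //.
- by move=> y a x z; rewrite lieDr lieZr.
- by move=> y x Jx; apply: hJ.
- by move=> g _ y; apply: (homogeneous_weight rels).
- move=> g g' gg'; apply: contrapT => noy.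
  have gg'0 : g - g' = 0.
    apply: weight_inj => y; rewrite weightD weightN.
    by apply/eqP; rewrite subr_eq0; apply: contrapT => /negP yy; apply: noy; exists y.
  by move/eqP: gg'0; rewrite subr_eq0 (negPf gg').
Qed.

Definition offdiagonal (g : 'rV[int]_m) (x : L) : Prop :=
  homogeneous g x /\ (g = 0 -> x = 0).

Lemma offdiagonal_subspace g : subspace (offdiagonal g).
Proof.
have [H0 HD HZ] := homogeneous_subspace rels g.
split=> [|x y [gx x0] [gy y0]|a x [gx x0]]; split=> //.
- exact: HD.
- by move=> g0; rewrite x0 // y0 // addr0.
- exact: HZ.
- by move=> g0; rewrite x0 // scaler0.
Qed.

Lemma offdiagonal_cartan x : graded_sum offdiagonal (h x) -> h x = 0.
Proof.
case=> s [c [us Hc xc]].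
(* The components of [h x - h x = 0], with the first copy split by [c]; as [c 0 = 0], the one of
   degree zero is [- h x]. *)
pose d g := (if g \in s then c g else 0) - (if g == 0 then h x else 0).
have c00 : c 0 = 0 by case: (Hc 0) => _ ->.
have us0 : uniq (undup (0 :: s)) by apply: undup_uniq.
have := homogeneous_components (J := fun z => z = 0) (c := d) _ _ us0 _ _.
move=> /(_ _ _ _ _ 0); rewrite mem_undup mem_head /d eqxx c00 if_same sub0r.
move=> d0; apply/eqP; rewrite -oppr_eq0; apply/eqP/d0 => //.
- by split=> [//|y z -> ->|a y ->]; rewrite ?addr0 ?scaler0.
- by move=> y z ->; rewrite lie0r.
- move=> g; apply: subspaceB; first exact: (homogeneous_subspace rels).
    by case: ifP => _; [case: (Hc g) | case: (homogeneous_subspace rels g)].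
  case: eqP => [->|_]; first exact: homogeneous_cartan.
  by case: (homogeneous_subspace rels g).
- rewrite sumrB sum_supported // => [|g gs]; last by rewrite mem_undup inE gs orbT.
  rewrite -xc -big_mkcond -big_filter.
  have -> : [seq g <- undup (0 :: s) | g == 0] = [:: 0].
    by apply: filter_pred1_uniq; rewrite ?mem_undup ?mem_head.
  by rewrite big_seq1 subrr.
Qed.

End Decomposition.
End Chevalley.

(** * Endomorphisms and affine maps *)

Section Endomorphisms.
Variables (K : fieldType) (V : lmodType K).

Definition linear_pred : {pred (V -> V)} := fun f => `[< linear f >].

Lemma linear_pred_submod_closed : submod_closed linear_pred.
Proof.
split=> [|a f g /asboolP lf /asboolP lg]; apply/asboolP => b x y.
  by rewrite /= scaler0 addr0.
rewrite !fctE lf lg; lmod_ring.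
Qed.

HB.instance Definition _ :=
  GRing.isSubmodClosed.Build K (V -> V) linear_pred
    (GRing.submod_closed_semi linear_pred_submod_closed).

Record endo := Endo { endo_fun :> V -> V; _ : endo_fun \in linear_pred }.

HB.instance Definition _ := [isSub for endo_fun].
HB.instance Definition _ := [Choice of endo by <:].
HB.instance Definition _ := [SubChoice_isSubLmodule of endo by <:].

Lemma endo_linear (f : endo) : linear f.
Proof. by case: f => f lf; apply/asboolP. Qed.

HB.instance Definition _ (f : endo) :=
  GRing.isLinear.Build K V V *:%R f (endo_linear f).

Lemma endo_ext (f g : endo) : f =1 g -> f = g.
Proof. by move=> fg; apply/val_inj/funext. Qed.

Lemma mem_linear_pred (f : V -> V) : linear f -> f \in linear_pred.
Proof. by move=> lf; apply/asboolP. Qed.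

Definition mk_endo (f : V -> V) (lf : linear f) : endo := Endo (mem_linear_pred lf).

Lemma endoDE (f g : endo) x : (f + g) x = f x + g x. Proof. by []. Qed.
Lemma endoZE a (f : endo) x : (a *: f) x = a *: f x. Proof. by []. Qed.
Lemma endo0E x : (0 : endo) x = 0. Proof. by []. Qed.
Lemma endoNE (f : endo) x : (- f) x = - f x. Proof. by []. Qed.

Lemma endo_additive (f : endo) x y : f (x + y) = f x + f y.
Proof. exact: linearD. Qed.

Lemma endoB (f : endo) x y : f (x - y) = f x - f y.
Proof. exact: linearB. Qed.

Lemma endoZ (f : endo) a x : f (a *: x) = a *: f x.
Proof. exact: linearZ. Qed.

Lemma endo0 (f : endo) : f 0 = 0.
Proof. exact: linear0. Qed.

Fact comm_is_linear (f g : endo) : linear (fun x => f (g x) - g (f x)).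
Proof. by move=> a x y /=; rewrite !linearP; lmod_ring. Qed.

Definition endo_lie (f g : endo) : endo := mk_endo (comm_is_linear f g).

Lemma endo_lieE (f g : endo) x : endo_lie f g x = f (g x) - g (f x).
Proof. by []. Qed.

Let endoE := (endo_lieE, endoDE, endoZE, endo0E, endoNE).

Fact endo_lieDl f g k : endo_lie (f + g) k = endo_lie f k + endo_lie g k.
Proof. by apply: endo_ext => x; rewrite !endoE linearD; lmod_ring. Qed.

Fact endo_lieDr f g k : endo_lie f (g + k) = endo_lie f g + endo_lie f k.
Proof. by apply: endo_ext => x; rewrite !endoE linearD; lmod_ring. Qed.

Fact endo_lieZl a f g : endo_lie (a *: f) g = a *: endo_lie f g.
Proof. by apply: endo_ext => x; rewrite !endoE linearZ; lmod_ring. Qed.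

Fact endo_lieZr a f g : endo_lie f (a *: g) = a *: endo_lie f g.
Proof. by apply: endo_ext => x; rewrite !endoE linearZ; lmod_ring. Qed.

Fact endo_liexx f : endo_lie f f = 0.
Proof. by apply: endo_ext => x; rewrite !endoE subrr. Qed.

Fact endo_jacobi f g k :
  endo_lie f (endo_lie g k) + endo_lie g (endo_lie k f)
    + endo_lie k (endo_lie f g) = 0.
Proof. by apply: endo_ext => x; rewrite !endoE !linearB; lmod_ring. Qed.

HB.instance Definition _ := Lmodule_isLie.Build K endo
  endo_lieDl endo_lieDr endo_lieZl endo_lieZr endo_liexx endo_jacobi.

Lemma lie_endoE (f g : endo) x : [lie f, g] x = f (g x) - g (f x).
Proof. by []. Qed.

(** The semidirect product of [endo] by [V]: a homomorphism into it is a representation together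
    with a 1-cocycle. This lets the cobracket be defined by its values on generators. *)
Definition affine : Type := (endo * V)%type.
HB.instance Definition _ := GRing.Lmodule.on affine.

Definition affine_lie (p q : affine) : affine :=
  ([lie p.1, q.1], p.1 q.2 - q.1 p.2).

Fact affine_lieDl p q r : affine_lie (p + q) r = affine_lie p r + affine_lie q r.
Proof.
congr pair; first exact: lieDl.
by rewrite [RHS]/= [_.1]/= endoDE [_.2]/= linearD; lmod_ring.
Qed.

Fact affine_lieDr p q r : affine_lie p (q + r) = affine_lie p q + affine_lie p r.
Proof.
congr pair; first exact: lieDr.
by rewrite [RHS]/= [_.1]/= endoDE [_.2]/= linearD; lmod_ring.
Qed.

Fact affine_lieZl a p q : affine_lie (a *: p) q = a *: affine_lie p q.
Proof.
congr pair; first exact: lieZl.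
by rewrite [RHS]/= [_.1]/= endoZE [_.2]/= linearZ; lmod_ring.
Qed.

Fact affine_lieZr a p q : affine_lie p (a *: q) = a *: affine_lie p q.
Proof.
congr pair; first exact: lieZr.
by rewrite [RHS]/= [_.1]/= endoZE [_.2]/= linearZ; lmod_ring.
Qed.

Fact affine_liexx p : affine_lie p p = 0.
Proof. by congr pair; rewrite /= ?liexx ?subrr. Qed.

Fact affine_jacobi p q r :
  affine_lie p (affine_lie q r) + affine_lie q (affine_lie r p)
    + affine_lie r (affine_lie p q) = 0.
Proof.
congr pair; first exact: lie_jacobi.
by rewrite /= ?linearB; lmod_ring.
Qed.

HB.instance Definition _ := Lmodule_isLie.Build K affine
  affine_lieDl affine_lieDr affine_lieZl affine_lieZr affine_liexx affine_jacobi.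

End Endomorphisms.

(** * Structure of Kac-Moody algebras *)

(* The graded dual of a Verma module of highest weight [lam] over the free
   algebra on the [f_i]: words index a basis, and functions on words carry the
   transposed action. *)
Section WordModule.
Variables (K : fieldType) (n : nat) (A : 'M[int]_n) (R : realization K A).
Local Notation C := (cartan R).
Variable lam : {scalar C}.
Local Notation root i x := (simple_root R i x : K).
Local Notation cor := (simple_coroot R).
Local Notation V := (seq 'I_n -> K^o).

Definition word_weight (w : seq 'I_n) (y : C) : K := lam y - \sum_(i <- w) root i y.

Definition word_h (y : C) (v : V) : V := fun w => word_weight w y * v w.
Definition word_e (i : 'I_n) (v : V) : V := fun w => v (i :: w).
(** Forced by the relations: [(f i v) (j :: w)] is [(e j (f i v)) w], and [e j] moves past [f i] at
    the cost of a Cartan term when [i = j]. *)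
Fixpoint word_f_at (i : 'I_n) (w : seq 'I_n) (v : V) : K :=
  if w is j :: w' then word_f_at i w' (word_e j v)
    + (if i == j then word_h (cor i) v w' else 0) else 0.
Definition word_f (i : 'I_n) (v : V) : V := fun w => word_f_at i w v.

Lemma word_weight_cons i w y : word_weight (i :: w) y = word_weight w y - root i y.
Proof. by rewrite /word_weight big_cons; ring. Qed.

Lemma word_h_linear y : linear (word_h y).
Proof.
by move=> a u v; apply/funext => w; rewrite /word_h !fctE /GRing.scale /=; ring.
Qed.

Lemma word_e_linear i : linear (word_e i).
Proof. by []. Qed.

Lemma word_f_linear i : linear (word_f i).
Proof.
move=> a u v; apply/funext => w; rewrite /word_f !fctE.
elim: w u v => [|j w IHw] u v /=; first by rewrite scaler0 addr0.
rewrite word_e_linear IHw; case: eqP => _; last by rewrite !addr0.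
rewrite word_h_linear !fctE /GRing.scale /=; ring.
Qed.

Lemma word_hf i y v : word_h y (word_f i v) - word_f i (word_h y v)
  = - root i y *: word_f i v.
Proof.
apply/funext => w; rewrite /word_f !fctE {1}/word_h /GRing.scale /=.
elim: w v => [|j w IHw] v /=; first by rewrite !mulr0 subrr.
have -> : word_e j (word_h y v) = (- root j y) *: word_e j v + word_h y (word_e j v).
  apply/funext => u; rewrite /word_e /word_h !fctE word_weight_cons /GRing.scale /=.
  ring.
have := word_f_linear i (- root j y) (word_e j v) (word_h y (word_e j v)).
move/(congr1 (fun F : V => F w)); rewrite /word_f !fctE => ->.
have /eqP := IHw (word_e j v); rewrite subr_eq => /eqP.
rewrite word_weight_cons /GRing.scale /=.
case: eqP => [<-|_] IH; rewrite mulrDr mulrBl IH /word_h; ring.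
Qed.

Definition word_gen (x : km_gen R) : endo V :=
  match x with
  | GenE i => mk_endo (word_e_linear i)
  | GenF i => mk_endo (word_f_linear i)
  | GenH y => mk_endo (word_h_linear y)
  end.

Lemma word_rels t u : km_rel (R := R) t u -> lie_eval word_gen t = lie_eval word_gen u.
Proof.
case=> {t u} [a x y|i|i j ij|x y|x i|x i] /=; apply: endo_ext => v.
- apply/funext => w; rewrite /= !fctE /word_h /word_weight linearP /= /GRing.scale /=.
  rewrite (eq_bigr (fun i => a * root i x + root i y)); last first.
    by move=> i _; rewrite linearP.
  by rewrite big_split -mulr_sumr /=; ring.
- apply/funext => w.
  by rewrite /= !fctE /word_e /word_f /= eqxx addrC addKr.
- apply/funext => w.
  by rewrite /= !fctE /word_e /word_f /= eq_sym (negPf ij) addr0 subrr.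
- by apply/funext => w; rewrite /= !fctE /word_h mulrCA subrr.
- apply/funext => w.
  rewrite /= !fctE /word_h /word_e word_weight_cons /GRing.scale /=; ring.
- exact: word_hf.
Qed.

Lemma tilde_h_functional x : tilde_h x = 0 -> lam x = 0.
Proof.
move=> x0.
have := pres_liftE word_rels (LGen (GenH x)).
rewrite -[pres_pi _ _]/(tilde_h x) x0 (lie_hom0 (pres_lift_hom word_rels)) /=.
(* The empty word has weight [lam], so applying [tilde_h x] to the constant function 1 gives the
   value [lam x] there. *)
move/(congr1 (fun F : endo V => F (fun=> 1) [::])).
by rewrite /= /word_h /word_weight big_nil subr0 mulr1.
Qed.

End WordModule.

Lemma free_enum (K : fieldType) (V : vectType K) n (F : 'I_n -> V) (c : 'I_n -> K) :
  free [seq F i | i <- enum 'I_n] -> \sum_i c i *: F i = 0 -> forall i, c i = 0.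
Proof.
move=> freeF sum0; apply: (freeP (X := map_tuple F (ord_tuple n)) freeF).
rewrite -[RHS]sum0; apply: eq_bigr => i _.
by rewrite -tnth_nth tnth_map tnth_ord_tuple.
Qed.

Section KacMoodyStructure.
Variables (K : numFieldType) (n : nat) (A : 'M[int]_n) (R : realization K A).
Local Notation C := (cartan R).
Local Notation root := (fun i (x : C) => simple_root R i x : K).
Local Notation cor := (simple_coroot R).
Local Notation wt := (weight root).

Lemma tilde_h_inj x : tilde_h (R := R) x = 0 -> x = 0.
Proof.
by move=> x0; apply: scalar_ext => xi; rewrite linear0; apply: tilde_h_functional.
Qed.

Definition tilde_e i : km_tilde R := pres_pi (km_rel (R := R)) (LGen (GenE R i)).
Definition tilde_f i : km_tilde R := pres_pi (km_rel (R := R)) (LGen (GenF R i)).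

Lemma tilde_chevalley : chevalley_rels root cor tilde_e tilde_f (tilde_h (R := R)).
Proof.
split=> [a x y|i j|x y|x i|x i]; rewrite ?[in LHS]/tilde_h ?[in LHS]/tilde_e ?[in LHS]/tilde_f.
- by rewrite -pres_piZ -pres_piD; apply/pres_piP/lc_rel/km_lin.
- rewrite -pres_pi_lie; case: eqP => [<-|/eqP ij]; first exact/pres_piP/lc_rel/km_EF.
  by rewrite -pres_pi0; apply/pres_piP/lc_rel/km_EF0.
- by rewrite -pres_pi_lie -pres_pi0; apply/pres_piP/lc_rel/km_HH.
- by rewrite -pres_pi_lie -pres_piZ; apply/pres_piP/lc_rel/km_HE.
- by rewrite -pres_pi_lie -pres_piZ; apply/pres_piP/lc_rel/km_HF.
Qed.

Lemma tilde_generated : lie_generated (chevalley_gen tilde_e tilde_f (tilde_h (R := R))).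
Proof.
move=> S subS Sgen; apply: (pres_generated subS) => _ [[i|i|x] ->]; apply: Sgen.
- by constructor 1; exists i.
- by constructor 2; exists i.
- by constructor 3; exists x.
Qed.

Lemma root_independent (g : 'rV[int]_n) : (forall y, wt g y = 0) -> g = 0.
Proof.
move=> g0; apply/rowP => i; rewrite [RHS]mxE.
have := free_enum (c := fun i => (g 0 i)%:~R) (simple_root_free R).
move=> /(_ _ i)/eqP; rewrite intr_eq0 => /(_ _)/eqP; apply.
apply/lfunP => y; rewrite lfunE /= -[RHS](g0 y) sum_lfunE.
by apply: eq_bigr => j _; rewrite lfunE.
Qed.

Lemma km_chevalley : chevalley_rels root cor (km_e R) (km_f R) (km_h (R := R)).
Proof.
have [hl ef hh he hf] := tilde_chevalley.
split=> [a x y|i j|x y|x i|x i]; rewrite ?[in LHS]/km_h ?[in LHS]/km_e ?[in LHS]/km_f.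
- by rewrite hl quot_piD quot_piZ.
- by rewrite -quot_pi_lie ef; case: eqP => //; rewrite quot_pi0.
- by rewrite -quot_pi_lie hh quot_pi0.
- exact: km_he.
- exact: km_hf.
Qed.

Lemma km_generated : lie_generated (chevalley_gen (km_e R) (km_f R) (km_h (R := R))).
Proof.
move=> S [[S0 SD SZ] SL] Sgen x; rewrite -[x]quot_pi_repr.
have := @tilde_generated (fun y => S (quot_pi (km_radical R) y)); apply.
- split; first split.
  + by rewrite quot_pi0.
  + by move=> y z; rewrite quot_piD; apply: SD.
  + by move=> a y; rewrite quot_piZ; apply: SZ.
  + by move=> y z; rewrite quot_pi_lie; apply: SL.
- move=> y [[i ->]|[i ->]|[c ->]]; apply: Sgen.
  + by constructor 1; exists i.
  + by constructor 2; exists i.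
  + by constructor 3; exists c.
Qed.

Local Notation offdiagonal := (offdiagonal tilde_e tilde_f (tilde_h (R := R))).

(** The ideal contains the homogeneous components of [y]; the one of degree zero lies in h, hence
    vanishes. *)
Lemma h_trivial_offdiagonal I y : h_trivial (tilde_h (R := R)) I -> I y ->
  graded_sum offdiagonal y.
Proof.
move=> I0; have := graded_decomposition tilde_chevalley tilde_generated y.
case=> s [c [us Hc ->]] Iy.
have Ic : {in s, forall g, I (c g)}.
  apply: (homogeneous_components tilde_chevalley root_independent) Iy => //.
    exact: ideal_subspace.
  by move=> x z; apply: ideal_lie.
apply: subspace_sum; first exact/graded_sum_subspace/(offdiagonal_subspace tilde_chevalley).
move=> g gs; apply: (graded_sum_homogeneous (offdiagonal_subspace tilde_chevalley) (i := g)).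
split=> // g0; have := Hc g; have := Ic g gs.
case/(homogeneous_cases tilde_chevalley): (Hc g) => [[gp _]|[gp _]|[_ [d ->]]|-> //].
- by case: (positive_neq0 gp).
- by case: (positive_neq0 gp); rewrite g0 oppr0.
- by move=> /I0.
Qed.

(** Meeting h trivially is not visibly stable under sums of ideals, but having no Cartan component
    is stable under sums of elements. *)
Lemma radical_h x : km_radical R (tilde_h x) -> x = 0.
Proof.
move=> [r [xr rI]]; apply: tilde_h_inj.
apply: (offdiagonal_cartan tilde_chevalley root_independent).
rewrite xr; apply: subspace_sum => [|y /rI[I [I0 Iy]]].
  exact/graded_sum_subspace/(offdiagonal_subspace tilde_chevalley).
exact: h_trivial_offdiagonal Iy.
Qed.

Lemma km_h_inj x : km_h (R := R) x = 0 -> x = 0.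
Proof.
move=> /(quot_piP (km_radical R) _ 0).1; rewrite subr0; exact: radical_h.
Qed.

(** The preimage of [I] in [g~(A)] meets h trivially, so it lies in the radical. *)
Lemma km_h_trivial_ideal (I : lieIdeal (km_alg R)) :
  h_trivial (km_h (R := R)) I -> forall x, I x -> x = 0.
Proof.
move=> I0 x; rewrite -[x]quot_pi_repr => Ix.
have J0 : I (quot_pi (km_radical R) 0) by rewrite quot_pi0; apply: ideal0.
have JD y z : I (quot_pi (km_radical R) y) -> I (quot_pi (km_radical R) z) ->
    I (quot_pi (km_radical R) (y + z)) by rewrite quot_piD; apply: idealD.
have JZ a y : I (quot_pi (km_radical R) y) -> I (quot_pi (km_radical R) (a *: y)).
  by rewrite quot_piZ; apply: idealZ.
have JL y z : I (quot_pi (km_radical R) z) -> I (quot_pi (km_radical R) [lie y, z]).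
  by rewrite quot_pi_lie; apply: ideal_lie.
apply/(quot_piP (km_radical R) _ 0); rewrite subr0.
exists [:: repr x]; rewrite big_seq1; split=> // y; rewrite mem_seq1 => /eqP ->.
exists (LieIdeal J0 JD JZ JL); split=> // z /= /I0 /km_h_inj ->.
exact: (cartan0 tilde_chevalley).
Qed.

End KacMoodyStructure.

(** * Serre relations and weights *)

Section IterLie.
Variables (K : fieldType) (L : lieAlgType K).
Implicit Types x y z : L.

Lemma iter_lie_subspace z N : subspace (fun x => iter N (lie z) x = 0).
Proof.
elim: N => [|N [S0 SD SZ]].
  by split=> [//|x y /= -> ->|a x /= ->]; rewrite ?addr0 ?scaler0.
split=> [|x y|a x]; rewrite !iterSr.
- by rewrite lie0r.
- by move=> Sx Sy; rewrite lieDr; apply: SD.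
- by move=> Sx; rewrite lieZr; apply: SZ.
Qed.

Lemma iter_lie_bracket z a b x y : iter a (lie z) x = 0 -> iter b (lie z) y = 0 ->
  iter (a + b) (lie z) [lie x, y] = 0.
Proof.
have iter0 N : iter N (lie z) 0 = 0 by case: (iter_lie_subspace z N).
elim: a b x y => [|a IHa] b x y; first by move=> /= -> _; rewrite lie0l iter0.
elim: b y => [|b IHb] y; first by move=> _ y0; rewrite [y]y0 lie0r iter0.
move=> xz yz; rewrite addSnnS addnS iterSr lieAr.
have [_ SD _] := iter_lie_subspace z (a + b.+1); apply: SD.
  by apply: IHa => //; rewrite -iterSr.
by rewrite -addSnnS; apply: IHb => //; rewrite -iterSr.
Qed.

Lemma iter_lie_le z M N x : (M <= N)%N -> iter M (lie z) x = 0 -> iter N (lie z) x = 0.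
Proof.
move=> /subnK <-; rewrite iterD => ->.
by case: (iter_lie_subspace z (N - M)).
Qed.

Definition ad_nilpotent z x : Prop := exists N, iter N (lie z) x = 0.

Lemma ad_nilpotent_subalgebra z : subalgebra (ad_nilpotent z).
Proof.
split; first split=> [|x y [M xM] [N yN]|a x [M xM]].
- by exists 0%N.
- exists (M + N)%N; have [_ SD _] := iter_lie_subspace z (M + N); apply: SD.
    by apply: iter_lie_le xM; rewrite leq_addr.
  by apply: iter_lie_le yN; rewrite leq_addl.
- by exists M; have [_ _ SZ] := iter_lie_subspace z M; apply: SZ.
- move=> x y [M xM] [N yN]; exists (M + N)%N; exact: iter_lie_bracket.
Qed.

End IterLie.

Section Sl2.
Variables (K : numFieldType) (L : lieAlgType K) (e f h : L).
Hypotheses (ef : [lie e, f] = h) (he : [lie h, e] = 2%:R *: e).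
Hypothesis hf : [lie h, f] = - 2%:R *: f.

Lemma sl2_weight (M : K) u k : [lie h, u] = M *: u ->
  [lie h, iter k (lie f) u] = (M - 2%:R * k%:R) *: iter k (lie f) u.
Proof.
move=> hu; elim: k => [|k IHk]; first by rewrite mulr0 subr0.
rewrite iterS lieAr hf IHk lieZl lieZr -scalerDl; congr (_ *: _).
by rewrite -natr1; ring.
Qed.

Lemma sl2_raise (M : K) u k : [lie e, u] = 0 -> [lie h, u] = M *: u ->
  [lie e, iter k.+1 (lie f) u] = (k.+1%:R * (M - k%:R)) *: iter k (lie f) u.
Proof.
move=> eu hu; elim: k => [|k IHk].
  by rewrite /= lieAr ef eu lie0r addr0 hu mul1r subr0.
rewrite iterS lieAr ef IHk (sl2_weight _ hu) lieZr -iterS -scalerDl.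
by congr (_ *: _); rewrite -!natr1; ring.
Qed.

(** With [k + 1] the least exponent that kills [u], raising back gives [(k + 1) (M - k) = 0], so
    [M = k] in characteristic zero. *)
Lemma sl2_top (M : K) u : [lie e, u] = 0 -> [lie h, u] = M *: u -> u != 0 ->
  ad_nilpotent f u ->
  exists k : nat, M = k%:R /\ forall j, (j <= k)%N -> iter j (lie f) u != 0.
Proof.
move=> eu hu u0 fnil.
pose p N := iter N (lie f) u == 0.
have exp : exists N, p N by case: fnil => N fN; exists N; apply/eqP.
case: (ex_minnP exp) => -[|k] pk kmin; first by rewrite /p /= (negPf u0) in pk.
have nz j : (j <= k)%N -> iter j (lie f) u != 0.
  by move=> jk; apply/negP => /kmin; rewrite ltnNge jk.
exists k; split=> //; apply/eqP.
have := sl2_raise k eu hu; rewrite (eqP pk) lie0r => /esym/eqP.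
rewrite scaler_eq0 (negPf (nz k _)) // orbF mulf_eq0 pnatr_eq0 /=.
by rewrite subr_eq0.
Qed.

End Sl2.

Section Sl2String.
Variables (K : numFieldType) (L : lieAlgType K) (e f h : L).
Hypotheses (ef : [lie e, f] = h) (he : [lie h, e] = 2%:R *: e).
Hypothesis hf : [lie h, f] = - 2%:R *: f.
Hypotheses (enil : forall x, ad_nilpotent e x) (fnil : forall x, ad_nilpotent f x).

(** Climb with [e] to a highest weight vector, then apply [sl2_top] to it. *)
Lemma sl2_string (M : K) x : x != 0 -> [lie h, x] = M *: x ->
  exists N k : nat, M + 2%:R * N%:R = k%:R /\
    forall j, (j <= k)%N -> iter j (lie f) (iter N (lie e) x) != 0.
Proof.
move=> x0 hx; pose p N := iter N (lie e) x == 0.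
have exp : exists N, p N by case: (enil x) => N eN; exists N; apply/eqP.
case: (ex_minnP exp) => -[|N] pN Nmin; first by rewrite /p /= (negPf x0) in pN.
have uN0 : iter N (lie e) x != 0 by apply/negP => /Nmin; rewrite ltnn.
have eu : [lie e, iter N (lie e) x] = 0 by apply/eqP.
have hN : [lie h, iter N (lie e) x] = (M + 2%:R * N%:R) *: iter N (lie e) x.
  elim: (N) => [|k IHk]; first by rewrite mulr0 addr0.
  rewrite iterS lieAr he IHk lieZl lieZr -scalerDl; congr (_ *: _).
  by rewrite -natr1; ring.
by have [k [Mk fk]] := sl2_top ef hf eu hN uN0 (fnil _); exists N, k.
Qed.

End Sl2String.

Section Contragredient.
Variables (K : numFieldType) (n : nat) (A : 'M[int]_n) (C : lmodType K).
Variables (root : 'I_n -> C -> K) (cor : 'I_n -> C).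
Hypothesis root_cor : forall i j, root j (cor i) = (A i j)%:~R.
Hypothesis root_indep : forall g, (forall y, weight root g y = 0) -> g = 0.

(** The characterization of g(A) in a form symmetric under exchange of [e] and [f], so that each
    result about [e] gives one about [f]. *)
Record contragredient (L : lieAlgType K) (e f : 'I_n -> L) (h : C -> L) : Prop := {
  contra_rels : chevalley_rels root cor e f h;
  contra_gen : lie_generated (chevalley_gen e f h);
  contra_ideal : forall I : lieIdeal L, h_trivial h I -> forall x, I x -> x = 0
}.

Section Swap.
Variables (L : lieAlgType K) (e f : 'I_n -> L) (h : C -> L).

Lemma contragredient_swap : contragredient e f h -> contragredient f e (fun x => - h x).
Proof.
case=> rels genL triv; split; first exact: chevalley_swap.
- move=> S subS Sgen; apply: genL => // x [[i ->]|[i ->]|[c ->]]; apply: Sgen.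
  + by constructor 2; exists i.
  + by constructor 1; exists i.
  + by constructor 3; exists (- c); rewrite (cartanN rels) opprK.
- move=> I I0; apply: triv => x Ix; apply/eqP; rewrite -oppr_eq0; apply/eqP/I0.
  exact: idealN.
Qed.

End Swap.

Section Serre.
Variables (L : lieAlgType K) (e f : 'I_n -> L) (h : C -> L).
Hypothesis KM : contragredient e f h.
Let rels := contra_rels KM.

Inductive generated_by_singular (g0 : 'rV[int]_n) (x0 : L) : 'rV[int]_n -> L -> Prop :=
| gbs_0 g : generated_by_singular g0 x0 g 0
| gbs_gen : generated_by_singular g0 x0 g0 x0
| gbs_ad i g x : generated_by_singular g0 x0 g x ->
    generated_by_singular g0 x0 (alpha i + g) [lie e i, x]
| gbs_D g x y : generated_by_singular g0 x0 g x -> generated_by_singular g0 x0 g y ->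
    generated_by_singular g0 x0 g (x + y)
| gbs_Z g a x : generated_by_singular g0 x0 g x -> generated_by_singular g0 x0 g (a *: x).

(* A singular vector of positive degree generates an ideal concentrated in
   positive degrees. *)
Lemma singular_vector_eq0 g0 x0 : npos e g0 x0 -> (forall j, [lie f j, x0] = 0) -> x0 = 0.
Proof.
have [hl ef hh he hf] := rels => gx0 fx0.
have [//|gp0] := npos_positive gx0.
pose U := generated_by_singular g0 x0.
have subU g : subspace (U g).
  by split; [apply: gbs_0 | apply: gbs_D | move=> a; apply: gbs_Z].
have Upos g x : U g x -> npos e g x.
  elim=> {g x} [g||i g x _ IH|g x y _ IHx _ IHy|g a x _ IH] //.
  - exact: npos_0.
  - exact: npos_ad.
  - exact: npos_D.
  - exact: npos_Z.
(* [f j] kills [x0] and commutes with the [e i] up to Cartan elements, which act by scalars. *)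
have Uf j g x : U g x -> U (g - alpha j) [lie f j, x].
  elim=> {g x} [g||i g x gx IH|g x y _ IHx _ IHy|g a x _ IH].
  - by rewrite lie0r; apply: gbs_0.
  - by rewrite fx0; apply: gbs_0.
  - rewrite lieAr (lieC (f j)) ef; apply: gbs_D; last by rewrite -addrA; apply: gbs_ad.
    case: eqP => [->|_]; last by rewrite oppr0 lie0l; apply: gbs_0.
    rewrite (addrC (alpha j)) addrK lieNl (npos_weight rels (Upos _ _ gx)) -scaleNr.
    exact: gbs_Z.
  - by rewrite lieDr; apply: gbs_D.
  - by rewrite lieZr; apply: gbs_Z.
have subG := graded_sum_subspace subU.
have HG := graded_sum_homogeneous subU.
have stab z x : graded_sum U x -> graded_sum U [lie z, x].
  move: z x; apply: (generated_stable (contra_gen KM)) => // z x zgen [s [c [us Hc ->]]].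
  rewrite lie_sumr; apply: subspace_sum => // g _.
  case: zgen => -[i ->].
  - by apply: (HG (alpha i + g)); apply/gbs_ad/Hc.
  - by apply: (HG (g - alpha i)); apply/Uf/Hc.
  - rewrite (npos_weight rels (Upos _ _ (Hc g))).
    by case: subG => _ _; apply; apply/HG/Hc.
have [G0 GD GZ] := subG.
pose I := LieIdeal G0 GD GZ stab.
apply: (contra_ideal KM (I := I)); last exact/(HG g0)/gbs_gen.
move=> x [s [c [us Hc xc]]].
apply: (offdiagonal_cartan rels root_indep); exists s, c; split=> // g.
have gc := Upos _ _ (Hc g).
split=> [|g0E]; first exact: (homogeneous_pos rels).
by case: (npos_positive gc) => // /positive_neq0.
Qed.

Hypothesis gcmA : is_gcm A.

Lemma h_sl2 i : [/\ [lie e i, f i] = h (cor i), [lie h (cor i), e i] = 2%:R *: e i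
  & [lie h (cor i), f i] = - 2%:R *: f i].
Proof.
have [_ ef _ he hf] := rels; have [A2 _ _] := gcmA.
by rewrite ef eqxx he hf root_cor A2.
Qed.

(** The left side has positive degree and is killed by every [f k], so [singular_vector_eq0]
    applies. *)
Lemma serre i j : i != j -> iter (absz (A i j)).+1 (lie (e i)) (e j) = 0.
Proof.
have [hl ef hh he hf] := rels; have [A2 A0 AC] := gcmA => ij.
have fe k l : [lie f k, e l] = if k == l then - h (cor k) else 0.
  by rewrite lieC ef eq_sym; case: eqP => [->|]; rewrite ?oppr0.
set N := absz _.
have AN : (A i j)%:~R = - N%:R :> K.
  have -> : A i j = - N%:Z by rewrite /N abszE ler0_norm ?A0 // opprK.
  by rewrite intrN.
have deg M : npos e (alpha i *+ M + alpha j) (iter M (lie (e i)) (e j)).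
  elim: M => [|M IHM]; first by rewrite add0r; apply: npos_gen.
  by rewrite mulrS -addrA iterS; apply: npos_ad.
apply: (singular_vector_eq0 (deg N.+1)) => k.
(* For [k = i], the vector [e j] has weight [N] for the swapped sl2-triple, and the factor [N - N]
   in [sl2_raise] vanishes. *)
have [<-|ki] := eqVneq i k.
  have [efi hei hfi] := h_sl2 i.
  have nefi : [lie f i, e i] = - h (cor i) by rewrite lieC efi.
  have nhei : [lie - h (cor i), e i] = - 2%:R *: e i by rewrite lieNl hei scaleNr.
  rewrite (sl2_raise nefi nhei _ (M := N%:R)).
  - by rewrite subrr mulr0 scale0r.
  - by rewrite fe (negPf ij).
  - by rewrite lieNl he root_cor AN scaleNr opprK.
have step M : iter M (lie (e i)) [lie f k, e j] = [lie f k, iter M (lie (e i)) (e j)].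
  elim: M => [//|M IHM]; rewrite !iterS [RHS]lieAr [X in [lie X, _] + _]fe [k == i]eq_sym (negPf ki) lie0l add0r.
  by rewrite IHM.
rewrite -step fe; case: eqP => [kj|_]; last first.
  by case: (iter_lie_subspace (e i) N.+1).
rewrite iterSr lieNr lieC opprK he root_cor kj.
(* For [k = j], one [e i] takes the Cartan element to [A j i] times [e i]; either this is zero, or
   [N > 0] and another [e i] kills it. *)
have [Aji|Aji] := eqVneq (A j i) 0.
  by rewrite Aji scale0r; case: (iter_lie_subspace (e i) N).
have : (0 < N)%N by rewrite absz_gt0; apply: contraNneq Aji => /AC ->.
case: (N) => // M _; rewrite iterSr lieZr liexx scaler0.
by case: (iter_lie_subspace (e i) M).
Qed.

Lemma ad_nilpotent_e i x : ad_nilpotent (e i) x.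
Proof.
have [hl ef hh he hf] := rels.
apply: (contra_gen KM) (ad_nilpotent_subalgebra (e i)) _ x => x [[j ->]|[j ->]|[c ->]].
- have [<-|ij] := eqVneq i j; last by eexists; apply: serre ij.
  by exists 1%N; rewrite /= liexx.
- have [<-|ij] := eqVneq i j; last by exists 1%N; rewrite /= ef (negPf ij).
  exists 3%N; rewrite /= ef eqxx (lieC _ (h _)) he lieNr lieZr liexx.
  by rewrite scaler0 oppr0.
- exists 2%N; rewrite /= (lieC _ (h _)) he lieNr lieZr liexx.
  by rewrite scaler0 oppr0.
Qed.

End Serre.
Section Weights.
Variables (L : lieAlgType K) (e f : 'I_n -> L) (h : C -> L).
Hypothesis KM : contragredient e f h.
Hypothesis gcmA : is_gcm A.
Let rels := contra_rels KM.

Definition is_weight (b : C -> K) : Prop :=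
  exists x, x != 0 /\ forall y, [lie h y, x] = b y *: x.

Lemma iter_weight z (c b : C -> K) x N : (forall y, [lie h y, z] = c y *: z) ->
  (forall y, [lie h y, x] = b y *: x) ->
  forall y, [lie h y, iter N (lie z) x] = (b y + N%:R * c y) *: iter N (lie z) x.
Proof.
move=> hz hx y; elim: N => [|N IHN]; first by rewrite mul0r addr0.
rewrite iterS lieAr hz IHN lieZl lieZr -scalerDl -natr1; congr (_ *: _).
by ring.
Qed.

Lemma is_weight_reflect i b : is_weight b ->
  is_weight (fun y => b y - b (cor i) * root i y).
Proof.
have [_ _ _ he hf] := rels => -[x [x0 bx]].
have [ef hce hcf] := h_sl2 KM gcmA i.
have enil := ad_nilpotent_e KM gcmA i.
have fnil := ad_nilpotent_e (contragredient_swap KM) gcmA i.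
have [N [k [Mk fk]]] := sl2_string ef hce hcf enil fnil x0 (bx (cor i)).
(* Lowering the top vector [k - N] times ends at the reflected weight, since
   [k - N = b (cor i) + N]. *)
have [Nk|kN] := leqP N k.
  exists (iter (k - N) (lie (f i)) (iter N (lie (e i)) x)).
  split=> [|y]; first by rewrite fk ?leq_subr.
  rewrite (iter_weight (c := fun y => - root i y) (b := fun y => b y + N%:R * root i y)) //.
    congr (_ *: _); rewrite natrB // -Mk; ring.
  by move=> z; rewrite (iter_weight (c := root i) (b := b)).
(* Here [b (cor i) + N] is negative, and the string is climbed with [f i] and descended with [e i]
   instead. *)
have fe : [lie f i, e i] = - h (cor i) by rewrite lieC ef.
have nhf : [lie - h (cor i), f i] = 2%:R *: f i by rewrite lieNl hcf scaleNr opprK.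
have nhe : [lie - h (cor i), e i] = - 2%:R *: e i by rewrite lieNl hce scaleNr.
have nhx : [lie - h (cor i), x] = - b (cor i) *: x by rewrite lieNl bx scaleNr.
have [N' [k' [Mk' ek]]] := sl2_string fe nhf nhe fnil enil x0 nhx.
have N'k' : (N' <= k')%N.
  (* Adding the two string equations gives [k + k' = 2 N + 2 N'], so [k < N] forces [N' <= k']. *)
  have : (k + k')%N%:R = (2 * N + 2 * N')%N%:R :> K.
    by rewrite natrD [RHS]natrD !natrM -Mk -Mk'; ring.
  by move/eqP; rewrite eqr_nat => /eqP; lia.
exists (iter (k' - N') (lie (e i)) (iter N' (lie (f i)) x)).
split=> [|y]; first by rewrite ek ?leq_subr.
rewrite (iter_weight (c := root i) (b := fun y => b y + N'%:R * - root i y)) //.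
  congr (_ *: _); rewrite natrB // -Mk'; ring.
by move=> z; rewrite (iter_weight (c := fun y => - root i y) (b := b)).
Qed.

Lemma weight_homogeneous b : is_weight b ->
  exists g x, [/\ x != 0, homogeneous e f h g x & forall y, b y = weight root g y].
Proof.
move=> [x [x0 bx]].
have [s [c [us Hc xc]]] := graded_decomposition rels (contra_gen KM) x.
have [g [gs cg]] : exists g, g \in s /\ c g != 0.
  apply: contrapT => noc; case/negP: x0; rewrite xc big_seq big1 // => g gs.
  by apply/eqP/negPn/negP => cg; apply: noc; exists g.
exists g, (c g); split=> // y; apply/eqP; rewrite eq_sym -subr_eq0.
have subS : subspace (fun z : L => z = 0).
  by split=> [//|z z' -> ->|a z ->]; rewrite ?addr0 ?scaler0.
(* These multiples of the components sum to [[h y, x] - b y *: x = 0], so each of them vanishes. *)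
have := homogeneous_components rels root_indep subS _ us
  (c := fun g => (weight root g y - b y) *: c g).
move=> /(_ _ _ _ g gs)/eqP; rewrite scaler_eq0 (negPf cg) orbF; apply.
- by move=> z z' ->; rewrite lie0r.
- by move=> g'; have [_ _ HZ] := homogeneous_subspace rels g'; apply: HZ.
- rewrite -[RHS](subrr (b y *: x)) -{1}bx xc lie_sumr scaler_sumr -sumrB.
  by apply: eq_bigr => g' _; rewrite (homogeneous_weight rels (Hc g')) scalerBl.
Qed.

Lemma weight_inj g g' : (forall y, weight root g y = weight root g' y) -> g = g'.
Proof.
move=> gg'; apply/eqP; rewrite -subr_eq0; apply/eqP/root_indep => y.
by rewrite weightD weightN gg' subrr.
Qed.

Lemma lattice_weight_sign g : is_weight (weight root g) ->
  [\/ positive g, positive (- g) | g = 0].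
Proof.
move=> /weight_homogeneous[g' [x [x0 gx /weight_inj ->]]].
case: (homogeneous_cases rels gx) => [[gp _]|[gp _]|[-> _]|xz].
- by constructor 1.
- by constructor 2.
- by constructor 3.
- by rewrite xz eqxx in x0.
Qed.

Lemma npos_multiple i g x : npos e g x -> (forall j, j != i -> g 0 j = 0) ->
  x = 0 \/ g = alpha i.
Proof.
(* The stronger claim identifies [x] as a multiple of [e i], so that a further bracket with [e i]
   vanishes. *)
suff main : npos e g x -> (forall j, j != i -> g 0 j = 0) ->
    exists a, x = a *: e i /\ (a = 0 \/ g = alpha i).
  by move=> gx gi; have [a [-> [->|]]] := main gx gi; rewrite ?scale0r; auto.
elim=> {g x} [g|j|j g x gx IH|g x y _ IHx _ IHy|g a x _ IH] gi.
- by exists 0; rewrite scale0r; auto.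
- have [->|ji] := eqVneq j i; first by exists 1; rewrite scale1r; auto.
  by have := gi _ ji; rewrite mxE !eqxx.
- exists 0; rewrite scale0r; split; last by left.
  have [ji|ji] := eqVneq j i.
    rewrite ji; have [|a [-> _]] := IH; last by rewrite lieZr liexx scaler0.
    by move=> k ki; have := gi k ki; rewrite mxE mxE ji (negPf ki) add0r.
  have [->|[gp _]] := npos_positive gx; first by rewrite lie0r.
  have := gi _ ji; rewrite mxE mxE !eqxx => /eqP; rewrite gt_eqF //.
  by apply: ltr_pwDl; rewrite ?gp.
- have [a [-> ag]] := IHx gi; have [b [-> bg]] := IHy gi.
  exists (a + b); rewrite scalerDl; split=> //.
  by case: ag bg => [->|->] [->|]; rewrite ?addr0; auto.
- have [b [-> bg]] := IH gi; exists (a * b); rewrite scalerA; split=> //.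
  by case: bg => [->|->]; rewrite ?mulr0; auto.
Qed.

Definition lattice_pairing (g : 'rV[int]_n) (i : 'I_n) : int := \sum_j g 0 j * A i j.

Lemma weight_cor g i : weight root g (cor i) = (lattice_pairing g i)%:~R.
Proof.
rewrite /weight /lattice_pairing rmorph_sum; apply: eq_bigr => j _.
by rewrite root_cor /= intrM.
Qed.

Lemma lattice_reflect g i : is_weight (weight root g) ->
  is_weight (weight root (g - lattice_pairing g i *: alpha i)).
Proof.
move=> /(is_weight_reflect i)[x [x0 bx]]; exists x; split=> // y.
rewrite bx weight_cor weightD weightN; congr ((_ - _) *: _).
rewrite /weight (bigD1 i) //= big1 ?addr0 => [|j ji].
  by rewrite !mxE !eqxx mulr1.
by rewrite !mxE (negPf ji) andbF mulr0 mul0r.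
Qed.

(** The coordinates of a weight have a common sign, and those other than [i] are constant along the
    string. For [N] large, a negative one contradicts the coordinate [i], a positive one contradicts
    it after reflection, and if all vanish, [alpha i] is the only positive multiple of itself that
    can be a weight. *)
Lemma simple_string_finite i (g : 'rV[int]_n) :
  exists N, ~ is_weight (weight root (g + alpha i *+ N)).
Proof.
apply: contrapT => /forallNP allw.
have {}allw N : is_weight (weight root (g + alpha i *+ N)) := contrapT (allw N).
have coord N j : (g + alpha i *+ N) 0 j = g 0 j + (j == i)%:R *+ N.
  rewrite mxE; congr (_ + _).
  by elim: N => [|N IHN]; rewrite ?mulr0n ?mxE // !mulrS mxE IHN mxE eqxx.
have [] := pselect (exists j, j != i /\ g 0 j != 0); last first.
  move=> /forallNP gj.
  have gi N j : j != i -> (g + alpha i *+ N) 0 j = 0.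
    move=> ji; rewrite coord (negPf ji) mul0rn addr0; apply/eqP/negPn/negP => gj0.
    exact: (gj j).
  pose N := (absz (g 0%R i)).+2.
  have [g' [x [x0 gx /weight_inj gE]]] := weight_homogeneous (allw N).
  have gN : 2 <= (g + alpha i *+ N) 0 i.
    by rewrite coord eqxx /N natz; lia.
  have hN := homogeneous_cases rels gx; rewrite -gE in hN.
  case: hN => [[_ gNx]|[[+ _] _]|[gN0 _]|xz].
  - case: (npos_multiple gNx (gi N)) => [xz|gN1]; first by rewrite xz eqxx in x0.
    by rewrite gN1 mxE !eqxx in gN.
  - by move=> /(_ i); rewrite mxE oppr_ge0 => /(le_trans gN).
  - by rewrite gN0 mxE in gN.
  - by rewrite xz eqxx in x0.
move=> [j [ji gj]].
have pairN N : lattice_pairing (g + alpha i *+ N) i = lattice_pairing g i + N%:Z * 2.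
  have [A2 _ _] := gcmA.
  rewrite /lattice_pairing (eq_bigr (fun k => g 0 k * A i k + (k == i)%:R *+ N * A i k)).
    rewrite big_split /=; congr (_ + _).
    rewrite (bigD1 i) //= big1 ?addr0 => [|k ki]; last by rewrite (negPf ki) mul0rn mul0r.
    by rewrite eqxx A2 natz; lia.
  by move=> k _; rewrite coord mulrDl.
have [gj0|gj0|gj0] := ltrgtP (g 0 j) 0; last by rewrite gj0 eqxx in gj.
  pose N := (absz (g 0 i)).+1.
  have := lattice_weight_sign (allw N).
  case=> [[/(_ j)]|[/(_ i)]|/rowP/(_ j)].
  - by rewrite coord (negPf ji) mul0rn addr0 leNgt gj0.
  - by rewrite mxE coord eqxx natz /N; lia.
  - by rewrite coord (negPf ji) mul0rn addr0 mxE => gj1; rewrite gj1 ltxx in gj0.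
(* After the reflection the coordinate [i] is [z - N], which is negative. *)
pose z : int := g 0 i - lattice_pairing g i; pose N := (absz z).+1.
have reflE k : (g + alpha i *+ N
      - lattice_pairing (g + alpha i *+ N) i *: alpha i) 0 k
    = g 0 k + (k == i)%:R *+ N - (lattice_pairing g i + N%:Z * 2) * (k == i)%:R.
  by rewrite pairN -coord mxE; congr (_ + _); rewrite mxE mxE mxE eqxx.
have := lattice_weight_sign (lattice_reflect i (allw N)).
case=> [[/(_ i)]|[/(_ j)]|/rowP/(_ j)].
- by rewrite reflE eqxx natz /N /z; lia.
- by rewrite mxE reflE (negPf ji) mul0rn mulr0 subr0 addr0 oppr_ge0 leNgt gj0.
- by rewrite reflE (negPf ji) mul0rn mulr0 subr0 addr0 mxE => gj1; rewrite gj1 ltxx in gj0.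
Qed.

End Weights.
End Contragredient.

(** * Graded tensor squares *)

Section Abelian.
Variables (K : fieldType) (W : lmodType K).

Definition abelian_on : Type := W.
HB.instance Definition _ := GRing.Lmodule.on abelian_on.

Let zero_lie (x y : abelian_on) : abelian_on := 0.
Fact zero_lieD (x y : abelian_on) : zero_lie x y = zero_lie x y + zero_lie x y.
Proof. by rewrite addr0. Qed.
Fact zero_lieZ (a : K) (x y : abelian_on) : zero_lie x y = a *: zero_lie x y.
Proof. by rewrite scaler0. Qed.
Fact zero_jacobi (x y z : abelian_on) :
  zero_lie x (zero_lie y z) + zero_lie y (zero_lie z x) + zero_lie z (zero_lie x y) = 0.
Proof. by rewrite !addr0. Qed.

HB.instance Definition _ := Lmodule_isLie.Build K abelian_on
  (fun x y z => zero_lieD x z) (fun x y z => zero_lieD x y)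
  zero_lieZ zero_lieZ (fun=> erefl) zero_jacobi.

End Abelian.

(* The graded tensor square [V (x) V [t, t^-1]], whose exponents record the
   degree of the left factor; it is presented as an abelian Lie algebra so as
   to share the universal property of [lie_pres]. *)
Section Tensor.
Variables (K : fieldType) (m : nat) (V : lieAlgType K).
Local Notation Q := 'rV[int]_m.
Local Notation sym b x y := (LGen (b, x, y) : lie_term K (Q * V * V)).

Inductive tensor_rel : lie_term K (Q * V * V) -> lie_term K (Q * V * V) -> Prop :=
| tensor_Dl b x y z : tensor_rel (sym b (x + y) z) (LAdd (sym b x z) (sym b y z))
| tensor_Dr b x y z : tensor_rel (sym b x (y + z)) (LAdd (sym b x y) (sym b x z))
| tensor_Zl b a x y : tensor_rel (sym b (a *: x) y) (LScale a (sym b x y))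
| tensor_Zr b a x y : tensor_rel (sym b x (a *: y)) (LScale a (sym b x y))
| tensor_lie t u : tensor_rel (LLie t u) LZero.

Definition tensor : lieAlgType K := lie_pres tensor_rel.
Definition tens (b : Q) (x y : V) : tensor := pres_pi tensor_rel (sym b x y).

Lemma tensDl b x y z : tens b (x + y) z = tens b x z + tens b y z.
Proof. by rewrite -[RHS]pres_piD; apply/pres_piP/lc_rel/tensor_Dl. Qed.

Lemma tensDr b x y z : tens b x (y + z) = tens b x y + tens b x z.
Proof. by rewrite -[RHS]pres_piD; apply/pres_piP/lc_rel/tensor_Dr. Qed.

Lemma tensZl b a x y : tens b (a *: x) y = a *: tens b x y.
Proof. by rewrite -[RHS]pres_piZ; apply/pres_piP/lc_rel/tensor_Zl. Qed.

Lemma tensZr b a x y : tens b x (a *: y) = a *: tens b x y.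
Proof. by rewrite -[RHS]pres_piZ; apply/pres_piP/lc_rel/tensor_Zr. Qed.

Lemma tensNl b x y : tens b (- x) y = - tens b x y.
Proof. by rewrite -scaleN1r tensZl scaleN1r. Qed.

Lemma tensNr b x y : tens b x (- y) = - tens b x y.
Proof. by rewrite -scaleN1r tensZr scaleN1r. Qed.

Lemma tens0l b y : tens b 0 y = 0.
Proof. by rewrite -[X in tens b X](scale0r 0) tensZl scale0r. Qed.

Lemma tens0r b x : tens b x 0 = 0.
Proof. by rewrite -[X in tens b _ X](scale0r 0) tensZr scale0r. Qed.

Lemma tensor_span (S : tensor -> Prop) : subspace S ->
  (forall b x y, S (tens b x y)) -> forall t, S t.
Proof.
move=> subS Ssym; apply: pres_generated => [|_ [[[b x] y] ->]]; last exact: Ssym.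
split=> // t u _ _; suff -> : [lie t, u] = 0 by case: subS.
rewrite -[t]pres_pi_repr -[u]pres_pi_repr -pres_pi_lie -pres_pi0.
exact/pres_piP/lc_rel/tensor_lie.
Qed.

Section Lift.
Variables (W : lmodType K) (F : Q -> V -> V -> W).
Hypotheses (Fl : forall b y, linear (F b ^~ y)) (Fr : forall b x, linear (F b x)).

Let gen (p : Q * V * V) : abelian_on W := F p.1.1 p.1.2 p.2.

Let gen_rel t u : tensor_rel t u -> lie_eval gen t = lie_eval gen u.
Proof.
have F0l b y : F b 0 y = 0.
  by have := Fl b y (-1) 0 0; rewrite scaler0 addr0 scaleN1r addNr.
have F0r b x : F b x 0 = 0.
  by have := Fr b x (-1) 0 0; rewrite scaler0 addr0 scaleN1r addNr.
case=> {t u} [b x y z|b x y z|b a x y|b a x y|//] /=; rewrite /gen /=.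
- by have := Fl b z 1 x y; rewrite !scale1r.
- by have := Fr b x 1 y z; rewrite !scale1r.
- by have := Fl b y a x 0; rewrite !addr0 F0l addr0.
- by have := Fr b x a y 0; rewrite !addr0 F0r addr0.
Qed.

Definition tensor_lift (t : tensor) : W := @pres_lift K _ tensor_rel (abelian_on W) gen t.

Lemma tensor_lift_linear : linear tensor_lift.
Proof. by case: (pres_lift_hom gen_rel). Qed.

Lemma tensor_liftE b x y : tensor_lift (tens b x y) = F b x y.
Proof. exact: (pres_liftE gen_rel). Qed.

End Lift.

Lemma linear_tensor_ext (W : lmodType K) (f g : tensor -> W) : linear f -> linear g ->
  (forall b x y, f (tens b x y) = g (tens b x y)) -> f =1 g.
Proof.
move=> lf lg fg; apply: tensor_span => //.
have f0 : f 0 = 0 by have := lf (-1) 0 0; rewrite scaler0 addr0 scaleN1r addNr.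
have g0 : g 0 = 0 by have := lg (-1) 0 0; rewrite scaler0 addr0 scaleN1r addNr.
split=> [|t u ft fu|a t ft]; first by rewrite f0 g0.
- by have := lf 1 t u; have := lg 1 t u; rewrite !scale1r => -> ->; rewrite ft fu.
- by have := lf a t 0; have := lg a t 0; rewrite !addr0 f0 g0 !addr0 => -> ->; rewrite ft.
Qed.

Section BracketMap.
Let F (_ : Q) (x y : V) : V := [lie x, y].

Let bracket_linearl b y : linear (F b ^~ y).
Proof. by move=> a x z; rewrite /F lieDl lieZl. Qed.

Let bracket_linearr b x : linear (F b x).
Proof. by move=> a y z; rewrite /F lieDr lieZr. Qed.

Definition bracket_map : tensor -> V := tensor_lift F.

Lemma bracket_map_linear : linear bracket_map.
Proof. exact: (tensor_lift_linear bracket_linearl bracket_linearr). Qed.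

HB.instance Definition _ :=
  GRing.isLinear.Build K tensor V *:%R bracket_map bracket_map_linear.

Lemma bracket_mapE b x y : bracket_map (tens b x y) = [lie x, y].
Proof. exact: (tensor_liftE bracket_linearl bracket_linearr). Qed.

End BracketMap.

Section Component.
Variables (b0 : Q) (xi : {scalar V}).
Let F (b : Q) (x y : V) : V := if b == b0 then xi y *: x else 0.

Let component_linearl b y : linear (F b ^~ y).
Proof. by move=> a x z; rewrite /F; case: ifP => _; lmod_ring. Qed.

Let component_linearr b x : linear (F b x).
Proof. by move=> a y z; rewrite /F; case: ifP => _; rewrite ?linearP; lmod_ring. Qed.

(** Contractions turn an identity of tensors into identities in [V], where the induction on the
    height applies; by [component_eq0] they lose nothing. *)
Definition component : tensor -> V := tensor_lift F.

Lemma component_linear : linear component.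
Proof. exact: (tensor_lift_linear component_linearl component_linearr). Qed.

HB.instance Definition _ :=
  GRing.isLinear.Build K tensor V *:%R component component_linear.

Lemma componentE b x y : component (tens b x y) = if b == b0 then xi y *: x else 0.
Proof. exact: (tensor_liftE component_linearl component_linearr). Qed.

End Component.

Lemma tensor_seq (t : tensor) :
  exists s : seq (Q * V * V), t = \sum_(p <- s) tens p.1.1 p.1.2 p.2.
Proof.
move: t; apply: tensor_span; first split=> [|t u [s ->] [r ->]|a t [s ->]].
- by exists [::]; rewrite big_nil.
- by exists (s ++ r); rewrite big_cat.
- exists [seq (p.1.1, a *: p.1.2, p.2) | p <- s].
  by rewrite big_map scaler_sumr; apply: eq_bigr => p _; rewrite tensZl.
- by move=> b x y; exists [:: (b, x, y)]; rewrite big_seq1.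
Qed.

(** The span of the right factors of exponent [b], by recursion on the list to match the rewriting
    in [right_span_absorb]. *)
Fixpoint right_span (b : Q) (s : seq (Q * V * V)) (w : V) : Prop :=
  if s is p :: s' then
    exists c : K, right_span b s' (w - c *: p.2) /\ (p.1.1 = b \/ c = 0)
  else w = 0.

Lemma right_span_subspace b s : subspace (right_span b s).
Proof.
elim: s => [|p s [S0 SD SZ]] /=.
  by split=> [//|x y -> ->|a x ->]; rewrite ?addr0 ?scaler0.
split=> [|x y [c [xs pc]] [d [ys pd]]|a x [c [xs pc]]].
- by exists 0; rewrite scale0r subr0; auto.
- exists (c + d); rewrite scalerDl opprD addrACA; split; first exact: SD.
  by case: pc pd => [->|->] [|->]; rewrite ?addr0; auto.
- exists (a * c); rewrite -scalerA -scalerBr; split; first exact: SZ.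
  by case: pc => [->|->]; rewrite ?mulr0; auto.
Qed.

(** A term whose right factor depends on the others is distributed over them by changing their left
    factors, without lengthening the list. *)
Lemma right_span_absorb b s x y : right_span b s y ->
  exists s', size s' = size s /\
    tens b x y + \sum_(p <- s) tens p.1.1 p.1.2 p.2 = \sum_(p <- s') tens p.1.1 p.1.2 p.2.
Proof.
elim: s y => [|[[b' x'] y'] s IHs] y /=.
  by move=> ->; exists [::]; rewrite !big_nil tens0r addr0.
move=> [c [/IHs[s' [ss' sum']] bc]].
exists ((b', x' + c *: x, y') :: s'); rewrite /= ss' !big_cons -sum' /=; split=> //.
rewrite tensDl tensZl tensDr tensNr tensZr.
by case: bc => [->|->]; lmod_ring.
Qed.

Lemma component_right_span b (xi : {scalar V}) s : (forall w, right_span b s w -> xi w = 0) ->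
  component b xi (\sum_(p <- s) tens p.1.1 p.1.2 p.2) = 0.
Proof.
elim: s => [|[[b' x'] y'] s IHs] xis; first by rewrite big_nil linear0.
rewrite big_cons linearD /= IHs ?addr0 => [|w ws].
  rewrite componentE; case: eqP => // b'b; rewrite xis ?scale0r //=.
  exists 1; rewrite scale1r subrr; split; last by left.
  by case: (right_span_subspace b s).
by apply: xis => /=; exists 0; rewrite scale0r subr0; auto.
Qed.

(** Induction on the number of terms: the first is absorbed by the rest if its right factor depends
    on theirs; otherwise a functional separating that factor shows that the left factor is zero. *)
Lemma component_eq0 (t : tensor) : (forall b xi, component b xi t = 0) -> t = 0.
Proof.
have [s ->] := tensor_seq t; move: {2}(size s) (erefl (size s)) => N.
elim: N s => [|N IHN] [|[[b x] y] s] //=; try by rewrite big_nil.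
move=> [sN]; rewrite big_cons /= => cs.
have [ys|ys] := pselect (right_span b s y).
  have [s' [ss' sum']] := right_span_absorb x ys.
  by move: cs; rewrite sum'; apply: IHN; rewrite ss'.
have [xi [xis xiy]] := separating_functional (right_span_subspace b s) ys.
have := cs b xi; rewrite linearD /= (component_right_span xis) addr0.
rewrite componentE eqxx xiy scale1r => x0.
rewrite x0 tens0l add0r; apply: IHN => // b' xi'.
by have := cs b' xi'; rewrite x0 tens0l add0r.
Qed.

Section Operator.
Variables (al : Q) (u : V).
Let F (b : Q) (x y : V) : tensor := tens (b + al) [lie u, x] y + tens b x [lie u, y].

Let operator_linearl b y : linear (F b ^~ y).
Proof.
by move=> a x z; rewrite /F lieDr lieZr !(tensDl, tensDr, tensZl, tensZr); lmod_ring.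
Qed.

Let operator_linearr b x : linear (F b x).
Proof.
by move=> a y z; rewrite /F lieDr lieZr !(tensDl, tensDr, tensZl, tensZr); lmod_ring.
Qed.

Definition operator : endo tensor :=
  mk_endo (tensor_lift_linear operator_linearl operator_linearr).

Lemma operatorE b x y :
  operator (tens b x y) = tens (b + al) [lie u, x] y + tens b x [lie u, y].
Proof. exact: (tensor_liftE operator_linearl operator_linearr). Qed.

Lemma bracket_map_operator t : bracket_map (operator t) = [lie u, bracket_map t].
Proof.
move: t; apply: linear_tensor_ext => [a t t'|a t t'|b x y].
- by rewrite !linearP.
- by rewrite linearP lieDr lieZr.
- by rewrite operatorE linearD /= !bracket_mapE [RHS]lieAr.
Qed.

Fact functional_ad_linear (xi : {scalar V}) : scalar (fun x => xi [lie u, x]).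
Proof. by move=> a x y; rewrite lieDr lieZr linearP. Qed.

Definition functional_ad (xi : {scalar V}) : {scalar V} :=
  HB.pack (fun x => xi [lie u, x])
    (GRing.isLinear.Build K V K *%R (fun x => xi [lie u, x]) (functional_ad_linear xi)).

(** For a tensor killed by the operator, this expresses the bracket of [u] with one component
    through a component whose degree is shifted by [al]. *)
Lemma component_operator b xi t : component b xi (operator t)
  = [lie u, component (b - al) xi t] + component b (functional_ad xi) t.
Proof.
move: t; apply: linear_tensor_ext => [a t t'|a t t'|b' x y].
- by rewrite !linearP.
- by rewrite !linearP /= lieDr lieZr; lmod_ring.
- rewrite operatorE linearD /= !componentE.
  have -> : (b' == b - al) = (b' + al == b) by rewrite eq_sym subr_eq eq_sym.
  by congr (_ + _); case: ifP => _; rewrite ?lie0r // lieZr.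
Qed.

End Operator.

Lemma operatorDZ al a u v : operator al (a *: u + v) = a *: operator al u + operator al v.
Proof.
apply: endo_ext; apply: linear_tensor_ext => [c t t'|c t t'|b x y].
- exact: linearP.
- exact: linearP.
- rewrite endoDE endoZE !operatorE !(lieDl, lieZl) !(tensDl, tensDr, tensZl, tensZr).
  lmod_ring.
Qed.

Lemma operator0 al : operator al 0 = 0.
Proof.
have := operatorDZ al (-1) 0 0.
by rewrite scaler0 addr0 scaleN1r addNr.
Qed.

Lemma operatorZ al a u : operator al (a *: u) = a *: operator al u.
Proof. by have := operatorDZ al a u 0; rewrite addr0 operator0 addr0. Qed.

Lemma lie_operator al u be v :
  [lie operator al u, operator be v] = operator (al + be) [lie u, v].
Proof.
apply: endo_ext; apply: linear_tensor_ext => [c t t'|c t t'|b x y].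
- exact: linearP.
- exact: linearP.
- rewrite lie_endoE !operatorE !endo_additive !operatorE !lieA.
  rewrite -!addrA (addrC be al) tensDl tensDr tensNl tensNr.
  lmod_ring.
Qed.

End Tensor.

(** * The cobracket *)

Section ChevalleyPresentation.
Variables (K : fieldType) (m : nat) (C : lmodType K).
Variables (root : 'I_m -> C -> K) (cor : 'I_m -> C).

Inductive chev_gen : Type := ChevE of 'I_m | ChevF of 'I_m | ChevH of C.

Local Notation term := (lie_term K chev_gen).
Local Notation E i := (LGen (ChevE i) : term).
Local Notation F i := (LGen (ChevF i) : term).
Local Notation H x := (LGen (ChevH x) : term).

Inductive chev_rel : term -> term -> Prop :=
| chev_lin a x y : chev_rel (H (a *: x + y)) (LAdd (LScale a (H x)) (H y))
| chev_EF i : chev_rel (LLie (E i) (F i)) (H (cor i))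
| chev_EF0 i j : i != j -> chev_rel (LLie (E i) (F j)) LZero
| chev_HH x y : chev_rel (LLie (H x) (H y)) LZero
| chev_HE x i : chev_rel (LLie (H x) (E i)) (LScale (root i x) (E i))
| chev_HF x i : chev_rel (LLie (H x) (F i)) (LScale (- root i x) (F i)).

Definition chev_alg : lieAlgType K := lie_pres chev_rel.
Definition chev_e i : chev_alg := pres_pi chev_rel (E i).
Definition chev_f i : chev_alg := pres_pi chev_rel (F i).
Definition chev_h x : chev_alg := pres_pi chev_rel (H x).

Lemma chev_alg_rels : chevalley_rels root cor chev_e chev_f chev_h.
Proof.
split=> [a x y|i j|x y|x i|x i]; rewrite /chev_h /chev_e /chev_f.
- by rewrite -pres_piZ -pres_piD; apply/pres_piP/lc_rel/chev_lin.
- rewrite -pres_pi_lie; case: eqP => [<-|/eqP ij]; first exact/pres_piP/lc_rel/chev_EF.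
  by rewrite -pres_pi0; apply/pres_piP/lc_rel/chev_EF0.
- by rewrite -pres_pi_lie -pres_pi0; apply/pres_piP/lc_rel/chev_HH.
- by rewrite -pres_pi_lie -pres_piZ; apply/pres_piP/lc_rel/chev_HE.
- by rewrite -pres_pi_lie -pres_piZ; apply/pres_piP/lc_rel/chev_HF.
Qed.

Lemma chev_alg_generated : lie_generated (chevalley_gen chev_e chev_f chev_h).
Proof.
move=> S subS Sgen; apply: (pres_generated subS) => _ [[i|i|x] ->]; apply: Sgen.
- by constructor 1; exists i.
- by constructor 2; exists i.
- by constructor 3; exists x.
Qed.

Section Lift.
Variables (L : lieAlgType K) (e f : 'I_m -> L) (h : C -> L).
Hypothesis rels : chevalley_rels root cor e f h.

Let gen (x : chev_gen) : L :=
  match x with ChevE i => e i | ChevF i => f i | ChevH c => h c end.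

Let gen_rel t u : chev_rel t u -> lie_eval gen t = lie_eval gen u.
Proof.
have [hl ef hh he hf] := rels.
case=> {t u} [a x y|i|i j /negPf ij|x y|x i|x i] /=.
- exact: hl.
- by rewrite ef eqxx.
- by rewrite ef ij.
- exact: hh.
- exact: he.
- exact: hf.
Qed.

Definition chev_lift : chev_alg -> L := @pres_lift _ _ chev_rel L gen.

Lemma chev_lift_hom : lie_hom chev_lift.
Proof. exact: (pres_lift_hom gen_rel). Qed.

Lemma chev_lift_e i : chev_lift (chev_e i) = e i.
Proof. exact: (pres_liftE gen_rel). Qed.

Lemma chev_lift_f i : chev_lift (chev_f i) = f i.
Proof. exact: (pres_liftE gen_rel). Qed.

Lemma chev_lift_h x : chev_lift (chev_h x) = h x.
Proof. exact: (pres_liftE gen_rel). Qed.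

End Lift.
End ChevalleyPresentation.

Section CartanMatrixData.
Variables (K : fieldType) (m : nat) (B : 'M[int]_m).

(** The Cartan part of [g0] has the coroots as a basis, so the roots are dependent when [B] is
    singular. *)
Definition mx_root (j : 'I_m) (c : 'rV[K]_m) : K := \sum_i c 0 i * (B i j)%:~R.
Definition mx_coroot (i : 'I_m) : 'rV[K]_m := delta_mx 0 i.

Lemma mx_root_coroot i j : mx_root j (mx_coroot i) = (B i j)%:~R.
Proof.
rewrite /mx_root (bigD1 i) //= mxE !eqxx mul1r big1 ?addr0 // => k ki.
by rewrite mxE (negPf ki) andbF mul0r.
Qed.

End CartanMatrixData.

Section Cobracket.
Variables (K : numFieldType) (m : nat) (B : 'M[int]_m) (a : 'I_m -> K).
Hypothesis a_sym : forall i j, a i * (B i j)%:~R = a j * (B j i)%:~R.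
Hypothesis B2 : forall i, B i i = 2.
Hypothesis a_gt0 : forall i, 0 < a i.
Local Notation root := (mx_root (K := K) B).
Local Notation cor := (@mx_coroot K m).
Variables (V : lieAlgType K) (e f : 'I_m -> V) (h : 'rV[K]_m -> V).
Hypothesis rels : chevalley_rels root cor e f h.
Hypothesis e_nil : forall i x, ad_nilpotent (e i) x.

Local Notation g0 := (chev_alg root cor).
Local Notation ce := (chev_e root cor).
Local Notation cf := (chev_f root cor).
Local Notation ch := (chev_h root cor).
Local Notation rho := (chev_lift (root := root) (cor := cor) e f h).
Local Notation T := (tensor m V).
Local Notation O := (0 : 'rV[int]_m).
Let rho_hom := chev_lift_hom rels.
Let rho_e := chev_lift_e rels.
Let rho_f := chev_lift_f rels.
(* The values on generators of the standard Lie bialgebra structure. *)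
Definition twist_e (i : 'I_m) : T :=
  a i *: (tens 0 (h (cor i)) (e i) - tens (alpha i) (e i) (h (cor i))).
Definition twist_f (i : 'I_m) : T :=
  a i *: (tens 0 (h (cor i)) (f i) - tens (- alpha i) (f i) (h (cor i))).

(** The adjoint action paired with the prescribed value of the cobracket; a homomorphism that
    extends such pairs is a cocycle. *)
Definition cob_e (i : 'I_m) : affine T := (operator (alpha i) (e i), twist_e i).
Definition cob_f (i : 'I_m) : affine T := (operator (- alpha i) (f i), twist_f i).
Definition cob_h (c : 'rV[K]_m) : affine T := (operator 0 (h c), 0).

Let tensE := (tensDl, tensDr, tensNl, tensNr, tensZl, tensZr, tens0l, tens0r).

Lemma cob_rels : chevalley_rels root cor cob_e cob_f cob_h.
Proof.
have [hl ef hh he hf] := rels.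
split=> [c x y|i j|x y|x i|x i].
- congr pair; first by rewrite hl operatorDZ.
  by rewrite /= scaler0 addr0.
(* The mixed terms in [e i] and [f j] cancel by the symmetry [a i * B i j = a j * B j i]. *)
- transitivity (operator (alpha i - alpha j) [lie e i, f j],
      operator (alpha i) (e i) (twist_f j) - operator (- alpha j) (f j) (twist_e i)).
    by congr pair; apply: lie_operator.
  rewrite !endoZ !endoB !operatorE.
  rewrite (lieC (e i) (h _)) (lieC (f j) (h _)) !(he, hf) !mx_root_coroot.
  rewrite (lieC (f j) (e i)) ef !tensE !add0r.
  rewrite !(scalerDr, scalerBr, scalerN, scaleNr, scalerA) -a_sym.
  case: eqP => [<-|_]; last by rewrite operator0 !tensE; congr pair; lmod_ring.
  by rewrite subrr addNr; congr pair; lmod_ring.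
- transitivity (operator O [lie h x, h y], operator O (h x) 0 - operator O (h y) (0 : T)).
    by congr pair; rewrite -[X in operator X](addr0 O); apply: lie_operator.
  by rewrite hh operator0 !endo0 subrr.
- transitivity (operator (alpha i) [lie h x, e i],
      operator O (h x) (twist_e i) - operator (alpha i) (e i) 0).
    by congr pair; rewrite -[X in operator X]add0r; apply: lie_operator.
  rewrite endo0 !endoZ !endoB !operatorE !hh !he !tensE operatorZ !addr0.
  by congr pair; rewrite /twist_e /=; lmod_ring.
- transitivity (operator (- alpha i) [lie h x, f i],
      operator O (h x) (twist_f i) - operator (- alpha i) (f i) 0).
    by congr pair; rewrite -[X in operator X]add0r; apply: lie_operator.
  rewrite endo0 !endoZ !endoB !operatorE !hh !hf !tensE operatorZ !addr0.
  by congr pair; rewrite /twist_f /=; lmod_ring.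
Qed.

Definition cobracket_aff : g0 -> affine T := chev_lift cob_e cob_f cob_h.
Definition cobracket (x : g0) : T := (cobracket_aff x).2.

Let aff_hom : lie_hom cobracket_aff := chev_lift_hom cob_rels.

Lemma cobracket_cocycle x y : cobracket [lie x, y]
  = (cobracket_aff x).1 (cobracket y) - (cobracket_aff y).1 (cobracket x).
Proof. by rewrite /cobracket (lie_homE aff_hom). Qed.

Lemma cobracketD x y : cobracket (x + y) = cobracket x + cobracket y.
Proof. by rewrite /cobracket (lie_homD aff_hom). Qed.

Lemma cobracketZ c x : cobracket (c *: x) = c *: cobracket x.
Proof. by rewrite /cobracket (lie_homZ aff_hom). Qed.

Lemma cobracket0 : cobracket 0 = 0.
Proof. by rewrite /cobracket (lie_hom0 aff_hom). Qed.

Lemma cobracket_e i : cobracket (ce i) = twist_e i.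
Proof. by rewrite /cobracket /cobracket_aff (chev_lift_e cob_rels). Qed.

Lemma cobracket_f i : cobracket (cf i) = twist_f i.
Proof. by rewrite /cobracket /cobracket_aff (chev_lift_f cob_rels). Qed.

Lemma cobracket_h c : cobracket (ch c) = 0.
Proof. by rewrite /cobracket /cobracket_aff (chev_lift_h cob_rels). Qed.

Lemma aff_e i : (cobracket_aff (ce i)).1 = operator (alpha i) (e i).
Proof. by rewrite /cobracket_aff (chev_lift_e cob_rels). Qed.

Lemma aff_f i : (cobracket_aff (cf i)).1 = operator (- alpha i) (f i).
Proof. by rewrite /cobracket_aff (chev_lift_f cob_rels). Qed.

Lemma aff_npos g x : npos ce g x -> (cobracket_aff x).1 = operator g (rho x).
Proof.
elim=> {g x} [g|i|i g x _ IH|g x y _ IHx _ IHy|g c x _ IH].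
- by rewrite (lie_hom0 aff_hom) (lie_hom0 rho_hom) operator0.
- by rewrite aff_e rho_e.
- rewrite (lie_homE aff_hom) (lie_homE rho_hom) rho_e -lie_operator -aff_e -IH //.
- rewrite (lie_homD aff_hom) (lie_homD rho_hom).
  by have := operatorDZ (m := m) g 1 (rho x) (rho y); rewrite !scale1r => ->; rewrite -IHx -IHy.
- by rewrite (lie_homZ aff_hom) (lie_homZ rho_hom) operatorZ -IH.
Qed.

Lemma npos_rho g x : npos ce g x -> npos e g (rho x).
Proof. exact: (npos_hom rho_hom rho_e). Qed.

(** The components of the cobracket live in [V]; lifting them to [g0] makes the induction hypothesis
    of [singular_kernel] applicable. *)
Lemma npos_rho_lift g y : npos e g y -> exists2 x, npos ce g x & rho x = y.
Proof.
elim=> {g y} [g|i|i g y _ [x gx <-]|g y y' _ [x gx <-] _ [x' gx' <-]|g c y _ [x gx <-]].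
- by exists 0; [apply: npos_0 | rewrite (lie_hom0 rho_hom)].
- by exists (ce i); [apply: npos_gen | rewrite rho_e].
- by exists [lie ce i, x]; [apply: npos_ad | rewrite (lie_homE rho_hom) rho_e].
- by exists (x + x'); [apply: npos_D | rewrite (lie_homD rho_hom)].
- by exists (c *: x); [apply: npos_Z | rewrite (lie_homZ rho_hom)].
Qed.

(* [nu g] represents the functional [(g | .)] for the form with Gram matrix
   [a_i B_ij] on the root lattice. *)
Definition dual_row (g : 'rV[int]_m) : 'rV[K]_m := \row_i ((g 0 i)%:~R * a i).
Definition nu (g : 'rV[int]_m) : V := h (dual_row g).

Lemma nuD g g' : nu (g + g') = nu g + nu g'.
Proof.
rewrite /nu -(cartanD rels); congr h.
by apply/rowP => i; rewrite !mxE intrD mulrDl.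
Qed.

Lemma nu_alpha i : nu (alpha i) = a i *: h (cor i).
Proof.
rewrite /nu -(cartanZ rels); congr h.
by apply/rowP => j; rewrite !mxE eqxx /=; case: (eqVneq j i) => [->|_];
  rewrite ?mulr1 ?mul1r ?mulr0 ?mul0r.
Qed.

(* The span of [n+_b (x) n+_(g - b)]; both factors have positive degree. *)
Inductive dplus (g : 'rV[int]_m) : T -> Prop :=
| dplus_0 : dplus g 0
| dplus_tens b x y : npos e b x -> npos e (g - b) y -> dplus g (tens b x y)
| dplus_D t u : dplus g t -> dplus g u -> dplus g (t + u)
| dplus_Z c t : dplus g t -> dplus g (c *: t).

Lemma dplus_e i g t : dplus g t -> dplus (alpha i + g) (operator (alpha i) (e i) t).
Proof.
elim=> {t} [|b x y bx gy|t u _ IHt _ IHu|c t _ IH].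
- by rewrite endo0; apply: dplus_0.
- rewrite operatorE; apply: dplus_D; apply: dplus_tens => //.
  + by rewrite addrC; apply: npos_ad.
  + by rewrite opprD [- b - _]addrC addrACA subrr add0r.
  + by rewrite -addrA; apply: npos_ad.
- by rewrite endo_additive; apply: dplus_D.
- by rewrite endoZ; apply: dplus_Z.
Qed.

Definition reduced_cobracket g x : T :=
  cobracket x - (tens 0 (nu g) (rho x) - tens g (rho x) (nu g)).

(** A bracket with [e i] adds [nu (alpha i)] to the Cartan part; all other new terms pair [e i] with
    [rho x], hence lie in [dplus]. *)
Lemma reduced_cobracket_dplus g x : npos ce g x -> dplus g (reduced_cobracket g x).
Proof.
have [hl ef hh he hf] := rels.
rewrite /reduced_cobracket.
elim=> {g x} [g|i|i g x gx IH|g x y _ IHx _ IHy|g c x _ IH].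
- by rewrite cobracket0 (lie_hom0 rho_hom) !tensE !subrr; apply: dplus_0.
- rewrite cobracket_e rho_e nu_alpha !tensE -scalerBr subrr; exact: dplus_0.
- rewrite cobracket_cocycle aff_e (aff_npos gx) (lie_homE rho_hom) rho_e nuD nu_alpha.
  set X := rho x in IH *.
  have gX : npos e g X := npos_rho gx.
  set D := cobracket x - _ in IH.
  have -> : cobracket x = D + (tens 0 (nu g) X - tens g X (nu g)) by rewrite subrK.
  clearbody D.
  rewrite endo_additive cobracket_e /twist_e endoZ !endoB !operatorE.
  have eX j : [lie e j, nu g] = - root j (dual_row g) *: e j.
    by rewrite /nu lieC he scaleNr.
  have Xh : [lie X, h (cor i)] = - weight root g (cor i) *: X.
    by rewrite lieC (npos_weight rels gX) scaleNr.
  rewrite eX Xh (lieC X (e i)) !add0r (addrC g) !tensE.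
  have gXe : dplus (alpha i + g) (tens g X (e i)).
    by apply: dplus_tens => //; rewrite addrK; apply: npos_gen.
  have geX : dplus (alpha i + g) (tens (alpha i) (e i) X).
    by apply: dplus_tens; [apply: npos_gen | rewrite addrC addKr].
  set r := root i (dual_row g); set w := weight root g (cor i).
  rewrite (_ : _ - _ = operator (alpha i) (e i) D
    + (- r - a i * w) *: tens (alpha i) (e i) X + (r + a i * w) *: tens g X (e i)).
    by apply: dplus_D; [apply: dplus_D; [apply: dplus_e | ] | ]; try apply: dplus_Z.
  by lmod_ring.
- rewrite cobracketD (lie_homD rho_hom) !tensE opprB (addrC (tens 0 _ _)) addrAC.
  have := dplus_D IHx IHy; congr dplus; lmod_ring.
- rewrite cobracketZ (lie_homZ rho_hom) !tensE -!scalerBr.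
  exact: dplus_Z.
Qed.

(* The bracket of a cocycle is a derivation, so its value on generators
   determines it. *)
Lemma bracket_cobracket g x : npos ce g x ->
  bracket_map (cobracket x) = (4%:R * \sum_i (g 0 i)%:~R * a i) *: rho x.
Proof.
have [hl ef hh he hf] := rels.
elim=> {g x} [g|i|i g x gx IH|g x y _ IHx _ IHy|g c x _ IH].
- by rewrite cobracket0 (lie_hom0 rho_hom) linear0 scaler0.
- rewrite cobracket_e rho_e linearZ linearB /= !bracket_mapE (lieC (e i)) he mx_root_coroot B2.
  rewrite (bigD1 i) //= big1 ?addr0 => [|j ji]; last by rewrite mxE (negPf ji) mul0r.
  by rewrite mxE !eqxx; lmod_ring.
- rewrite cobracket_cocycle aff_e (aff_npos gx) linearB /= !bracket_map_operator IH.
  rewrite (lie_homE rho_hom) rho_e cobracket_e linearZ linearB /= !bracket_mapE.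
  rewrite (lieC (e i) (h _)) he mx_root_coroot B2 lieZr (lieC (rho x)).
  rewrite !(lieZl, lieBl, lieDl, lieNl).
  have -> : \sum_j ((alpha i + g) 0 j)%:~R * a j = a i + \sum_j (g 0 j)%:~R * a j.
    rewrite (eq_bigr (fun j => (j == i)%:R * a j + (g 0 j)%:~R * a j)); last first.
      by move=> j _; rewrite !mxE eqxx /= intrD mulrDl; case: eqP.
    rewrite big_split /= (bigD1 i) //= big1 ?addr0 => [|j ji]; last by rewrite (negPf ji) mul0r.
    by rewrite eqxx mul1r.
  by lmod_ring.
- by rewrite cobracketD (lie_homD rho_hom) linearD /= IHx IHy scalerDr.
- by rewrite cobracketZ (lie_homZ rho_hom) linearZ /= IH !scalerA mulrC.
Qed.

Lemma npos_component b xi g t : dplus g t -> npos e b (component b xi t).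
Proof.
elim=> {t} [|b' x y bx _|t u _ IHt _ IHu|c t _ IH].
- by rewrite linear0; apply: npos_0.
- by rewrite componentE; case: eqP => [<-|_]; [apply: npos_Z | apply: npos_0].
- by rewrite linearD; apply: npos_D.
- by rewrite linearZ; apply: npos_Z.
Qed.

(** The right factor would have degree [g - b], whose height is not positive. *)
Lemma component_high b xi g t : dplus g t -> height g <= height b -> component b xi t = 0.
Proof.
move=> gt gb; elim: gt => {t} [|b' x y _ gy|t u _ IHt _ IHu|c t _ IH].
- by rewrite linear0.
- rewrite componentE; case: eqP => // b'b.
  case: (npos_positive gy) => [->|[_]]; first by rewrite linear0 scale0r.
  by rewrite heightD heightN b'b subr_gt0 ltNge gb.
- by rewrite linearD /= IHt IHu addr0.
- by rewrite linearZ /= IH scaler0.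
Qed.

(** The cocycle identity equates [f j] acting on the cobracket of [x] with [rho x] acting on
    [twist_f j]. The Cartan part yields the same, because [(alpha_j | g) = a j * weight root g (cor
    j)] by symmetry. *)
Lemma reduced_cobracket_f g x j : npos ce g x -> cobracket [lie cf j, x] = 0 ->
  [lie f j, rho x] = 0 -> operator (- alpha j) (f j) (reduced_cobracket g x) = 0.
Proof.
have [hl ef hh he hf] := rels => gx.
rewrite cobracket_cocycle aff_f (aff_npos gx) cobracket_f => + fX.
have gX : npos e g (rho x) := npos_rho gx.
move: fX gX; rewrite /reduced_cobracket; set X := rho x => fX gX.
have Xf : [lie X, f j] = 0 by rewrite lieC fX oppr0.
have Xh : [lie X, h (cor j)] = - weight root g (cor j) *: X.
  by rewrite lieC (npos_weight rels gX) scaleNr.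
have fn : [lie f j, nu g] = root j (dual_row g) *: f j.
  by rewrite /nu lieC hf scaleNr opprK.
have rE : root j (dual_row g) = a j * weight root g (cor j).
  rewrite /weight mulr_sumr; apply: eq_bigr => i _.
  by rewrite mxE mx_root_coroot mulrCA a_sym mulrA.
move=> /subr0_eq cc.
rewrite endoB cc endoZ !endoB !operatorE fn rE Xh fX Xf !tensE !add0r.
by lmod_ring.
Qed.

(* If [rho [F_j, x] = 0] for all [j], the components of the reduced cobracket of
   [x] are again killed by the [f_j], so they vanish by induction on the height.
   Unless [rho x = 0], applying the bracket map then gives
   [2 (g | g) = 4 * sum_i g_i a_i], although sl2-theory makes [(g | g) <= 0]. *)
Lemma singular_kernel (N : nat) g x : npos ce g x -> height g <= N%:Z ->
  (forall j, rho [lie cf j, x] = 0) -> rho x = 0 /\ cobracket x = 0.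
Proof.
have [hl ef hh he hf] := rels.
elim: N g x => [|N IHN] g x gx gN fx.
  case: (npos_positive gx) => [->|[_]]; last by rewrite ltNge gN.
  by rewrite (lie_hom0 rho_hom) cobracket0.
have [->|gp] := npos_positive gx; first by rewrite (lie_hom0 rho_hom) cobracket0.
have fX j : [lie f j, rho x] = 0 by rewrite -rho_f -(lie_homE rho_hom).
(* Here the second conclusion is used in lower degree: [[F_j, x]] is either of degree [g - alpha j],
   where the induction applies, or a multiple of [H_j], on which the cobracket vanishes. *)
have cfx j : cobracket [lie cf j, x] = 0.
  have [c [y [fxy gy gc]]] := npos_lower (chev_alg_rels root cor) j gx.
  have hgj : height (g - alpha j) <= N%:Z by rewrite heightD heightN height_alpha; lia.
  case: gc => [c0|gj].
    rewrite fxy c0 scale0r add0r; apply: (proj2 (IHN _ _ gy hgj _)) => k.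
    have := fx j; rewrite fxy c0 scale0r add0r => y0.
    by rewrite (lie_homE rho_hom) y0 lie0r.
  case: (npos_positive gy) => [y0|]; last by rewrite gj subrr => /positive_neq0.
  by rewrite fxy y0 addr0 cobracketZ cobracket_h scaler0.
have dp := reduced_cobracket_dplus gx.
have fD j : operator (- alpha j) (f j) (reduced_cobracket g x) = 0.
  exact: reduced_cobracket_f.
set D := reduced_cobracket g x in dp fD.
have D0 : D = 0.
  suff comp0 p b xi : height b <= p%:Z -> component b xi D = 0.
    by apply: component_eq0 => b xi; apply: (comp0 (absz (height b))); lia.
  elim: p b xi => [|p IHp] b xi bp.
    case: (npos_positive (npos_component b xi dp)) => // -[_].
    by rewrite ltNge bp.
  have [gb|bg] := lerP (height g) (height b); first exact: (component_high xi dp gb).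
  (* As [f j] kills [D], its bracket with this component is up to sign a component of degree
     [b - alpha j], zero by the inner induction. So [u] is singular, of smaller height than [g], and
     the outer induction applies. *)
  have [u bu uE] := npos_rho_lift (npos_component b xi dp).
  rewrite -uE; apply: (proj1 (IHN _ _ bu _ _)) => [|j]; first by lia.
  rewrite (lie_homE rho_hom) rho_f uE.
  have := component_operator (- alpha j) (f j) (b - alpha j) xi D.
  rewrite fD linear0 opprK subrK (IHp (b - alpha j)) ?addr0 //.
  by rewrite heightD heightN height_alpha; lia.
have X0 : rho x = 0.
  apply/eqP/negPn/negP => X0.
  have gX := npos_rho gx.
  have hX := npos_weight rels gX.
  (* [rho x] is killed by [f i] and some power of [e i]: it is a lowest weight vector of a finite
     sl2-string. *)
  have wle0 i : weight root g (cor i) <= 0.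
    have efi : [lie f i, e i] = - h (cor i) by rewrite lieC ef eqxx.
    have hei : [lie - h (cor i), e i] = - 2%:R *: e i.
      by rewrite lieNl he mx_root_coroot B2 scaleNr.
    have hXi : [lie - h (cor i), rho x] = - weight root g (cor i) *: rho x.
      by rewrite lieNl hX scaleNr.
    have [k [wk _]] := sl2_top efi hei (fX i) hXi X0 (e_nil i (rho x)).
    by rewrite -oppr_ge0 wk ler0n.
  have := bracket_cobracket gx.
  have -> : cobracket x = tens 0 (nu g) (rho x) - tens g (rho x) (nu g).
    by apply: subr0_eq.
  rewrite linearB /= !bracket_mapE (lieC (rho x)) /nu hX opprK -scalerDl => /eqP.
  rewrite -subr_eq0 -scalerBl scaler_eq0 (negPf X0) orbF => /eqP wE.
  (* [(g | g)] is a combination of the [weight root g (cor k)] with nonnegative coefficients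
     [g_k a_k]. *)
  have wdual : weight root g (dual_row g) <= 0.
    have -> : weight root g (dual_row g)
        = \sum_k (g 0 k)%:~R * a k * weight root g (cor k).
      rewrite [LHS](eq_bigr (fun i => \sum_k
         (g 0 k)%:~R * a k * ((g 0 i)%:~R * (B k i)%:~R))).
        rewrite exchange_big; apply: eq_bigr => k _; rewrite mulr_sumr.
        by apply: eq_bigr => i _; rewrite mx_root_coroot.
      move=> i _; rewrite mulr_sumr; apply: eq_bigr => k _.
      by rewrite mxE; ring.
    apply: sumr_le0 => k _; apply: mulr_ge0_le0 => //.
    by apply: mulr_ge0; [rewrite ler0z; case: gp | apply: ltW].
  have sgt0 : 0 < \sum_i (g 0 i)%:~R * a i.
    have [g_ge0 hg] := gp.
    have ge0 i : 0 <= (g 0 i)%:~R * a i by rewrite mulr_ge0 ?ler0z // ltW.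
    rewrite lt_neqAle eq_sym sumr_ge0 ?andbT //.
    apply/negP => /eqP s0; move: hg; rewrite /height big1 ?ltxx // => i _.
    have /eqP := @psumr_eq0P _ _ xpredT _ (fun i _ => ge0 i) s0 i isT.
    by rewrite mulf_eq0 intr_eq0 (gt_eqF (a_gt0 i)) orbF => /eqP.
  have : weight root g (dual_row g) + weight root g (dual_row g)
      = 4%:R * \sum_i (g 0 i)%:~R * a i by apply/eqP; rewrite -subr_eq0 wE.
  apply/eqP; rewrite lt_eqF //.
  apply: (@le_lt_trans _ _ 0); last by rewrite mulr_gt0.
  by rewrite -[X in _ <= X]addr0 lerD.
split=> //; rewrite -[LHS](subrK (tens 0 (nu g) (rho x) - tens g (rho x) (nu g))).
by rewrite -/(reduced_cobracket g x) -/D D0 X0 !tensE subrr addr0.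
Qed.

End Cobracket.

(** * Comparison of kernels *)

Section Comparison.
Variables (K : numFieldType) (m : nat) (B : 'M[int]_m) (a : 'I_m -> K).
Hypothesis a_sym : forall i j, a i * (B i j)%:~R = a j * (B j i)%:~R.
Hypothesis B2 : forall i, B i i = 2.
Hypothesis a_gt0 : forall i, 0 < a i.
Local Notation root := (mx_root (K := K) B).
Local Notation cor := (@mx_coroot K m).
Local Notation g0 := (chev_alg root cor).
Local Notation ce := (chev_e root cor).
Local Notation cf := (chev_f root cor).
Local Notation ch := (chev_h root cor).

Lemma chev_hom_ext (L : lieAlgType K) (phi psi : g0 -> L) : lie_hom phi -> lie_hom psi ->
  (forall i, phi (ce i) = psi (ce i)) -> (forall i, phi (cf i) = psi (cf i)) ->
  phi =1 psi.
Proof.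
move=> hphi hpsi phie phif; have rels := chev_alg_rels root cor.
apply: (chev_alg_generated (root := root) (cor := cor)
  (S := fun x => phi x = psi x)).
  split=> [|x y xE yE]; last by rewrite (lie_homE hphi) (lie_homE hpsi) xE yE.
  split=> [|x y xE yE|c x xE]; first by rewrite (lie_hom0 hphi) (lie_hom0 hpsi).
  - by rewrite (lie_homD hphi) (lie_homD hpsi) xE yE.
  - by rewrite (lie_homZ hphi) (lie_homZ hpsi) xE.
move=> x [[i ->]|[i ->]|[c ->]] //.
(* The coroots span the Cartan part, so it lies in the subalgebra generated by the [E_i] and
   [F_i]. *)
have -> : ch c = \sum_i c 0 i *: [lie ce i, cf i].
  have [_ ef _ _ _] := rels.
  rewrite (eq_bigr (fun i => ch (c 0 i *: cor i))); last first.
    by move=> i _; rewrite ef eqxx -(cartanZ rels).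
  rewrite [in LHS](row_sum_delta c).
  elim/big_rec2: _ => [|i u v _ <-]; first exact: (cartan0 rels).
  exact: (cartanD rels).
rewrite (lie_hom_sum hphi) (lie_hom_sum hpsi); apply: eq_bigr => i _.
by rewrite (lie_homZ hphi) (lie_homZ hpsi) (lie_homE hphi) (lie_homE hpsi) phie phif.
Qed.

Section Positive.
Variables (V : lieAlgType K) (e f : 'I_m -> V) (h : 'rV[K]_m -> V).
Hypothesis rels : chevalley_rels root cor e f h.
Hypothesis e_nil : forall i x, ad_nilpotent (e i) x.
Variables (W : lieAlgType K) (pi : g0 -> W).
Hypothesis pi_hom : lie_hom pi.
Hypothesis pi_h : forall c, pi (ch c) = 0 -> c = 0.

(** Bracketing with [F_j] stays in the kernel of [pi] and lowers the height, so by induction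
    [singular_kernel] applies; a Cartan term vanishes because [pi] is injective on the Cartan
    part. *)
Lemma kernel_pos g x : npos ce g x -> pi x = 0 -> chev_lift e f h x = 0.
Proof.
have crels := chev_alg_rels root cor.
have [n] : exists n : nat, height g <= n%:Z by exists (absz (height g)); lia.
elim: n g x => [|n IHn] g x gn gx px.
  case: (npos_positive gx) => [->|[_]]; last by rewrite ltNge gn.
  exact: (lie_hom0 (chev_lift_hom rels)).
apply: (proj1 (singular_kernel a_sym B2 a_gt0 rels e_nil gx gn _)) => j.
have [c [y [fxy gy gc]]] := npos_lower crels j gx.
have pfx : c *: pi (ch (cor j)) + pi y = 0.
  by rewrite -(lie_homZ pi_hom) -(lie_homD pi_hom) -fxy (lie_homE pi_hom) px lie0r.
case: gc => [c0|gj].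
  rewrite fxy c0 scale0r add0r; apply: IHn gy _.
    by rewrite heightD heightN height_alpha; lia.
  by rewrite -pfx c0 scale0r add0r.
have y0 : y = 0 by case: (npos_positive gy) => //; rewrite gj subrr => /positive_neq0.
have : cor j != 0 by apply/negP => /eqP/rowP/(_ j)/eqP; rewrite !mxE !eqxx oner_eq0.
have /pi_h/eqP : pi (ch (c *: cor j)) = 0.
  by rewrite (cartanZ crels) (lie_homZ pi_hom) -pfx y0 (lie_hom0 pi_hom) addr0.
rewrite scaler_eq0 fxy y0 => /orP[/eqP -> _|-> //].
by rewrite scale0r addr0 (lie_hom0 (chev_lift_hom rels)).
Qed.

End Positive.

Section Kernel.
Variables (V : lieAlgType K) (e f : 'I_m -> V) (h : 'rV[K]_m -> V).
Hypothesis rels : chevalley_rels root cor e f h.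
Hypotheses (e_nil : forall i x, ad_nilpotent (e i) x).
Hypotheses (f_nil : forall i x, ad_nilpotent (f i) x).
Variables (W : lieAlgType K) (pi : g0 -> W).
Hypothesis pi_hom : lie_hom pi.
Hypothesis pi_h : forall c, pi (ch c) = 0 -> c = 0.

Lemma kernel_neg g x : npos cf g x -> pi x = 0 -> chev_lift e f h x = 0.
Proof.
have crels := chev_alg_rels root cor.
have cswap := chevalley_swap crels; have swap := chevalley_swap rels.
move=> /(npos_rho_lift cswap)[x' gx' <-] px'.
have sigma_hom := chev_lift_hom cswap; have rho_hom := chev_lift_hom rels.
(* The Chevalley involution of [g0] moves the problem to positive degree, with [pi] replaced by its
   composite with [sigma]. *)
pose sigma := chev_lift (root := root) (cor := cor) cf ce (fun c => - ch c).
have -> : chev_lift e f h (sigma x') = chev_lift f e (fun c => - h c) x'.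
  apply: (chev_hom_ext (phi := fun x => chev_lift e f h (sigma x))) => [||i|i].
  - exact: lie_hom_comp.
  - exact: (chev_lift_hom swap).
  - by rewrite /sigma (chev_lift_e cswap) (chev_lift_f rels) (chev_lift_e swap).
  - by rewrite /sigma (chev_lift_f cswap) (chev_lift_e rels) (chev_lift_f swap).
apply: (kernel_pos swap f_nil (pi := fun x => pi (sigma x)) _ _ gx') => //.
- exact: lie_hom_comp.
- move=> c; rewrite /sigma (chev_lift_h cswap) -(cartanN crels) => /pi_h/eqP.
  by rewrite oppr_eq0 => /eqP.
Qed.

Lemma kernel_homogeneous g x : homogeneous ce cf ch g x -> pi x = 0 ->
  chev_lift e f h x = 0.
Proof.
have crels := chev_alg_rels root cor.
case/(homogeneous_cases crels) => [[_ gx]|[_ gx]|[_ [c ->]]|->].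
- exact: (kernel_pos rels e_nil pi_hom pi_h gx).
- exact: (kernel_neg gx).
- move=> /pi_h ->; rewrite (cartan0 crels); exact: (lie_hom0 (chev_lift_hom rels)).
- by rewrite (lie_hom0 (chev_lift_hom rels)).
Qed.

End Kernel.
End Comparison.

(** * Real roots *)

Section Weyl.
Variables (K : numFieldType) (n : nat) (A : 'M[int]_n) (R : realization K A).
Hypothesis gcmA : is_gcm A.
Local Notation C := (cartan R).
Local Notation sroot := (fun i (x : C) => simple_root R i x : K).
Local Notation cor := (simple_coroot R).

Lemma km_contragredient :
  contragredient sroot cor (km_e R) (km_f R) (km_h (R := R)).
Proof.
split; first exact: km_chevalley.
- exact: km_generated.
- exact: km_h_trivial_ideal.
Qed.

Lemma simple_reflE i (x : C) : simple_refl R i x = x - sroot i x *: cor i.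
Proof. by rewrite lfunE. Qed.

Lemma root_simple_refl i j (x : C) :
  sroot j (simple_refl R i x) = sroot j x - sroot i x * (A i j)%:~R.
Proof. by rewrite simple_reflE linearB linearZ /= simple_pairing. Qed.

Lemma simple_reflK i (x : C) : simple_refl R i (simple_refl R i x) = x.
Proof.
have [A2 _ _] := gcmA.
rewrite [LHS]simple_reflE root_simple_refl A2 simple_reflE; lmod_ring.
Qed.

(** For an arbitrary linear map [w^-1] is only a generalized inverse; Weyl elements are invertible
    because simple reflections are involutions. *)
Lemma weyl_inverse (w : 'End(C)) : weyl w ->
  cancel w (w^-1)%VF /\ cancel (w^-1)%VF w.
Proof.
move=> ww; have [v [vw wv]] : exists v : 'End(C), cancel w v /\ cancel v w.
  elim: ww => [|i|u v _ [u' [uu' u'u]] _ [v' [vv' v'v]]].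
  - by exists \1%VF; split=> x; rewrite !lfunE.
  - by exists (simple_refl R i); split=> x; apply: simple_reflK.
  - exists (v' \o u')%VF; split=> x; rewrite !lfunE /=; first by rewrite uu' vv'.
    by rewrite v'v u'u.
have wK : cancel w (w^-1)%VF.
  by apply: lker0_lfunK; apply/lker0P/(can_inj vw).
by split=> // x; rewrite -{1}[x]wv wK.
Qed.

Local Notation is_weight := (is_weight (km_h (R := R))).

Lemma is_weight_ext b b' : b =1 b' -> is_weight b -> is_weight b'.
Proof. by move=> bb' [x [x0 bx]]; exists x; split=> // y; rewrite bx bb'. Qed.

Lemma is_weight_weyl (w : 'End(C)) (b : 'Hom(C, K^o)) : weyl w ->
  is_weight b -> is_weight (fun y => b (w y)).
Proof.
move=> ww; elim: ww b => [|i|u v _ IHu _ IHv] b hb.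
- by apply: is_weight_ext hb => y; rewrite lfunE.
- have hs := is_weight_reflect (@simple_pairing _ _ _ R) (@root_independent _ _ _ R)
    km_contragredient gcmA i hb.
  apply: is_weight_ext hs => y.
  by rewrite simple_reflE linearB linearZ /= /GRing.scale /= mulrC.
- have hbu : is_weight (b \o u)%VF by apply: is_weight_ext (IHu _ hb) => y; rewrite lfunE.
  by apply: is_weight_ext (IHv _ hbu) => y; rewrite !lfunE.
Qed.

Definition weight_lfun (g : 'rV[int]_n) : 'Hom(C, K^o) :=
  \sum_i (g 0 i)%:~R *: simple_root R i.

Lemma weight_lfunE g y : weight_lfun g y = weight sroot g y.
Proof.
by rewrite /weight_lfun sum_lfunE; apply: eq_bigr => i _; rewrite lfunE.
Qed.

(** If no power of [ad z] killed a homogeneous [x], its weight plus every multiple of [b] would be a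
    weight; [w] turns these into an infinite string along the simple root [k], against
    [simple_string_finite]. *)
Lemma real_root_nilpotent (b : 'Hom(C, K^o)) (w : 'End(C)) k (z : km_alg R) :
  weyl w -> (forall y, b (w y) = sroot k y) -> in_root_space b z ->
  forall x, ad_nilpotent z x.
Proof.
move=> ww bw bz x; have rels := km_chevalley R.
have [[S0 SD SZ] _] := ad_nilpotent_subalgebra z.
have [s [c [us Hc ->]]] := graded_decomposition rels (@km_generated _ _ _ R) x.
apply: subspace_sum => // g _; move: (c g) (Hc g) => {}x gx.
apply: contrapT => /forallNP nz.
have hN N : is_weight (weight_lfun g + N%:R *: b)%VF.
  exists (iter N (lie z) x); split=> [|y]; first by apply/eqP/nz.
  rewrite (iter_weight (c := b) (b := weight sroot g)) // => [|y'].
    by rewrite !lfunE /= lfunE /= weight_lfunE.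
  exact: (homogeneous_weight rels gx).
have hNw N := is_weight_weyl ww (hN N).
have [g' [x' [_ _ gE]]] :=
  weight_homogeneous (@root_independent _ _ _ R) km_contragredient (hNw 0%N).
have [N []] := simple_string_finite (@simple_pairing _ _ _ R) (@root_independent _ _ _ R)
  km_contragredient gcmA k g'.
apply: is_weight_ext (hNw N) => y.
have := gE y; rewrite !lfunE /= !lfunE /= bw scale0r addr0 => ->.
rewrite weightD; congr (_ + _); rewrite /GRing.scale /=.
elim: N => [|N IHN]; first by rewrite mulr0n weight0 mul0r.
by rewrite -natr1 mulrDl mul1r IHN mulrSr weightD weight_alpha.
Qed.

Section Symmetry.
Variable d : 'I_n -> K.
Hypothesis d_gt0 : forall i, 0 < d i.
Hypothesis d_sym : forall i j, d i * (A i j)%:~R = d j * (A j i)%:~R.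

(* With [d A] symmetric, [cor l |-> root l / d l] is the Weyl-equivariant map
   induced by the invariant form. *)
Definition coroot_comb (c : 'I_n -> K) : C := \sum_l c l *: cor l.
Definition root_comb (c : 'I_n -> K) (y : C) : K := \sum_l c l / d l * sroot l y.

Lemma weyl_comb (w : 'End(C)) : weyl w -> forall c, exists c',
  w (coroot_comb c) = coroot_comb c' /\ forall y, root_comb c' (w y) = root_comb c y.
Proof.
elim=> [|i|u v _ IHu _ IHv] c.
- by exists c; split=> [|y]; rewrite lfunE.
- exists (fun l => c l - (if l == i then sroot i (coroot_comb c) else 0)); split=> [|y].
    rewrite simple_reflE; set r := sroot i _; rewrite /coroot_comb.
    rewrite [in RHS](eq_bigr _ (fun l _ => scalerBl _ _ _)) sumrB; congr (_ - _).
    by rewrite [in RHS](bigD1 i) //= eqxx big1 ?addr0 // => l /negPf ->; rewrite scale0r.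
  rewrite /root_comb.
  rewrite (eq_bigr (fun l => (c l / d l * sroot l y - sroot i y * (c l / d l * (A i l)%:~R))
     - (if l == i then sroot i (coroot_comb c) / d i * sroot i (simple_refl R i y) else 0))).
    rewrite sumrB sumrB -mulr_sumr -big_mkcond big_pred1_eq root_simple_refl.
    have [-> _ _] := gcmA.
    have -> : sroot i (coroot_comb c) / d i = \sum_l c l / d l * (A i l)%:~R.
      rewrite /coroot_comb linear_sum mulr_suml; apply: eq_bigr => l _.
      rewrite linearZ /= simple_pairing /GRing.scale /=.
      have dl := lt0r_neq0 (d_gt0 l); have di := lt0r_neq0 (d_gt0 i).
      apply: (mulfI di); apply: (mulfI dl).
      transitivity (c l * (d l * (A l i)%:~R)); first by field.
      by rewrite -d_sym; field.
    by ring.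
  move=> l _; rewrite root_simple_refl; case: eqP => [->|_]; last by ring.
  by rewrite root_simple_refl; have di := lt0r_neq0 (d_gt0 i); field.
- have [c1 [vc1 rc1]] := IHv c; have [c2 [uc2 rc2]] := IHu c1.
  exists c2; split=> [|y]; first by rewrite lfunE /= vc1 uc2.
  by rewrite lfunE /= rc2 rc1.
Qed.

(** This holds for a simple root with factor [d k], and both sides move alike under [w]. *)
Lemma real_root_comb (b : 'Hom(C, K^o)) (bv : C) : real_root_coroot b bv ->
  exists k c, bv = coroot_comb c /\ forall y, b y = d k * root_comb c y.
Proof.
move=> [w [k [ww -> ->]]].
have [wK Kw] := weyl_inverse ww.
have [c [cE rE]] := weyl_comb ww (fun l => (l == k)%:R).
exists k, c; split.
  rewrite -cE; congr (w _); rewrite /coroot_comb (bigD1 k) //= eqxx scale1r.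
  by rewrite big1 ?addr0 // => l /negPf ->; rewrite scale0r.
move=> y; rewrite /weyl_dual lfunE /=; have := rE ((w^-1)%VF y); rewrite Kw => ->.
rewrite /root_comb (bigD1 k) //= eqxx big1 ?addr0 => [|l /negPf ->]; last by rewrite !mul0r.
by rewrite mul1r mulrA mulfV ?mul1r // lt0r_neq0.
Qed.

Lemma root_comb_sym c c' : root_comb c (coroot_comb c') = root_comb c' (coroot_comb c).
Proof.
have rc c1 c2 : root_comb c1 (coroot_comb c2)
    = \sum_l \sum_p c1 l * c2 p * ((A p l)%:~R / d l).
  apply: eq_bigr => l _; rewrite linear_sum mulr_sumr; apply: eq_bigr => p _.
  by rewrite linearZ /= simple_pairing /GRing.scale /=; ring.
rewrite !rc exchange_big; apply: eq_bigr => p _; apply: eq_bigr => l _.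
rewrite (mulrC (c l)); congr (_ * _).
have dl := lt0r_neq0 (d_gt0 l); have dp := lt0r_neq0 (d_gt0 p).
apply: (mulfI dl); apply: (mulfI dp).
transitivity (d p * (A p l)%:~R); first by field.
by rewrite d_sym; field.
Qed.

End Symmetry.
End Weyl.

(** * Derived algebras and pi-systems *)

Section DerivedAlgebra.
Variables (K : numFieldType) (m : nat) (B : 'M[int]_m) (RB : realization K B).
Local Notation root := (mx_root (K := K) B).
Local Notation cor := (@mx_coroot K m).
Local Notation g0 := (chev_alg root cor).
Local Notation ce := (chev_e root cor).
Local Notation cf := (chev_f root cor).
Local Notation ch := (chev_h root cor).
Local Notation sroot := (fun i (x : cartan RB) => simple_root RB i x : K).

Definition coroot_span (c : 'rV[K]_m) : cartan RB := \sum_i c 0 i *: simple_coroot RB i.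
Definition km_coroot_h (c : 'rV[K]_m) : km_alg RB := km_h (coroot_span c).

Lemma coroot_span_linear : linear coroot_span.
Proof.
move=> a x y; rewrite /coroot_span scaler_sumr -big_split; apply: eq_bigr => i _.
by rewrite !mxE scalerDl scalerA.
Qed.

Lemma coroot_span_coroot i : coroot_span (cor i) = simple_coroot RB i.
Proof.
rewrite /coroot_span (bigD1 i) //= mxE !eqxx scale1r big1 ?addr0 // => j ji.
by rewrite mxE (negPf ji) andbF scale0r.
Qed.

Lemma root_coroot_span i c : sroot i (coroot_span c) = root i c.
Proof.
rewrite /coroot_span linear_sum; apply: eq_bigr => j _.
by rewrite linearZ /= simple_pairing.
Qed.

Lemma km_coroot_rels : chevalley_rels root cor (km_e RB) (km_f RB) km_coroot_h.
Proof.
have [hl ef hh he hf] := km_chevalley RB; rewrite /km_coroot_h.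
split=> [a x y|i j|x y|x i|x i].
- by rewrite coroot_span_linear hl.
- by rewrite ef coroot_span_coroot.
- exact: hh.
- by rewrite he root_coroot_span.
- by rewrite hf root_coroot_span.
Qed.

Definition to_km : g0 -> km_alg RB := chev_lift (km_e RB) (km_f RB) km_coroot_h.

Lemma to_km_hom : lie_hom to_km. Proof. exact: (chev_lift_hom km_coroot_rels). Qed.
Lemma to_km_e i : to_km (ce i) = km_e RB i. Proof. exact: (chev_lift_e km_coroot_rels). Qed.
Lemma to_km_f i : to_km (cf i) = km_f RB i. Proof. exact: (chev_lift_f km_coroot_rels). Qed.
Lemma to_km_h c : to_km (ch c) = km_h (coroot_span c).
Proof. exact: (chev_lift_h km_coroot_rels). Qed.

Lemma to_km_h_inj c : to_km (ch c) = 0 -> c = 0.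
Proof.
rewrite to_km_h => /km_h_inj c0; apply/rowP => i; rewrite [RHS]mxE.
exact: (free_enum (simple_coroot_free RB) c0).
Qed.

Lemma to_km_homogeneous g x : homogeneous ce cf ch g x ->
  homogeneous (km_e RB) (km_f RB) (km_h (R := RB)) g (to_km x).
Proof.
have crels := chev_alg_rels root cor; have rels := km_chevalley RB.
case/(homogeneous_cases crels) => [[_ gx]|[_ gx]|[-> [c ->]]|->].
- by apply: (homogeneous_pos rels); apply: (npos_hom to_km_hom to_km_e).
- by apply: (homogeneous_neg rels); apply: (npos_hom to_km_hom to_km_f).
- by rewrite to_km_h; apply: homogeneous_cartan.
- by rewrite (lie_hom0 to_km_hom); case: (homogeneous_subspace rels g).
Qed.

(** The kernel of [to_km] is graded: components are separated by their weights in g(B), where the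
    simple roots are independent. *)
Lemma to_km_kernel (L : lieAlgType K) (rho : g0 -> L) : lie_hom rho ->
  (forall g x, homogeneous ce cf ch g x -> to_km x = 0 -> rho x = 0) ->
  forall x, to_km x = 0 -> rho x = 0.
Proof.
move=> rho_hom rho0 x; have crels := chev_alg_rels root cor.
have [s [c [us Hc ->]]] := graded_decomposition crels (@chev_alg_generated _ _ _ root cor) x.
rewrite (lie_hom_sum to_km_hom) (lie_hom_sum rho_hom) => sum0.
rewrite big_seq big1 // => g gs; apply: rho0 (Hc g) _.
apply: (homogeneous_components (km_chevalley RB) (@root_independent _ _ _ RB)
  (J := fun z => z = 0) (c := fun g => to_km (c g)) _ _ us _ sum0 gs).
- by split=> [//|z z' -> ->|b z ->]; rewrite ?addr0 ?scaler0.
- by move=> z z' ->; rewrite lie0r.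
- by move=> g'; apply: to_km_homogeneous.
Qed.

(** The image [S] of [g0] is normalized by h, and [S' = S + h] is everything; as h is abelian, all
    brackets lie in [S]. *)
Lemma derived_to_km x : x \in derived_pred (L := km_alg RB) -> exists u, to_km u = x.
Proof.
have crels := chev_alg_rels root cor; have [hl ef hh he hf] := km_chevalley RB.
pose S (y : km_alg RB) := exists u, to_km u = y.
have subS : subalgebra S.
  split; first split=> [|_ _ [u <-] [v <-]|a _ [u <-]].
  - by exists 0; rewrite (lie_hom0 to_km_hom).
  - by exists (u + v); rewrite (lie_homD to_km_hom).
  - by exists (a *: u); rewrite (lie_homZ to_km_hom).
  - by move=> _ _ [u <-] [v <-]; exists [lie u, v]; rewrite (lie_homE to_km_hom).
have [[S0 SD SZ] SL] := subS.
have Sh c y : S y -> S [lie km_h c, y].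
  move=> [u <-].
  have [s [d [us Hd ->]]] := graded_decomposition crels (@chev_alg_generated _ _ _ root cor) u.
  rewrite (lie_hom_sum to_km_hom) lie_sumr; apply: subspace_sum => // g _.
  rewrite (homogeneous_weight (km_chevalley RB) (to_km_homogeneous (Hd g))).
  by apply: SZ; exists (d g).
pose S' (y : km_alg RB) := exists u c, y = u + km_h c /\ S u.
have subS' : subalgebra S'.
  split; first split=> [|_ _ [u [c [-> Su]]] [v [d [-> Sv]]]|a _ [u [c [-> Su]]]].
  - by exists 0, 0; rewrite (cartan0 (km_chevalley RB)) addr0.
  - exists (u + v), (c + d); rewrite (cartanD (km_chevalley RB)) addrACA.
    by split=> //; apply: SD.
  - exists (a *: u), (a *: c); rewrite (cartanZ (km_chevalley RB)) scalerDr.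
    by split=> //; apply: SZ.
  - move=> _ _ [u [c [-> Su]]] [v [d [-> Sv]]].
    exists ([lie u, v] - [lie km_h d, u] + [lie km_h c, v]), 0.
    rewrite (cartan0 (km_chevalley RB)) addr0; split.
      by rewrite lieDl !lieDr hh addr0 (lieC u (km_h d)).
    by apply: SD; [apply: (subspaceB (proj1 subS)); [apply: SL | apply: Sh] | apply: Sh].
have full y : S' y.
  apply: (@km_generated _ _ _ RB) subS' _ y => y [[i ->]|[i ->]|[c ->]].
  - exists (km_e RB i), 0; rewrite (cartan0 (km_chevalley RB)) addr0; split=> //.
    by exists (ce i); rewrite to_km_e.
  - exists (km_f RB i), 0; rewrite (cartan0 (km_chevalley RB)) addr0; split=> //.
    by exists (cf i); rewrite to_km_f.
  - by exists 0, c; rewrite add0r.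
move=> /asboolP[s ->]; apply: (subspace_sum (S := S)) => // -[y z] _ /=.
have [u [c [-> Su]]] := full y; have [v [d [-> Sv]]] := full z.
rewrite lieDl !lieDr hh addr0 (lieC u (km_h d)).
by apply: SD; [apply: (subspaceB (proj1 subS)); [apply: SL | apply: Sh] | apply: Sh].
Qed.

End DerivedAlgebra.

(** On generators, [e i = [h_i / 2, e i]], similarly for [f i], and [h_i = [e i, f i]]. *)
Lemma chev_lift_derived (K : numFieldType) m (B : 'M[int]_m) (L : lieAlgType K)
    (e f : 'I_m -> L) (h : 'rV[K]_m -> L) :
  chevalley_rels (mx_root B) (@mx_coroot K m) e f h -> (forall i, B i i = 2) ->
  forall u, chev_lift (root := mx_root B) (cor := @mx_coroot K m) e f h u
    \in derived_pred (L := L).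
Proof.
move=> rels B2 u; have [hl ef hh he hf] := rels; have rho_hom := chev_lift_hom rels.
have genD := @chev_alg_generated K m _ (mx_root B) (@mx_coroot K m).
have two0 : (2%:R : K) != 0 by rewrite pnatr_eq0.
have De i : e i \in derived_pred (L := L).
  have -> : e i = [lie 2%:R^-1 *: h (mx_coroot K i), e i].
    by rewrite lieZl he mx_root_coroot B2 scalerA mulVf // scale1r.
  exact: lie_derived.
have Df i : f i \in derived_pred (L := L).
  have -> : f i = [lie (- 2%:R^-1) *: h (mx_coroot K i), f i].
    by rewrite lieZl hf mx_root_coroot B2 scalerA mulrNN mulVf // scale1r.
  exact: lie_derived.
have Dh c : h c \in derived_pred (L := L).
  rewrite (row_sum_delta c).
  have -> : h (\sum_j c 0 j *: delta_mx 0 j) = \sum_j c 0 j *: [lie e j, f j].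
    elim/big_rec2: _ => [|i y1 y2 _ <-]; first exact: (cartan0 rels).
    by rewrite (cartanD rels) (cartanZ rels) ef eqxx.
  by apply: rpred_sum => j _; apply/rpredZ/lie_derived.
apply: (genD (fun u => chev_lift e f h u \in derived_pred (L := L))).
  split; first split=> [|x y Dx Dy|a x Dx].
  - by rewrite (lie_hom0 rho_hom) rpred0.
  - by rewrite (lie_homD rho_hom) rpredD.
  - by rewrite (lie_homZ rho_hom) rpredZ.
  - by move=> x y _ _; rewrite (lie_homE rho_hom) lie_derived.
move=> x [[i ->]|[i ->]|[c ->]].
- by rewrite (chev_lift_e rels).
- by rewrite (chev_lift_f rels).
- by rewrite (chev_lift_h rels).
Qed.

Section PiSystem.
Variables (K : numFieldType) (n : nat) (A : 'M[int]_n).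
Hypotheses (hA : is_gcm A) (hAs : symmetrizable A).
Variable RA : realization K A.
Variables (m : nat) (beta : 'I_m -> 'Hom(cartan RA, K^o)).
Hypothesis hpi : pi_system beta.
Variable betav : 'I_m -> cartan RA.
Hypothesis hbetav : forall i, real_root_coroot (beta i) (betav i).
Variable B : 'M[int]_m.
Hypothesis hB : forall i j, (B i j)%:~R = beta j (betav i) :> K.

Lemma real_root_weyl i : exists w k, [/\ weyl w, betav i = w (simple_coroot RA k)
  & forall y, beta i (w y) = simple_root RA k y].
Proof.
have [w [k [ww bE ->]]] := hbetav i; exists w, k; split=> // y.
have [wK _] := weyl_inverse hA ww.
by rewrite bE /weyl_dual lfunE /= wK.
Qed.

Lemma pi_matrix_diag i : B i i = 2.
Proof.
have [w [k [_ bv bw]]] := real_root_weyl i; have [A2 _ _] := hA.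
by apply: (@intr_inj K); rewrite hB bv bw simple_pairing A2.
Qed.

Lemma pi_matrix_symmetrizable : exists a : 'I_m -> K, (forall i, 0 < a i) /\
  forall i j, a i * (B i j)%:~R = a j * (B j i)%:~R.
Proof.
have [dq [dq_gt0 dq_sym]] := hAs.
pose d i : K := ratr (dq 0 i).
have d_gt0 i : 0 < d i by rewrite ltr0q.
have d_sym i j : d i * (A i j)%:~R = d j * (A j i)%:~R.
  have := congr1 (fun M : 'M_n => M j i) dq_sym.
  rewrite mul_diag_mx !mxE => /(congr1 (ratr : rat -> K)).
  by rewrite !rmorphM /= !ratr_int.
have [kc kcP] := choice (fun i => let: ex_intro k (ex_intro c P) :=
    real_root_comb hA d_gt0 d_sym (hbetav i) in
  ex_intro (fun kc : 'I_n * ('I_n -> K) => betav i = coroot_comb RA kc.2 /\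
    forall y, beta i y = d kc.1 * root_comb d kc.2 y) (k, c) P).
(* [beta j (betav i)] is [d k_j] times a symmetric form, so multiplying it by [d k_i] makes it
   symmetric. *)
exists (fun i => d (kc i).1); split=> // i j.
rewrite !hB; have [-> bi] := kcP i; have [-> bj] := kcP j.
by rewrite bi bj mulrCA; congr (_ * (_ * _)); apply: root_comb_sym.
Qed.

Variables (ep em : 'I_m -> km_alg RA).
Hypothesis hep : forall i, ep i != 0 /\ in_root_space (beta i) (ep i).
Hypothesis hem : forall i, em i != 0 /\ in_root_space (- beta i) (em i).
Hypothesis hepm : forall i, [lie ep i, em i] = km_h (betav i).

Definition pi_h (c : 'rV[K]_m) : km_alg RA := km_h (\sum_i c 0 i *: betav i).

Lemma pi_rels : chevalley_rels (mx_root B) (@mx_coroot K m) ep em pi_h.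
Proof.
have [hl ef hh he hf] := km_chevalley RA.
have [beta_inj _ beta_pi] := hpi.
have rootE i (c : 'rV[K]_m) : beta i (\sum_j c 0 j *: betav j) = mx_root B i c.
  rewrite linear_sum; apply: eq_bigr => j _.
  by rewrite linearZ /= -hB.
rewrite /pi_h; split=> [a x y|i j|x y|x i|x i].
- rewrite -hl scaler_sumr -big_split; congr km_h; apply: eq_bigr => i _.
  by rewrite !mxE scalerDl scalerA.
- case: eqP => [<-|/eqP ij].
    rewrite hepm; congr km_h; rewrite (bigD1 i) //= mxE !eqxx scale1r.
    by rewrite big1 ?addr0 // => k ki; rewrite mxE (negPf ki) andbF scale0r.
  (* A nonzero [[ep i, em j]] would be a root vector for [beta i - beta j]. *)
  apply: contrapT => /eqP b0; apply: (beta_pi i j ij); split.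
    by rewrite subr_eq0; apply: contraNneq ij => /beta_inj ->.
  exists [lie ep i, em j]; split=> // y.
  rewrite lieAr (proj2 (hep i)) (proj2 (hem j)) lieZl lieZr -scalerDl.
  by rewrite [in RHS]lfunE.
- exact: hh.
- by rewrite (proj2 (hep i)) rootE.
- by rewrite (proj2 (hem i)) lfunE /= rootE.
Qed.

Lemma pi_e_nilpotent i x : ad_nilpotent (ep i) x.
Proof.
have [w [k [ww _ bw]]] := real_root_weyl i.
exact: (real_root_nilpotent hA ww bw (proj2 (hep i))).
Qed.

Lemma pi_f_nilpotent i x : ad_nilpotent (em i) x.
Proof.
have [w [k [ww _ bw]]] := real_root_weyl i.
(* [- beta i] is the image of the simple root [k] under [w] composed with the simple reflection
   [k]. *)
apply: (real_root_nilpotent hA (w := (w \o simple_refl RA k)%VF) (k := k) _ _ (proj2 (hem i))).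
  by apply: weyl_comp => //; apply: weyl_refl.
have [A2 _ _] := hA => y; rewrite !lfunE /= bw root_simple_refl A2; ring.
Qed.

Lemma pi_system_hom (RB : realization K B) :
  exists! phi : km_derived RB -> km_derived RA,
    lie_hom phi /\
    forall i,
      [/\ phi (km_e' RB i) = ep i :> km_alg RA,
          phi (km_f' RB i) = em i :> km_alg RA
        & phi [lie km_e' RB i, km_f' RB i] = km_h (betav i) :> km_alg RA].
Proof.
have [a [a_gt0 a_sym]] := pi_matrix_symmetrizable.
have B2 := pi_matrix_diag; have rels := pi_rels.
pose rho := chev_lift (root := mx_root B) (cor := @mx_coroot K m) ep em pi_h.
have rho_hom : lie_hom rho := chev_lift_hom rels.
have rho_der u : rho u \in derived_pred (L := km_alg RA) by apply: chev_lift_derived.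
pose pi := to_km RB; have pi_hom : lie_hom pi := to_km_hom RB.
have pi_der u : pi u \in derived_pred (L := km_alg RB).
  by apply: chev_lift_derived => //; apply: km_coroot_rels.
have ker u : pi u = 0 -> rho u = 0.
  apply: to_km_kernel => // g x.
  by apply: (kernel_homogeneous a_sym B2 a_gt0 rels pi_e_nilpotent pi_f_nilpotent
    (to_km_hom RB) (@to_km_h_inj _ _ _ RB)).
have ker2 u v : pi u = pi v -> rho u = rho v.
  move=> uv; apply: subr0_eq; rewrite -scaleN1r -(lie_homZ rho_hom) -(lie_homD rho_hom).
  by apply: ker; rewrite (lie_homD pi_hom) (lie_homZ pi_hom) uv scaleN1r subrr.
have surj (x : km_derived RB) : exists u, pi u = x.
  by case: x => x xd; apply: derived_to_km.
(* [phi] is [rho] of an arbitrary preimage under [pi]; [ker2] makes the choice immaterial. *)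
have [lift liftP] := choice surj.
pose phi (x : km_derived RB) : km_derived RA := Derived (rho_der (lift x)).
have phiE x u : pi u = derived_val x -> derived_val (phi x) = rho u.
  by move=> ux; apply: ker2; rewrite liftP.
have phi_hom : lie_hom phi.
  split=> [c x y|x y]; apply: val_inj.
    rewrite [LHS](phiE _ (c *: lift x + lift y)).
      by rewrite (lie_homD rho_hom) (lie_homZ rho_hom).
    by rewrite (lie_homD pi_hom) (lie_homZ pi_hom) !liftP.
  rewrite [LHS](phiE _ [lie lift x, lift y]); first by rewrite (lie_homE rho_hom).
  by rewrite (lie_homE pi_hom) !liftP.
have phi_e i : derived_val (phi (km_e' RB i)) = ep i.
  by rewrite (phiE _ (chev_e _ _ i)) ?/rho ?(chev_lift_e rels) // /pi to_km_e.
have phi_f i : derived_val (phi (km_f' RB i)) = em i.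
  by rewrite (phiE _ (chev_f _ _ i)) ?/rho ?(chev_lift_f rels) // /pi to_km_f.
exists phi; split.
  split=> // i; split=> //; rewrite (lie_homE phi_hom).
  by rewrite -[LHS]/[lie derived_val (phi _), derived_val (phi _)] phi_e phi_f hepm.
(* Uniqueness is checked on [g0], which maps onto g'(B): there [rho] and [psi] after [pid] agree on
   generators. *)
move=> psi [psi_hom psiP]; apply/funext => x; apply: val_inj.
pose pid u : km_derived RB := Derived (pi_der u).
have pid_hom : lie_hom pid.
  split=> [c u v|u v]; apply: val_inj => /=.
    by rewrite (lie_homD pi_hom) (lie_homZ pi_hom).
  by rewrite (lie_homE pi_hom).
have val_hom : lie_hom (fun y : km_derived RA => derived_val y) by [].
have psid_hom : lie_hom (fun u => derived_val (psi (pid u))).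
  exact: (lie_hom_comp val_hom (lie_hom_comp psi_hom pid_hom)).
have -> : x = pid (lift x) by apply: val_inj; rewrite /= liftP.
rewrite -[val (psi _)]/(derived_val (psi (pid (lift x)))).
rewrite [LHS](phiE _ (lift x)) //.
apply: (chev_hom_ext rho_hom psid_hom) => i.
- have [pe _ _] := psiP i; rewrite /rho (chev_lift_e rels) -pe.
  by congr (derived_val (psi _)); apply: val_inj; rewrite /= /pi to_km_e.
- have [_ pf _] := psiP i; rewrite /rho (chev_lift_f rels) -pf.
  by congr (derived_val (psi _)); apply: val_inj; rewrite /= /pi to_km_f.
Qed.

End PiSystem.

Theorem theorem2p5 (R : realType) (n : nat) (A : 'M[int]_n)
    (hA : is_gcm A) (hAs : symmetrizable A) (RA : realization R[i] A)
    (m : nat) (beta : 'I_m -> 'Hom(cartan RA, R[i]^o)) (hpi : pi_system beta)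
    (betav : 'I_m -> cartan RA)
    (hbetav : forall i, real_root_coroot (beta i) (betav i))
    (B : 'M[int]_m)
    (hB : forall i j, (B i j)%:~R = beta j (betav i) :> R[i])
    (RB : realization R[i] B)
    (ep em : 'I_m -> km_alg RA)
    (hep : forall i, ep i != 0 /\ in_root_space (beta i) (ep i))
    (hem : forall i, em i != 0 /\ in_root_space (- beta i) (em i))
    (hepm : forall i, [lie ep i, em i] = km_h (betav i)) :
  exists! phi : km_derived RB -> km_derived RA,
    lie_hom phi /\
    forall i,
      [/\ phi (km_e' RB i) = ep i :> km_alg RA,
          phi (km_f' RB i) = em i :> km_alg RA
        & phi [lie km_e' RB i, km_f' RB i] = km_h (betav i) :> km_alg RA].
Proof. exact: (pi_system_hom hA hAs hpi hbetav hB hep hem hepm). Qed.
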